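(* As $k\to\infty$, $$\gamma_k\ge\big(e^{\gamma}+o(1)\big)\frac{\log\log k}{\log k},$$ where $\gamma$ on the right is Euler's constant.
   Context: For $k\ge2$, $S_k=\{0\}\cup\{\xi\in\mathbb C:\xi^k=1\}$ and $\mathcal F(S_k)$ is the class of completely multiplicative $f:\mathbb N\to\mathbb C$ with $f(p)\in S_k$ for all primes $p$. For $A\ge1$, $\varepsilon>0$, say $f$ satisfies $C_k(\varepsilon,X,A)$ if $|\sum_{n\le x}f(n)^j|\le\varepsilon x$ for all $1\le j\le k-1$ and all $X\le x\le X^A$. Define $$\gamma_k(A)=\lim_{\varepsilon\to0^+}\limsup_{X\to\infty}\ \sup_{f\in\mathcal F(S_k),\ f\text{ satisfies }C_k(\varepsilon,X,A)}\frac1{\log X}\Big|\sum_{n\le X}\frac{f(n)}n\Big|$$ (empty supremum $=0$), which is non-increasing in $A$, and $\gamma_k=\lim_{A\to\infty}\gamma_k(A)$. *)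

(* Defs.v *)
From HB Require Import structures.
From mathcomp Require Import all_boot all_order all_algebra.
From mathcomp Require Import all_classical all_reals all_analysis.
From mathcomp Require Export complex.

Set Implicit Arguments.
Unset Strict Implicit.
Unset Printing Implicit Defensive.

Import Order.TTheory GRing.Theory Num.Theory.
Import numFieldNormedType.Exports.

Local Open Scope classical_set_scope.
Local Open Scope complex_scope.
Local Open Scope ring_scope.

(* Arithmetic functions are maps nat -> R[i] whose value at 0 is irrelevant:
   no condition and no sum below involves it. *)
Definition completely_multiplicative (R : realType) (f : nat -> R[i]) : Prop :=
  f 1%N = 1 /\
  forall m n : nat, (0 < m)%N -> (0 < n)%N -> f (m * n)%N = f m * f n.

Definition S_ (R : realType) (k : nat) : set R[i] :=
  [set 0] `|` [set xi | xi ^+ k = 1].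
Arguments S_ : clear implicits.

Definition calF (R : realType) (k : nat) : set (nat -> R[i]) :=
  [set f | completely_multiplicative f /\ forall p, prime p -> S_ R k (f p)].
Arguments calF : clear implicits.

(* The sum of F n over the integers 1 <= n <= x, for real x >= 0. *)
Definition psum (R : realType) (F : nat -> R[i]) (x : R) : R[i] :=
  \sum_(1 <= n < (Num.truncn x).+1) F n.

(* [Normc.normc] is the complex modulus with values in R; the generic norm
   on R[i] takes its values in R[i]. *)
Definition satisfies_C (R : realType) (k : nat) (eps X A : R)
    (f : nat -> R[i]) : Prop :=
  forall j : nat, (1 <= j <= k.-1)%N ->
  forall x : R, X <= x <= X `^ A ->
  Normc.normc (psum (fun n => f n ^+ j) x) <= eps * x.

Definition log_means (R : realType) (k : nat) (eps X A : R) : set (\bar R) :=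
  [set ((ln X)^-1 * Normc.normc (psum (fun n => f n / n%:R) X))%:E
    | f in calF R k `&` [set f | satisfies_C k eps X A f]].

(* The supremum of the empty set is 0 here, whereas [ereal_sup set0 = -oo]. *)
Definition sup_log_means (R : realType) (k : nat) (eps X A : R) : \bar R :=
  if log_means k eps X A == set0 then 0%E
  else ereal_sup (log_means k eps X A).

(* [lim] is total, but both limits below exist: for X > 1 the quantity
   [sup_log_means k eps X A] is nondecreasing in eps and nonincreasing in A,
   and monotone functions with values in \bar R converge. *)
Definition gamma_at (R : realType) (k : nat) (A : R) : \bar R :=
  lim (limf_esup (fun X : R => sup_log_means k eps X A) +oo%R
       @[eps --> (0 : R)^'+]).

Definition gamma_ (R : realType) (k : nat) : \bar R :=
  lim (@gamma_at R k A @[A --> +oo%R]).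
Arguments gamma_ : clear implicits.

(* [series harmonic n] is 1 + 1/2 + ... + 1/n. *)
Definition euler_mascheroni (R : realType) : R :=
  limn (fun n : nat => series (@harmonic R) n - ln n%:R).
Arguments euler_mascheroni : clear implicits.

(* Main.v *)
Require Import Defs.
From mathcomp Require Import all_boot all_order all_algebra.
From mathcomp Require Import separable cyclic cyclotomic.
From mathcomp Require Import all_classical all_reals all_analysis.
From mathcomp Require Import ring lra zify.

(** For small primes take f(p) = 1, and for the larger ones let f(p) be an
  independent random k-th root of unity all of whose powers f(p)^j, k not
  dividing j, have mean 1 - phi(p); this is possible as soon as
  0 <= phi(p) <= k/(k-1).  A second moment estimate replaces the sums over f^j
  by sums over F(n) = prod_(p | n) (1 - phi(p)).

  If phi(p) is the density at log p of a renewal process with step X >= 1 (the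
  small primes being those with log p < 1, after rescaling), then the sum of
  mu(d) prod_(p | d) phi(p)/p over d <= x is the tail probability P(X > log x).
  Hence F has mean value 0 beyond the largest step, and its logarithmic mean is
  E X divided by that step.  The density is exactly 1 when P(X > t) is the
  Dickman function, and E X is then e^gamma.  Conditioning X on X <= m raises phi
  to at most 1 + m/(m!-1), by the maximum principle for the renewal equation;
  this stays below k/(k-1) for some m ~ log k / log log k.

  All this is done with log p rounded down to multiples of h, where h tends to
  infinity with X.  The Dickman function becomes the generating function
  exp(sum_(i <= r) z^i/i), whose value at 1 is asymptotic to r e^gamma, and since
  phi is normalised by the sum of 1/p over each bin, only Mertens' first theorem
  is needed. *)

Set Implicit Arguments.
Unset Strict Implicit.
Unset Printing Implicit Defensive.

Import Order.TTheory GRing.Theory Num.Theory.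
Import numFieldNormedType.Exports.
Local Open Scope classical_set_scope.
Local Open Scope ring_scope.

(** * Renewal sequences and the discrete Dickman function *)

(** Why the step must be bounded: the bound eps x has to hold already at x = X, with eps tending to
    0 while k is fixed. The Dickman tail is never 0, so pushing it below eps would send X to
    infinity and the ratio of E X to the length of the range to 0. A bounded step makes the main
    term vanish exactly, at the price of phi slightly above 1. The roots of unity allow an excess of
    1/(k-1), and m/(m!-1) < 1/(k-1) reads m(k-1) < m!-1; the least such m gives the best mean
    e^gamma/m. Order of choices: k fixes m, A fixes the ratio M of the range to r, eps and the other
    tolerances fix r, and only h grows with X. Hence constants such as 3^(M(r+1)) are harmless:
    everything quadratic in phi(p)/p involves primes p >= e^h only and costs a factor e^(-h).
    Rounding log p down shifts log d by less than one bin per prime factor, and the relevant d have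
    at most M of these since each lies in a bin beyond r; M bins are negligible against m r. *)

Lemma course_of_values_rec (T : Type) (x0 : T) (F : nat -> (nat -> T) -> T)
  (F_ext : forall n f g, (forall i, (i < n)%N -> f i = g i) -> F n f = F n g) :
  exists f : nat -> T, forall n, f n = F n f.
Proof.
(* [G n] tabulates the solution below [n]; by [F_ext] its other entries are never consulted. *)
pose G := fix G n : nat -> T :=
  if n is n'.+1 then fun i => if (i < n')%N then G n' i else F n' (G n')
  else fun=> x0.
have GE n i : (i < n)%N -> G n i = G i.+1 i.
  elim: n => // n IHn; rewrite ltnS leq_eqVlt => /predU1P[->//|lt_in].
  by rewrite /= lt_in IHn //= ltnn.
exists (fun n => G n.+1 n) => n; rewrite /= ltnn.
by apply: F_ext => i lt_in; rewrite GE.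
Qed.

(* [rho n] is the proportion of permutations of [n] points without cycles longer
   than [r], a discrete analogue of the Dickman function. *)
Definition dickman_seq {R : realType} (r : nat) (rho : nat -> R) : Prop :=
  rho 0%N = 1 /\
  forall n, n.+1%:R * rho n.+1 = \sum_(n.+1 - r <= j < n.+1) rho j.

Lemma dickman_seq_exists (R : realType) (r : nat) :
  exists rho : nat -> R, dickman_seq r rho.
Proof.
pose F n (f : nat -> R) := if n is n'.+1 then
  n%:R^-1 * \sum_(n'.+1 - r <= j < n'.+1) f j else 1.
have [|rho rhoE] := @course_of_values_rec R 0 F.
  case=> //= n f g fg; congr (_ * _); apply: eq_big_nat => j /andP[_ ltjn].
  exact: fg.
exists rho; split=> [|n]; first by rewrite rhoE.
by rewrite [in LHS]rhoE /F mulVKf // pnatr_eq0.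
Qed.

Lemma dickman_init (R : realType) r (rho : nat -> R) :
  dickman_seq r rho -> forall n, (n <= r)%N -> rho n = 1.
Proof.
move=> [rho0 rhoS]; elim/ltn_ind=> -[//|n] IHn le_nr.
have n0 : n.+1%:R != 0 :> R by rewrite pnatr_eq0.
apply: (mulfI n0); rewrite rhoS mulr1.
have -> : (n.+1 - r = 0)%N by lia.
rewrite (eq_big_nat _ _ (F2 := fun=> 1)) => [|i /andP[_ lt_in]].
  by rewrite big_mkord sumr_const card_ord.
by apply: IHn => //; lia.
Qed.

Lemma dickman_ge0 (R : realType) r (rho : nat -> R) :
  dickman_seq r rho -> forall n, 0 <= rho n.
Proof.
move=> [rho0 rhoS]; elim/ltn_ind=> -[|n] IHn; first by rewrite rho0.
rewrite -(pmulr_rge0 _ (ltr0Sn R n)) rhoS big_nat sumr_ge0 // => i /andP[_ lt_in].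
exact: IHn.
Qed.

(** Difference of two consecutive recurrences; the discrete form of the delay equation u rho'(u) = -
    rho(u - 1). *)
Lemma dickman_step (R : realType) r (rho : nat -> R) :
  dickman_seq r rho -> (0 < r)%N -> forall n, (r <= n)%N ->
  n.+1%:R * (rho n - rho n.+1) = rho (n - r)%N.
Proof.
move=> [rho0 rhoS] r_gt0 [|n] le_rn; first by lia.
have E1 := rhoS n; rewrite big_ltn in E1; last by lia.
have E2 := rhoS n.+1; rewrite subSn // big_nat_recr /= in E2; last by lia.
rewrite mulrBr E2 -[n.+2]add1n natrD mulrDl E1.
by set S := \sum_(_ <= _ < _) _; ring.
Qed.

Lemma dickman_nonincreasing (R : realType) r (rho : nat -> R) :
  dickman_seq r rho -> (0 < r)%N -> {homo rho : m n / (m <= n)%N >-> n <= m}.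
Proof.
move=> rhoP r_gt0; apply: homo_leq => // [y x z yx zy|n]; first exact: le_trans zy yx.
have [lt_nr|le_rn] := ltnP n r.
  by rewrite !(dickman_init rhoP) // ltnW.
rewrite -subr_ge0 -(pmulr_rge0 _ (ltr0Sn R n)) (dickman_step rhoP) //.
exact: dickman_ge0 rhoP _.
Qed.

(** The window that defines [rho (j.+1 * r)] has [r] terms, none larger than [rho (j * r)], so each
    block of length [r] gains a factor [1 / j.+1]. *)
Lemma dickman_decay (R : realType) r (rho : nat -> R) :
  dickman_seq r rho -> (0 < r)%N -> forall j, rho (j * r)%N <= j`!%:R^-1.
Proof.
move=> rhoP r_gt0; elim=> [|j IHj].
  by rewrite mul0n rhoP.1 fact0 invr1.
rewrite factS natrM invfM.
have r0 : 0 < (j.+1 * r)%:R :> R by rewrite ltr0n muln_gt0.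
have step : (j.+1 * r)%:R * rho (j.+1 * r)%N <= r%:R * rho (j * r)%N.
  have E : (j.+1 * r = (j.+1 * r).-1.+1)%N by rewrite prednK // muln_gt0.
  rewrite E rhoP.2 -E.
  have -> : (j.+1 * r - r = j * r)%N by rewrite mulSn addKn.
  apply: (@le_trans _ _ (\sum_(j * r <= i < j.+1 * r) rho (j * r)%N)).
    rewrite !big_nat ler_sum // => i /andP[le_ji _].
    exact: dickman_nonincreasing rhoP r_gt0 _ _ le_ji.
  by rewrite sumr_const_nat mulSn addnK mulr_natl.
have j0 : 0 < j.+1%:R :> R by rewrite ltr0n.
rewrite natrM -mulrA (mulrCA _ r%:R) ler_pM2l ?ltr0n // in step.
by rewrite -(ler_pM2l j0) mulVKf ?gt_eqF //; apply: le_trans step IHj.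
Qed.

Lemma sum_inv_fact (R : realType) (j J : nat) : (0 < j <= J)%N ->
  \sum_(j <= i < J) i`!%:R^-1 <= 2 / j`!%:R :> R.
Proof.
move=> /andP[j0 le_jJ].
suff : \sum_(j <= i < J) i`!%:R^-1 <= 2 / j`!%:R - 2 / J`!%:R :> R.
  by move/le_trans; apply; rewrite lerBlDr lerDl divr_ge0.
rewrite -[leRHS]opprB -(telescope_sumr (fun i => 2 / i`!%:R)) // -sumrN !big_nat.
apply: ler_sum => i /andP[le_ji _]; rewrite opprB factS natrM invfM mulrA.
rewrite -[leLHS]mul1r -mulrBl ler_wpM2r // lerBrDl.
have i1 : 1 <= i%:R :> R by rewrite ler1n; lia.
by rewrite -lerBrDr ler_pdivrMr ?ltr0n // -natr1; lra.
Qed.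

Lemma expR_le_approx (R : realType) (x c : R) :
  (forall n, \sum_(i < n) x ^+ i / i`!%:R <= c) -> expR x <= c.
Proof.
move=> le_c; apply: limr_le; first exact: is_cvg_series_exp_coeff.
by near=> n; rewrite /series /= big_mkord; apply: le_c.
Unshelve. all: by end_near. Qed.

(** Differentiation lowers the order of a truncated exponential by one; this drives the induction on
    the order in [dickman_exp_coef]. *)
Lemma deriv_exp_approx (R : realType) (h : {poly R}) K :
  (\sum_(l < K.+1) l`!%:R^-1 *: h ^+ l)^`() =
  h^`() * \sum_(l < K) l`!%:R^-1 *: h ^+ l.
Proof.
rewrite raddf_sum /= big_ord_recl /= expr0 derivZ derivC scaler0 add0r.
rewrite mulr_sumr; apply: eq_bigr => l _; rewrite derivZ deriv_exp.
rewrite /bump /= add1n -scalerAr -scalerMnr scalerMnl factS natrM invfM -mulr_natl mulrA.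
by rewrite mulfV ?mul1r // pnatr_eq0.
Qed.

Lemma coef_geometric_mul (R : realType) (r n : nat) (p : {poly R}) :
  ((\sum_(i < r) 'X^i) * p)`_n = \sum_(n.+1 - r <= j < n.+1) p`_j.
Proof.
rewrite mulr_suml coef_sum.
under eq_bigr do rewrite coefXnM.
elim: r => [|r IHr]; first by rewrite big_ord0 subn0 big_geq.
rewrite big_ord_recr /= IHr; case: ltnP => [lt_nr|le_rn].
  by rewrite addr0; congr bigop; congr index_iota; lia.
have -> : (n.+1 - r = (n - r).+1)%N by lia.
by rewrite subSS [in RHS]big_ltn ?ltnS ?leq_subr // addrC.
Qed.

Lemma deriv_harmonic_poly (R : realType) (r : nat) :
  deriv (\sum_(i < r) i.+1%:R^-1 *: 'X^(i.+1)) = \sum_(i < r) 'X^i :> {poly R}.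
Proof.
rewrite raddf_sum /=; apply: eq_bigr => i _.
by rewrite derivZ derivXn /= -scalerMnr scalerMnl -mulr_natl mulfV ?scale1r ?pnatr_eq0.
Qed.

(** The generating function of [rho] is exp(h) with h = sum of X^i/i for i <= r. Truncating the
    exponential keeps everything polynomial: order K+1 at n+1 is the window sum of order K, which
    the recurrence of [rho] dominates. *)
Lemma dickman_exp_coef (R : realType) r (rho : nat -> R) :
  dickman_seq r rho -> forall K n,
  (\sum_(l < K) l`!%:R^-1 *: (\sum_(i < r) i.+1%:R^-1 *: 'X^(i.+1)) ^+ l)`_n
    <= rho n.
Proof.
move=> rhoP; set h := \sum_(_ < r) _; elim=> [|K IHK] n.
  by rewrite big_ord0 coef0 (dickman_ge0 rhoP).
case: n => [|n].
  rewrite coef_sum big_ord_recl /= fact0 invr1 scale1r expr0 coef1 rhoP.1.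
  rewrite big1 ?addr0 // => l _; rewrite coefZ.
  suff -> : (h ^+ l.+1)`_0 = 0 by rewrite mulr0.
  rewrite exprS coef0M -[h`_0]horner_coef0 horner_sum big1 ?mul0r // => i _.
  by rewrite hornerZ hornerXn exprS mul0r mulr0.
rewrite -(ler_pM2l (ltr0Sn R n)) rhoP.2 mulr_natl -coef_deriv.
rewrite deriv_exp_approx deriv_harmonic_poly coef_geometric_mul !big_nat.
exact: ler_sum.
Qed.

(** Evaluation at 1 of the truncated exponentials. The tail from [j * r] on is cut into blocks of
    length [r], the i-th of which is at most [r / i!]. *)
Lemma dickman_sum (R : realType) r (rho : nat -> R) :
  dickman_seq r rho -> (0 < r)%N -> forall j, (0 < j)%N ->
  expR (\sum_(i < r) i.+1%:R^-1) <=
  \sum_(0 <= n < j * r) rho n + r%:R * (2 / j`!%:R).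
Proof.
move=> rhoP r_gt0 j j_gt0; apply: expR_le_approx => K.
set h : {poly R} := \sum_(i < r) i.+1%:R^-1 *: 'X^(i.+1).
set T : {poly R} := \sum_(l < K) l`!%:R^-1 *: h ^+ l.
have -> : \sum_(l < K) (\sum_(i < r) i.+1%:R^-1) ^+ l / l`!%:R = T.[1] :> R.
  rewrite horner_sum; apply: eq_bigr => l _; rewrite hornerZ horner_exp mulrC.
  rewrite /h horner_sum; congr (_ * _ ^+ _); apply: eq_bigr => i _.
  by rewrite hornerZ hornerXn expr1n mulr1.
(* The degree of [T] depends on K, so the sum is first extended to a multiple of [r] that covers all
   of [T]. *)
pose J := maxn j (size T).
have le_TJ : (size T <= J * r)%N.
  by rewrite (leq_trans (leq_maxr j _)) // leq_pmulr.
rewrite (horner_coef_wide _ le_TJ) -(big_mkord xpredT (fun i => T`_i * 1 ^+ i)).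
apply: (@le_trans _ _ (\sum_(0 <= n < J * r) rho n)).
  apply: ler_sum_nat => n _; rewrite expr1n mulr1; exact: dickman_exp_coef.
rewrite (@big_cat_nat _ _ _ (j * r)) //=; last by rewrite leq_mul2r leq_maxl orbT.
rewrite lerD2l; apply: le_trans (_ : _ <= r%:R * \sum_(j <= i < J) i`!%:R^-1) _; last first.
  by rewrite ler_pM2l ?ltr0n // sum_inv_fact // j_gt0 leq_maxl.
have: (j <= J)%N by rewrite leq_maxl.
elim: (J) => [|i IHi]; first by rewrite leqn0 => /eqP->; rewrite mul0n !big_geq ?mulr0.
rewrite leq_eqVlt => /predU1P[<-|]; first by rewrite !big_geq ?mulr0.
rewrite ltnS => le_ji.
rewrite (@big_cat_nat _ _ _ (i * r)) ?leq_mul2r ?leqnSn ?le_ji ?orbT //=.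
rewrite [in leRHS]big_nat_recr //= mulrDr lerD ?IHi //.
apply: (@le_trans _ _ (\sum_(i * r <= n < i.+1 * r) rho (i * r)%N)).
  rewrite !big_nat ler_sum // => n /andP[le_in _].
  exact: dickman_nonincreasing rhoP r_gt0 _ _ le_in.
rewrite sumr_const_nat mulSn addnK -[leLHS]mulr_natl ler_wpM2l //.
exact: dickman_decay.
Qed.

(** * Renewal sequences with bounded step *)

(** With generating functions, Phi = X W' + W Phi, that is Phi = X W' / (1 - W) and 1 - W = exp(-
    sum phi_n X^n / n). The last expression is the counterpart of the product of the 1 - phi(p)/p,
    which is how [phi] becomes a weight on primes. *)
Definition renewal_pair {R : realType} (r D : nat) (w phi : nat -> R) : Prop :=
  [/\ forall n, 0 <= w n,
      forall n, (n <= r)%N \/ (D < n)%N -> w n = 0,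
      \sum_(0 <= n < D.+1) w n = 1 &
      forall n, phi n = n%:R * w n + \sum_(1 <= l < n.+1) w l * phi (n - l)%N].

Lemma renewal_density_exists (R : realType) (w : nat -> R) :
  exists phi : nat -> R,
  forall n, phi n = n%:R * w n + \sum_(1 <= l < n.+1) w l * phi (n - l)%N.
Proof.
apply: (course_of_values_rec 0) => n f g fg; congr (_ + _).
by apply: eq_big_nat => l /andP[l0 ln]; rewrite fg //; lia.
Qed.

Lemma renewal_ge0 (R : realType) r D (w phi : nat -> R) :
  renewal_pair r D w phi -> forall n, 0 <= phi n.
Proof.
move=> [w_ge0 _ _ phiE]; elim/ltn_ind => n IHn; rewrite phiE.
rewrite addr_ge0 ?mulr_ge0 // big_nat sumr_ge0 // => l /andP[l0 ln].
by rewrite mulr_ge0 // IHn //; lia.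
Qed.

Lemma renewal_init (R : realType) r D (w phi : nat -> R) :
  renewal_pair r D w phi -> forall n, (n <= r)%N -> phi n = 0.
Proof.
move=> [_ w0 _ phiE] n le_nr; rewrite phiE w0 ?mulr0; last by left.
rewrite big_nat big1 ?addr0 // => l /andP[l0 ln]; rewrite w0 ?mul0r //; left; lia.
Qed.

(* The step distribution is the decrement of [rho] conditioned on being at most
   [m * r]; without conditioning, [phi] would be the indicator of [n > r]. *)
Lemma dickman_renewal (R : realType) (r m : nat) : (0 < r)%N -> (1 < m)%N ->
  exists w phi : nat -> R,
  [/\ renewal_pair r (m * r) w phi,
      forall n, phi n <= 1 + m%:R / (m`!%:R - 1) &
      expR (\sum_(i < r) i.+1%:R^-1) - r%:R * (2 / (m.-1)`!%:R) <=
      \sum_(0 <= n < (m * r).+1) n%:R * w n].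
Proof.
move=> r_gt0 m_gt1; have [rho rhoP] := dickman_seq_exists R r.
set D := (m * r)%N; have mD : (r < D)%N by rewrite /D; nia.
pose q := rho D; have q_ge0 : 0 <= q by apply: dickman_ge0 rhoP _.
have mfact : 2 <= m`!%:R :> R.
  by rewrite ler_nat; apply: leq_trans m_gt1 _; rewrite fact_geq.
have q_le : q <= m`!%:R^-1 by apply: dickman_decay.
have q_lt1 : q < 1.
  by apply: le_lt_trans q_le _; rewrite invf_lt1; lra.
(* 1/(1 - q) = 1 + kappa, so [kappa] measures the inflation caused by the conditioning. *)
pose kappa := q / (1 - q).
have kappa_ge0 : 0 <= kappa by rewrite divr_ge0 //; lra.
have kappa_le : kappa <= (m`!%:R - 1)^-1.
  rewrite /kappa ler_pdivrMr ?subr_gt0 // ler_pdivlMl; last by lra.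
  move: q_le; rewrite -[_^-1]mul1r ler_pdivlMr; last by lra.
  by move=> ?; nra.
pose w n : R := if n is n'.+1 then
   if (n <= D)%N then (rho n' - rho n) / (1 - q) else 0 else 0.
have [phi phiE] := renewal_density_exists w.
have w_ge0 n : 0 <= w n.
  case: n => //= n; case: ifP => // _; rewrite divr_ge0 ?subr_ge0 ?(ltW q_lt1) //.
  exact: dickman_nonincreasing rhoP r_gt0 _ _ (leqnSn n).
have w0 n : (n <= r)%N \/ (D < n)%N -> w n = 0.
  case: n => //= n [nr|]; last by rewrite ltnNge => /negbTE->.
  by rewrite !(dickman_init rhoP) ?subrr ?mul0r ?if_same // ltnW.
have wS n : (n <= D)%N -> \sum_(0 <= l < n.+1) w l = (1 - rho n) / (1 - q).
  elim: n => [|n IHn] nD; first by rewrite big_nat1 rhoP.1 subrr mul0r.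
  rewrite big_nat_recr //= IHn ?(ltnW nD) // nD -mulrDl.
  by congr (_ / _); ring.
have nw n : (r <= n < D)%N -> n.+1%:R * w n.+1 = rho (n - r)%N / (1 - q).
  by move=> /andP[rn nD]; rewrite /= nD mulrA (dickman_step rhoP).
have wT : \sum_(0 <= l < D.+1) w l = 1 by rewrite wS // divff ?subr_eq0 1?eq_sym ?lt_eqF.
have P : renewal_pair r D w phi by split.
have w_le1 n : \sum_(0 <= l < n.+1) w l <= 1.
  have [nD|Dn] := leqP n D.
    rewrite wS // ler_pdivrMr ?subr_gt0 // mul1r lerD2l lerN2.
    exact: dickman_nonincreasing rhoP r_gt0 _ _ nD.
  rewrite (@big_cat_nat _ _ _ D.+1) //=; last by lia.
  rewrite wT [X in _ + X]big_nat big1 ?addr0 // => i /andP[Di _].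
  by rewrite w0 //; right.
(* The bound grows with slope [kappa / r.+1]: every step is at least [r.+1], so going back one step
   lowers it by [kappa], exactly the excess created by the conditioning. *)
have main n : (r < n)%N -> phi n <= 1 + kappa * (minn n D)%:R / r.+1%:R.
  elim/ltn_ind: n => n IHn rn.
  have bound B : 0 <= B -> (forall l, (r < l < n - r)%N ->
      1 + kappa * (minn (n - l) D)%:R / r.+1%:R <= B) ->
      phi n <= n%:R * w n + (\sum_(0 <= l < (n - r.+1).+1) w l) * B.
    (* For [l >= n - r] the factor [phi (n - l)] vanishes, so the mass of [w] involved stops at
       [n - r.+1]. *)
    move=> B_ge0 HB; rewrite phiE lerD2l (@big_cat_nat _ _ _ (n - r)) /=; [|lia|lia].
    rewrite [X in _ + X]big_nat [X in _ + X]big1 ?addr0; last first.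
      by move=> l /andP[nl ln]; rewrite (renewal_init P) ?mulr0 //; lia.
    have -> : ((n - r.+1).+1 = n - r)%N by clear -rn; lia.
    rewrite [X in X * _]big_ltn; last by lia.
    rewrite [w 0%N]w0 ?add0r; last by left.
    rewrite mulr_suml !big_nat; apply: ler_sum => l /andP[l_gt0 ln].
    have [lr|rl] := leqP l r; first by rewrite w0 ?mul0r //; left.
    rewrite ler_wpM2l //; apply: le_trans (IHn _ _ _) (HB _ _) => //; clear -l_gt0 rl rn ln; lia.
  have N_gt0 : 0 < r.+1%:R :> R by rewrite ltr0n.
  have [nD|Dn] := leqP n D.
    have n1 : 1 <= n%:R / r.+1%:R :> R by rewrite ler_pdivlMr // mul1r ler_nat.
    set a := n%:R / r.+1%:R in n1.
    have B0 : 0 <= kappa * (a - 1) by rewrite mulr_ge0 // subr_ge0.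
    have /bound := addr_ge0 ler01 B0; move/(_ _)/le_trans; apply.
      move=> l /andP[rl ln]; rewrite lerD2l -mulrA ler_wpM2l //.
      rewrite lerBrDr -[X in _ + X](divff (lt0r_neq0 N_gt0)) -mulrDl.
      rewrite ler_pM2r ?invr_gt0 // -natrD ler_nat; clear -rl ln; lia.
    have [n' nE] : exists n', n = n'.+1 by exists n.-1; clear -rn; lia.
    have := nw n'; rewrite -nE => -> ; last by clear -rn nD nE; lia.
    have -> : (n' - r = n - r.+1)%N by clear -nE; lia.
    set rho' := rho _.
    set s := \sum_(_ <= _ < _) _; have s_le1 : s <= 1 by exact: w_le1.
    (* n w_n = rho(n-r-1)/(1-q) and s = (1 - rho(n-r-1))/(1-q) are complementary: they add up to
       1/(1-q) = 1 + kappa. *)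
    have -> : rho' / (1 - q) = 1 + kappa - s.
      by rewrite /s wS /rho' /kappa; [field; rewrite subr_eq0 eq_sym lt_eqF|clear -nD; lia].
    rewrite mulrDr mulr1 addrA subrK -mulrA -/a -addrA lerD2l -lerBrDl.
    apply: le_trans (ler_piMl B0 s_le1) _; lra.
  have wn0 : w n = 0 by apply: w0; right.
  rewrite wn0 mulr0 in bound.
  have B0 : 0 <= 1 + kappa * D%:R / r.+1%:R by rewrite addr_ge0 // divr_ge0 // mulr_ge0.
  have /bound := B0; move/(_ _)/le_trans; apply.
    move=> l _; rewrite lerD2l ler_pM2r ?invr_gt0 // ler_wpM2l // ler_nat; clear; lia.
  rewrite add0r ler_piMl //.
exists w, phi; split => //.
  move=> n; have [rn|rn] := leqP n r.
    by rewrite (renewal_init P) // addr_ge0 // divr_ge0 // subr_ge0; lra.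
  apply: le_trans (main _ rn) _; rewrite lerD2l -mulrA mulrC.
  apply: ler_pM => //; last rewrite ler_pdivrMr ?ltr0n // -natrM ler_nat.
  by apply: leq_trans (geq_minr _ _) _; rewrite leq_mul2l leqnSn orbT.
rewrite lerBlDr; apply: le_trans (dickman_sum rhoP r_gt0 (j := m.-1) _) _; first by lia.
rewrite lerD2r.
rewrite [leRHS](@big_cat_nat _ _ _ r.+1) //=; last by lia.
rewrite [X in _ <= X + _]big_nat [X in _ <= X + _]big1 ?add0r; last first.
  by move=> i /andP[_ ir]; rewrite w0 ?mulr0 //; left.
rewrite -[r.+1 as X in index_iota X _]add0n big_addn.
(* With n = i + r + 1, n w_n = rho(i)/(1-q) >= rho(i), and i runs over [m.-1] blocks of length [r];
   hence [(m.-1)!] in the statement. *)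
have -> : (D.+1 - r.+1 = m.-1 * r)%N by rewrite /D; nia.
rewrite !big_nat; apply: ler_sum => i /andP[_ im].
rewrite addnS nw ?addnK; last by rewrite leq_addl /=; move: im; rewrite /D; nia.
rewrite ler_pdivlMr ?subr_gt0 // ler_piMr ?(dickman_ge0 rhoP) //; lra.
Qed.

(** * Products of binomial factors *)

Definition coef_dominated {R : realType} (p q : {poly R}) : Prop :=
  forall n, `|p`_n| <= q`_n.

Lemma coef_dominatedD (R : realType) (p q p' q' : {poly R}) :
  coef_dominated p q -> coef_dominated p' q' ->
  coef_dominated (p + p') (q + q').
Proof.
by move=> pq pq' n; rewrite !coefD (le_trans (ler_normD _ _)) // lerD.
Qed.

Lemma coef_dominatedM (R : realType) (p q p' q' : {poly R}) :
  coef_dominated p q -> coef_dominated p' q' ->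
  coef_dominated (p * p') (q * q').
Proof.
move=> pq pq' n; rewrite !coefM (le_trans (ler_norm_sum _ _ _)) // ler_sum // => i _.
by rewrite normrM ler_pM.
Qed.

Lemma coef_dominated_monomial (R : realType) (x y : R) b :
  `|x| <= y -> coef_dominated (x *: 'X^b) (y *: 'X^b).
Proof.
move=> xy n; rewrite !coefZ coefXn normrM ler_pM //.
by rewrite ger0_norm.
Qed.

Lemma coef_dominated1 (R : realType) : coef_dominated (1 : {poly R}) 1.
Proof. by move=> n; rewrite coef1 ger0_norm. Qed.

Lemma coef_dominated_prod (R : realType) (J : Type) (s : seq J)
    (x y : J -> R) (b : J -> nat) : (forall j, `|x j| <= y j) ->
  coef_dominated (\prod_(j <- s) (1 + x j *: 'X^(b j)))
                 (\prod_(j <- s) (1 + y j *: 'X^(b j))).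
Proof.
move=> xy; elim: s => [|j s IHs]; first by rewrite !big_nil; apply: coef_dominated1.
rewrite !big_cons; apply: coef_dominatedM => //.
by apply: coef_dominatedD; [apply: coef_dominated1|apply: coef_dominated_monomial].
Qed.

Lemma mulX_deriv_factor (R : realType) (x : R) b (P : {poly R}) :
  'X * deriv ((1 + x *: 'X^b) * P) =
  (b%:R * x) *: 'X^b * P + (1 + x *: 'X^b) * ('X * deriv P).
Proof.
have -> : (b%:R * x) *: 'X^b = 'X * deriv (1 + x *: 'X^b) :> {poly R}.
  rewrite derivD derivC add0r derivZ derivXn.
  case: b => [|b]; first by rewrite mulr0n scaler0 mulr0 mul0r scale0r.
  by rewrite /= -scalerMnr scalerMnl -scalerAr -exprS mulr_natl.
by rewrite derivM; ring.
Qed.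

(* The logarithmic derivative of a product of factors [1 + x X^b] is
   [sum x b X^b / X] up to terms that are quadratic in the [x]'s. *)
Lemma log_deriv_error (R : realType) (J : Type) (s : seq J)
    (x y : J -> R) (b : J -> nat) : (forall j, `|x j| <= y j) ->
  let P := \prod_(j <- s) (1 + x j *: 'X^(b j)) in
  coef_dominated ('X * deriv P - (\sum_(j <- s) ((b j)%:R * x j) *: 'X^(b j)) * P)
    ((\sum_(j <- s) ((b j)%:R * y j ^+ 2) *: 'X^(b j + b j)) *
     \prod_(j <- s) (1 + y j *: 'X^(b j))).
Proof.
move=> xy; elim: s => [|j s IHs] /=.
  by move=> n; rewrite !big_nil derivC mulr0 !mul0r subr0 coef0 normr0.
rewrite !big_cons mulX_deriv_factor; move: IHs => /=.
set P := \prod_(_ <- _) _; set Q := \prod_(_ <- _) _.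
set A := \sum_(_ <- _) _; set E := \sum_(_ <- _) _ => IHs.
(* The new factor misses its linear term by b x X^b (1 - (1 + x X^b)) = - b x^2 X^(2b). *)
have -> : ((b j)%:R * x j) *: 'X^(b j) * P +
   (1 + x j *: 'X^(b j)) * ('X * deriv P) -
   (((b j)%:R * x j) *: 'X^(b j) + A) * ((1 + x j *: 'X^(b j)) * P) =
   (- ((b j)%:R * x j ^+ 2)) *: 'X^(b j + b j) * (1 * P) +
   (1 + x j *: 'X^(b j)) * ('X * deriv P - A * P).
  by rewrite -!mul_polyC !rmorphN !rmorphM ?rmorphXn /= exprD; ring.
have -> : (((b j)%:R * y j ^+ 2) *: 'X^(b j + b j) + E) * ((1 + y j *: 'X^(b j)) * Q)
  = ((b j)%:R * y j ^+ 2) *: 'X^(b j + b j) * ((1 + y j *: 'X^(b j)) * Q)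
  + (1 + y j *: 'X^(b j)) * (E * Q) by ring.
have fac : coef_dominated (1 + x j *: 'X^(b j)) (1 + y j *: 'X^(b j)).
  by apply: coef_dominatedD; [apply: coef_dominated1|apply: coef_dominated_monomial].
apply: coef_dominatedD; last exact: coef_dominatedM.
apply: coef_dominatedM.
  apply: coef_dominated_monomial; rewrite normrN normrM normr_nat ler_wpM2l //.
  by rewrite normrX lerXn2r ?nnegrE // (le_trans (normr_ge0 _) (xy j)).
apply: coef_dominatedM; last exact: coef_dominated_prod.
move=> n; rewrite coefD coefZ coefXn coef1 normr_nat lerDl mulr_ge0 //.
exact: le_trans (normr_ge0 _) (xy j).
Qed.

(** Each term of X P' is b y X^b times the product of the other factors; restoring the missing
    factor only increases coefficients. *)
Lemma log_deriv_le (R : realType) (J : Type) (s : seq J)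
    (y : J -> R) (b : J -> nat) : (forall j, 0 <= y j) ->
  forall n, ('X * deriv (\prod_(j <- s) (1 + y j *: 'X^(b j))))`_n <=
  ((\sum_(j <- s) ((b j)%:R * y j) *: 'X^(b j)) *
     \prod_(j <- s) (1 + y j *: 'X^(b j)))`_n.
Proof.
move=> y_ge0; elim: s => [|j s IHs] n /=.
  by rewrite !big_nil derivC mulr0 mul0r coef0.
rewrite !big_cons mulX_deriv_factor; move: IHs => /=.
set P := \prod_(_ <- _) _; set A := \sum_(_ <- _) _ => IHs.
have P0 m : 0 <= P`_m.
  suff /(_ m) : coef_dominated P P by apply: le_trans.
  by apply: coef_dominated_prod => i; rewrite ger0_norm.
have -> : (((b j)%:R * y j) *: 'X^(b j) + A) * ((1 + y j *: 'X^(b j)) * P) =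
   ((b j)%:R * y j) *: 'X^(b j) * P + ((b j)%:R * y j ^+ 2) *: 'X^(b j + b j) * P +
   (1 + y j *: 'X^(b j)) * (A * P).
  by rewrite -!mul_polyC !rmorphM ?rmorphXn /= exprD; ring.
rewrite !coefD; apply: lerD.
  rewrite lerDl -scalerAl coefZ coefXnM mulr_ge0 //.
    by rewrite mulr_ge0 // exprn_ge0.
  by case: ifP.
rewrite !mulrDl !mul1r !coefD lerD //.
by rewrite -!scalerAl !coefZ !coefXnM ler_wpM2l //; case: ifP.
Qed.

(** * Growth and stability of renewal-type recurrences *)

(** Comparison with [A = 2], where exp(2 sum X^j/j) = (1 - X)^(-2) has partial sums proportional to
    n(n+1); the start [sum = 1] at n = r+1 fixes the factor. For n = O(r) the total mass is O(1) and
    a single bin has O(1/r). *)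
Lemma renewal_mass_bound (R : realType) (r L : nat) (c A : nat -> R) :
  c 0%N = 1 -> (forall n, 0 <= c n) ->
  (forall n, (n <= L)%N -> n%:R * c n <= \sum_(j < n.+1) A j * c (n - j)%N) ->
  (forall j, (j <= r)%N -> A j = 0) -> (forall j, (j <= L)%N -> A j <= 2) ->
  (forall n, (r < n <= L.+1)%N ->
     \sum_(0 <= m < n) c m <= n%:R * n.+1%:R / (r.+1%:R * r.+2%:R)) /\
  (forall n, (0 < n <= L)%N -> c n <= 2 * n.+1%:R / (r.+1%:R * r.+2%:R)).
Proof.
move=> c0 c_ge0 cE A0 A2.
have cS n : (n <= L)%N -> n%:R * c n <= 2 * \sum_(0 <= m < n) c m.
  move=> nL; apply: le_trans (cE _ nL) _; rewrite big_ord_recl A0 // mul0r add0r.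
  rewrite big_nat_rev /= add0n big_mkord mulr_sumr ler_sum // => j _.
  by rewrite ler_wpM2r // A2 // (leq_trans (ltn_ord j)).
have c_small n : (0 < n <= r)%N -> (n <= L)%N -> c n = 0.
  move=> /andP[n0 nr] nL; apply/eqP; rewrite eq_le c_ge0 andbT.
  rewrite -(pmulr_rle0 _ (_ : 0 < n%:R)) ?ltr0n //; apply: le_trans (cE _ nL) _.
  by rewrite big1 // => j _; rewrite A0 ?mul0r // (leq_trans _ nr) // -ltnS.
have N0 : 0 < r.+1%:R * r.+2%:R :> R by rewrite mulr_gt0.
have S_small n : (n < r.+1)%N -> (n <= L)%N -> \sum_(0 <= m < n.+1) c m = 1.
  elim: n => [|n IHn] nr nL; first by rewrite big_nat1.
  by rewrite big_nat_recr //= c_small ?addr0 ?IHn //; lia.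
have S n : (r < n <= L.+1)%N ->
     \sum_(0 <= m < n) c m <= n%:R * n.+1%:R / (r.+1%:R * r.+2%:R).
  elim: n => // n IHn /andP[rn nL].
  have [rn'|nr] := ltnP r n; last first.
    rewrite S_small // ler_pdivlMr // mul1r -!natrM ler_nat; nia.
  have n0 : 0 < n%:R :> R by rewrite ltr0n; lia.
  have {IHn} := IHn _; rewrite rn' ltnW // => /(_ isT).
  have := cS n _; rewrite -ltnS nL => /(_ isT).
  rewrite big_nat_recr //=; set s := \sum_(_ <= _ < _) _.
  rewrite !ler_pdivlMr // -!(natr1 n.+1) -!(natr1 n).
  set NN := r.+1%:R * r.+2%:R => h1 h2.
  rewrite -(ler_pM2l n0); have NN0 : 0 <= NN by exact: ltW.
  have h3 : n%:R * c n * NN <= 2 * s * NN by rewrite ler_wpM2r.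
  have h4 : (n%:R + 2) * (s * NN) <= (n%:R + 2) * (n%:R * (n%:R + 1)).
    by rewrite ler_wpM2l // addr_ge0.
  lra.
split=> // n /andP[n0 nL].
have [nr|rn] := leqP n r; first by rewrite c_small ?n0 // divr_ge0 ?mulr_ge0 // ltW.
have n0' : 0 < n%:R :> R by rewrite ltr0n.
rewrite -(ler_pM2l n0'); apply: le_trans (cS _ nL) _.
rewrite -mulrA mulrCA ler_pM2l // mulrA; apply: S; lia.
Qed.

(** A crude discrete Gronwall bound, based on 1 + 2(1 + 3 + ... + 3^(n-1)) = 3^n. The exponential
    loss is affordable: [L] is fixed and [delta] will be of order e^(-h). *)
Lemma renewal_perturbation (R : realType) (L : nat) (E A : nat -> R) (delta : R) :
  E 0%N = 0 -> A 0%N = 0 -> (forall j, (j <= L)%N -> 0 <= A j <= 2) ->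
  (forall n, (n <= L)%N ->
     `|n%:R * E n + \sum_(j < n.+1) A j * E (n - j)%N| <= delta) ->
  forall n, (n <= L)%N -> `|E n| <= 3 ^+ n * delta.
Proof.
move=> E0 A0 A2 EE; have d_ge0 : 0 <= delta := le_trans (normr_ge0 _) (EE 0%N (leq0n L)).
have S3 n : 2 * \sum_(0 <= m < n) 3 ^+ m = 3 ^+ n - 1 :> R.
  elim: n => [|n IHn]; first by rewrite big_geq // expr0 subrr mulr0.
  by rewrite big_nat_recr //= mulrDr IHn exprS; ring.
elim/ltn_ind => -[|n] IHn nL; first by rewrite E0 normr0 mulr_ge0 ?exprn_ge0.
have step : n.+1%:R * `|E n.+1| <= 3 ^+ n.+1 * delta.
  have := EE _ nL; rewrite big_ord_recl A0 mul0r add0r.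
  set s := \sum_(_ < _) _ => h.
  have hs : `|s| <= (3 ^+ n.+1 - 1) * delta.
    rewrite -S3 -mulrA mulr_suml big_nat_rev /= big_mkord mulr_sumr.
    apply: le_trans (ler_norm_sum _ _ _) _; apply: ler_sum => j _.
    rewrite lift0 add0n subSS normrM.
    have jL : (j.+1 <= L)%N by rewrite (leq_trans (ltn_ord j)).
    have /andP[Aj0 Aj2] := A2 _ jL.
    rewrite ger0_norm // ler_pM // IHn //; lia.
  rewrite -[n.+1%:R]normr_nat -normrM.
  have -> : n.+1%:R * E n.+1 = (n.+1%:R * E n.+1 + s) - s by rewrite addrK.
  apply: le_trans (ler_normB _ _) _; lra.
apply: le_trans step; rewrite ler_peMl // ler1n //.
Qed.

Lemma prod_monomial_coef (R : realType) (I : finType) (x : I -> R) (b : I -> nat) n :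
  (\prod_p (1 + x p *: 'X^(b p)))`_n =
  \sum_(T : {set I} | (\sum_(p in T) b p)%N == n) \prod_(p in T) x p.
Proof.
under eq_bigr do rewrite addrC.
rewrite bigA_distr.
rewrite (eq_bigr (fun T : {set I} => (\prod_(p in T) x p) *: 'X^(\sum_(p in T) b p))).
  by rewrite coef_sumMXn.
move=> T _; rewrite -big_mkcond /= scaler_prod; congr (_ *: _).
by elim/big_rec2: _ => [|p u v _ ->]; rewrite ?expr0 // exprD.
Qed.

Lemma sum_subsets_coef (R : realType) (I : finType) (x : I -> R) (b : I -> nat)
    (L : nat) (h : nat -> R) : (forall n, (L < n)%N -> h n = 0) ->
  \sum_(T : {set I}) (\prod_(p in T) x p) * h (\sum_(p in T) b p)%N =
  \sum_(0 <= n < L.+1) (\prod_p (1 + x p *: 'X^(b p)))`_n * h n.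
Proof.
move=> h0; rewrite big_mkord; under [RHS]eq_bigr do rewrite prod_monomial_coef mulr_suml.
rewrite [RHS](exchange_big_dep xpredT) //=; apply: eq_bigr => T _.
set n := (\sum_(p in T) b p)%N.
have [Ln|nL] := ltnP L n.
  by rewrite h0 // mulr0 big1 // => i /eqP ni; move: (ltn_ord i); rewrite -ni; lia.
have nL' : (n < L.+1)%N by [].
by rewrite (big_pred1 (Ordinal nL')) // => i; rewrite eq_sym.
Qed.

(** * Chebyshev and Mertens estimates *)

Lemma ln_natM (R : realType) (m n : nat) : (0 < m)%N -> (0 < n)%N ->
  ln (m * n)%:R = ln m%:R + ln n%:R :> R.
Proof. by move=> m0 n0; rewrite natrM lnM // posrE ltr0n. Qed.

Lemma ln_nat_ge0 (R : realType) (n : nat) : 0 <= ln n%:R :> R.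
Proof.
case: n => [|n]; first by rewrite ln0.
by rewrite ln_ge0 // ler1n.
Qed.

Lemma ln_prod_nat (R : realType) (I : Type) (s : seq I) (P : pred I) (F : I -> nat) :
  (forall i, P i -> (0 < F i)%N) ->
  ln (\prod_(i <- s | P i) F i)%:R = \sum_(i <- s | P i) ln (F i)%:R :> R.
Proof.
move=> F0; suff [] : (0 < \prod_(i <- s | P i) F i)%N /\
  ln (\prod_(i <- s | P i) F i)%:R = \sum_(i <- s | P i) ln (F i)%:R :> R by [].
elim/big_rec2: _ => [|i x y Pi [y0 yE]]; first by rewrite ln1.
by rewrite muln_gt0 y0 F0 // ln_natM ?F0 // yE.
Qed.

Lemma ln_nat_prime_sum (R : realType) (B n : nat) : (0 < n <= B)%N ->
  ln n%:R = \sum_(0 <= p < B.+1 | prime p) (logn p n)%:R * ln p%:R :> R.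
Proof.
move=> /andP[n0 nB]; rewrite -[in LHS](partnT n0) (widen_partn _ nB).
rewrite (bigID prime) /= [X in (_ * X)%N]big1 ?muln1; last first.
  by move=> p /negbTE np; rewrite lognE np.
rewrite ln_prod_nat => [|p /prime_gt0 p0]; last by rewrite expn_gt0 p0.
apply: eq_bigr => p /prime_gt0 p0.
by rewrite natrX lnXn ?ltr0n // mulr_natl.
Qed.

Lemma ln_fact_prime_sum (R : realType) (B n : nat) : (n <= B)%N ->
  ln n`!%:R = \sum_(0 <= p < B.+1 | prime p) (logn p n`!)%:R * ln p%:R :> R.
Proof.
elim: n => [|n IHn] nB.
  by rewrite fact0 ln1 big1 // => p _; rewrite logn1 mul0r.
rewrite factS ln_natM ?fact_gt0 // IHn ?(ltnW nB) // (@ln_nat_prime_sum _ B) //.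
rewrite -big_split /=; apply: eq_bigr => p _.
by rewrite lognM ?fact_gt0 // natrD mulrDl.
Qed.

Lemma ln_fact_le (R : realType) (n : nat) : ln n`!%:R <= n%:R * ln n%:R :> R.
Proof.
elim: n => [|n IHn]; first by rewrite fact0 ln1 mul0r.
rewrite factS ln_natM ?fact_gt0 // -[X in _ <= X * _]natr1 mulrDl mul1r.
rewrite addrC lerD2r; apply: le_trans IHn _; rewrite ler_wpM2l //.
case: n => [|n]; first by rewrite ln0 // ln_nat_ge0.
by rewrite ler_ln ?posrE ?ltr0n // ler_nat.
Qed.

Lemma ln_succ_sub (R : realType) (n : nat) : (0 < n)%N ->
  ln n.+1%:R - ln n%:R <= n%:R^-1 :> R.
Proof.
move=> n0; rewrite -ln_div ?posrE ?ltr0n //.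
have -> : n.+1%:R / n%:R = 1 + n%:R^-1 :> R.
  by rewrite -natr1 mulrDl divff ?mul1r // pnatr_eq0 -lt0n.
by apply: le_ln1Dx; apply: lt_le_trans (_ : 0 <= _); rewrite ?ltrN10 ?invr_ge0.
Qed.

Lemma ln_fact_ge (R : realType) (n : nat) :
  n%:R * ln n%:R - n%:R <= ln n`!%:R :> R.
Proof.
elim: n => [|n IHn]; first by rewrite fact0 ln1 mul0r subr0.
rewrite factS ln_natM ?fact_gt0 //; case: n IHn => [|n] IHn.
  by rewrite fact0 !ln1; lra.
have := @ln_succ_sub R n.+1 isT; set N := n.+1 in IHn *.
have N0 : 0 < N%:R :> R by rewrite ltr0n.
rewrite -(ler_pM2l N0) divff ?gt_eqF // -natr1.
by set x := ln N%:R in IHn *; set y := ln (N%:R + 1) => h; move: IHn; lra.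
Qed.

Lemma sum_ln_over_consecutive (R : realType) (K : nat) :
  \sum_(0 <= m < K) ln m.+2%:R / (m.+2 * m.+1)%:R <= 2 :> R.
Proof.
(* An antiderivative of ln x / x^2 is -(ln x + 1)/x; an extra 1/x makes the telescoping term by
   term. *)
suff : \sum_(0 <= m < K) ln m.+2%:R / (m.+2 * m.+1)%:R <=
   2 - (ln K.+1%:R + 2) / K.+1%:R :> R.
  move/le_trans; apply; rewrite lerBlDr lerDl divr_ge0 //.
  by rewrite addr_ge0 ?ln_nat_ge0.
elim: K => [|K IHK]; first by rewrite big_geq // ln1; lra.
rewrite big_nat_recr //=; apply: le_trans (lerD IHK (lexx _)) _.
rewrite -addrA lerD2l -subr_ge0.
have h := @ln_succ_sub R K.+1 isT.
have K0 : 0 < K.+1%:R :> R by [].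
have K1 : K.+2%:R = K.+1%:R + 1 :> R by rewrite natr1.
rewrite natrM; move: h; set x := ln K.+1%:R; set y := ln K.+2%:R; rewrite K1.
set k := K.+1%:R in K0 *; move=> h.
have k1 : 1 <= k by rewrite /k ler1n.
have -> : - ((y + 2) / (k + 1)) - (- ((x + 2) / k) + y / ((k + 1) * k)) =
  (2 - (k + 1) * (y - x)) / ((k + 1) * k).
  by field; rewrite !gt_eqF //; lra.
rewrite divr_ge0 //; last by nra.
rewrite subr_ge0; apply: le_trans (_ : (k + 1) * k^-1 <= _).
  by rewrite ler_pM2l //; lra.
by rewrite ler_pdivrMr //; lra.
Qed.

Lemma logn_fact_le (R : realType) (p n : nat) : prime p ->
  (logn p n`!)%:R <= n%:R / (p%:R - 1) :> R.
Proof.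
move=> p_pr; have p2 : 2 <= p%:R :> R by rewrite ler_nat prime_gt1.
have geom K : \sum_(1 <= k < K.+1) (p%:R ^+ k)^-1 <= (p%:R - 1)^-1 - ((p%:R - 1) * p%:R ^+ K)^-1 :> R.
  elim: K => [|K IHK]; first by rewrite big_geq // expr0 mulr1 subrr.
  rewrite big_nat_recr //=; apply: le_trans (lerD IHK (lexx _)) _.
  have pK : 0 < p%:R ^+ K :> R by rewrite exprn_gt0 //; lra.
  rewrite -subr_ge0 exprS [leRHS](_ : _ = 0) //; field.
  by rewrite !gt_eqF //; lra.
rewrite logn_fact // natr_sum; apply: le_trans (_ : \sum_(1 <= k < n.+1) n%:R * (p%:R ^+ k)^-1 <= _).
  apply: ler_sum => k _; rewrite ler_pdivlMr ?exprn_gt0 //; last by lra.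
  by rewrite -natrX -natrM ler_nat leq_divM.
rewrite -mulr_sumr ler_wpM2l //; apply: le_trans (geom n) _.
by rewrite lerBlDr lerDl invr_ge0 mulr_ge0 ?exprn_ge0 //; lra.
Qed.

Lemma logn_fact_ge (R : realType) (p n : nat) : prime p -> (0 < n)%N ->
  n%:R / p%:R - 1 <= (logn p n`!)%:R :> R.
Proof.
move=> p_pr n0; have p0 : 0 < p%:R :> R by rewrite ltr0n prime_gt0.
apply: le_trans (_ : (n %/ p)%:R <= _); last first.
  by rewrite ler_nat logn_fact // big_ltn // expn1 leq_addr.
rewrite lerBlDr natr1 ler_pdivrMr // -natrM ler_nat ltnW //.
by rewrite ltn_ceil // prime_gt0.
Qed.

(** Legendre's formula bounds ln n! by n times the sum of ln p/(p-1). Of the 3, one comes from n ln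
    n - n <= ln n! and two from replacing p - 1 by p. *)
Lemma mertens_lower (R : realType) (n : nat) : (0 < n)%N ->
  ln n%:R - 3 <= \sum_(0 <= p < n.+1 | prime p) ln p%:R / p%:R :> R.
Proof.
move=> n0; have n0' : 0 < n%:R :> R by rewrite ltr0n.
rewrite -(ler_pM2l n0').
have h1 := ln_fact_ge R n; rewrite (@ln_fact_prime_sum R n n) // in h1.
have h2 : \sum_(0 <= p < n.+1 | prime p) (logn p n`!)%:R * ln p%:R <=
   n%:R * \sum_(0 <= p < n.+1 | prime p) ln p%:R / p%:R +
   n%:R * \sum_(0 <= p < n.+1 | prime p) ln p%:R / (p * p.-1)%:R :> R.
  rewrite -mulrDr -big_split /= mulr_sumr; apply: ler_sum => p p_pr.
  have p2 : 2 <= p%:R :> R by rewrite ler_nat prime_gt1.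
  have -> : ln p%:R / p%:R + ln p%:R / (p * p.-1)%:R = ln p%:R / (p%:R - 1) :> R.
    have -> : (p * p.-1)%:R = p%:R * (p%:R - 1) :> R.
      by rewrite natrM -subn1 natrB // prime_gt0.
    by field; rewrite !gt_eqF //; lra.
  rewrite mulrCA [leLHS]mulrC ler_wpM2l ?ln_nat_ge0 //; exact: logn_fact_le.
have h3 : \sum_(0 <= p < n.+1 | prime p) ln p%:R / (p * p.-1)%:R <= 2 :> R.
  apply: le_trans (@sum_ln_over_consecutive R n).
  rewrite big_mkcond /= big_ltn //= add0r.
  case: n {n0 n0' h1 h2} => [|n]; first by rewrite !big_geq.
  rewrite big_ltn //= add0r -{1}[2%N]add0n big_addn.
  have -> : (n.+2 - 2 = n)%N by lia.
  rewrite [leRHS]big_nat_recr //= -[leLHS]addr0 lerD ?divr_ge0 ?ln_nat_ge0 //.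
  by apply: ler_sum => i _; rewrite addn2; case: ifP => // _; rewrite divr_ge0 ?ln_nat_ge0.
nra.
Qed.

Lemma primes_dvd_central_bin (n p : nat) : prime p -> (n < p <= 2 * n)%N ->
  (p %| 'C(2 * n, n))%N.
Proof.
move=> p_pr /andP[np p2n].
have E : ('C(2 * n, n) * (n`! * n`!) = (2 * n)`!)%N.
  have := @bin_fact (2 * n) n; rewrite leq_pmull // => /(_ isT) <-.
  by have -> : (2 * n - n = n)%N by lia.
have n_fact : ~~ (p %| n`!)%N.
  elim: n np {E p2n} => [|n IHn] np; first by rewrite fact0 dvdn1 neq_ltn prime_gt1 ?orbT.
  by rewrite factS Euclid_dvdM // negb_or IHn ?(ltnW np) // andbT gtnNdvd.
have : (p %| 'C(2 * n, n) * (n`! * n`!))%N.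
  by rewrite E dvdn_fact // prime_gt0.
by rewrite !Euclid_dvdM // (negbTE n_fact) !orbF.
Qed.

(** The primes in (n, 2n] divide the central binomial coefficient, which is at most 4^n; ln 2 is
    bounded by 1. *)
Lemma chebyshev_dyadic (R : realType) (n : nat) :
  \sum_(n.+1 <= p < (2 * n).+1 | prime p) ln p%:R <= (2 * n)%:R :> R.
Proof.
have C0 : (0 < 'C(2 * n, n))%N by rewrite bin_gt0 leq_pmull.
have C2 : ('C(2 * n, n) <= 2 ^ (2 * n))%N.
  have nn : (n < (2 * n).+1)%N by rewrite ltnS leq_pmull.
  have := expnDn 1 1 (2 * n).
  rewrite addn1 => ->; rewrite (bigD1 (Ordinal nn)) //= !exp1n !muln1 leq_addr //.
apply: (@le_trans _ _ (ln 'C(2 * n, n)%:R)).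
  rewrite (@ln_nat_prime_sum _ ('C(2 * n, n) + 2 * n)) ?C0 ?leq_addr //.
  have F0 a b : 0 <= \sum_(a <= p < b | prime p) (logn p 'C(2 * n, n))%:R * ln p%:R :> R.
    by apply: sumr_ge0 => p _; rewrite mulr_ge0 ?ln_nat_ge0.
  rewrite [leRHS](@big_cat_nat _ _ _ n.+1) //=; last by lia.
  rewrite [X in _ <= _ + X](@big_cat_nat _ _ _ (2 * n).+1) //=; [|lia|lia].
  apply: ler_wpDl => //; apply: ler_wpDr => //.
  rewrite big_nat_cond [leRHS]big_nat_cond; apply: ler_sum => p /andP[np p_pr].
  rewrite ler_peMl ?ln_nat_ge0 // ler1n logn_gt0 mem_primes p_pr C0 /=.
  exact: primes_dvd_central_bin.
apply: (@le_trans _ _ (ln (2 ^ (2 * n))%:R)).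
  by rewrite ler_ln ?posrE ?ltr0n ?expn_gt0 // ler_nat.
rewrite natrX lnXn // ler_wMn2r //.
by have := @le_ln1Dx R 1; rewrite -natr1 => -> //; lra.
Qed.

Lemma chebyshev_upper (R : realType) (n : nat) :
  \sum_(0 <= p < n.+1 | prime p) ln p%:R <= 4 * n%:R :> R.
Proof.
have dyadic k : \sum_(0 <= p < (2 ^ k).+1 | prime p) ln p%:R <= 2 * (2 ^ k)%:R :> R.
  elim: k => [|k IHk].
    by rewrite expn0 big_mkcond /= 2?big_ltn // big_geq //= !addr0 mulr_ge0.
  rewrite (@big_cat_nat _ _ _ (2 ^ k).+1) //=; last by rewrite ltnS leq_exp2l.
  apply: le_trans (lerD IHk _) _.
    by rewrite expnS; apply: chebyshev_dyadic.
  by rewrite expnS natrM; lra.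
case: n => [|n]; first by rewrite big_mkcond big_ltn //= big_geq // !addr0 mulr0.
have F0 a b : 0 <= \sum_(a <= p < b | prime p) ln p%:R :> R.
  by apply: sumr_ge0 => p _; rewrite ln_nat_ge0.
apply: le_trans (_ : \sum_(0 <= p < (2 ^ up_log 2 n.+1).+1 | prime p) ln p%:R <= _).
  rewrite [leRHS](@big_cat_nat _ _ _ n.+2) //= ?lerDl //.
  by rewrite ltnS up_logP.
apply: le_trans (dyadic _) _; rewrite -!natrM ler_nat.
case: n => [|n]; first by rewrite up_log1.
have /(_ _)/andP[//|h _] := @up_log_bounds 2 n.+2 isT.
have : (0 < up_log 2 n.+2)%N by rewrite up_log_gt0.
by case: (up_log 2 n.+2) h => //= k; rewrite expnS; lia.
Qed.

(** Here the exponent of p in n! is bounded below by n/p - 1; the correction, the sum of ln p, is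
    the Chebyshev function and gives the 4. *)
Lemma mertens_upper (R : realType) (n : nat) : (0 < n)%N ->
  \sum_(0 <= p < n.+1 | prime p) ln p%:R / p%:R <= ln n%:R + 4 :> R.
Proof.
move=> n0; have n0' : 0 < n%:R :> R by rewrite ltr0n.
rewrite -(ler_pM2l n0').
have h1 := ln_fact_le R n; rewrite (@ln_fact_prime_sum R n n) // in h1.
have h2 : n%:R * \sum_(0 <= p < n.+1 | prime p) ln p%:R / p%:R -
   \sum_(0 <= p < n.+1 | prime p) ln p%:R <=
   \sum_(0 <= p < n.+1 | prime p) (logn p n`!)%:R * ln p%:R :> R.
  rewrite -sumrN mulr_sumr -big_split /=; apply: ler_sum => p p_pr.
  apply: le_trans (_ : (n%:R / p%:R - 1) * ln p%:R <= _); first by rewrite le_eqVlt; apply/orP; left; apply/eqP; ring.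
  by rewrite ler_wpM2r ?ln_nat_ge0 // logn_fact_ge.
have h3 := chebyshev_upper R n.
nra.
Qed.

(** 9 = 4 + 5: the upper Mertens constant at s, and at t the lower constant 3, plus 1 for rounding t
    down to b, plus 1 for dropping p = b, which is not below t when t is an integer. *)
Lemma sum_ln_over_primes_interval (R : realType) (s t : R) (B : nat) :
  1 <= s -> s <= t -> t <= B%:R ->
  ln t - ln s - 9 <= \sum_(0 <= p < B | prime p && (s <= p%:R < t)) ln p%:R / p%:R.
Proof.
move=> s1 st tB.
have F0 (P : pred nat) a b : 0 <= \sum_(a <= p < b | P p) ln p%:R / p%:R :> R.
  by apply: sumr_ge0 => p _; rewrite divr_ge0 ?ln_nat_ge0.
have t1 : 1 <= t by exact: le_trans st.
have /andP[st1 st2] := truncn_itv (le_trans ler01 s1).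
have /andP[tt1 tt2] := truncn_itv (le_trans ler01 t1).
set a := Num.truncn s in st1 st2; set b := Num.truncn t in tt1 tt2.
have a0 : (0 < a)%N by rewrite -ltnS -(ltr_nat R) (le_lt_trans s1).
have b0 : (0 < b)%N by rewrite -ltnS -(ltr_nat R) (le_lt_trans t1).
have bB : (b <= B)%N by rewrite -(ler_nat R) (le_trans tt1).
have hs : \sum_(0 <= p < B | prime p && (p%:R < s)) ln p%:R / p%:R <= ln s + 4 :> R.
  apply: le_trans (_ : \sum_(0 <= p < a.+1 | prime p) ln p%:R / p%:R <= _).
    have aB : (a <= B)%N by rewrite -(ler_nat R) (le_trans st1) // (le_trans st).
    have [aB'|Ba] := ltnP a B; last first.
      have -> : a = B by lia.
      rewrite [leRHS]big_mkcond big_nat_recr //= big_mkcond ler_wpDr //.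
        by case: ifP => // _; rewrite divr_ge0 ?ln_nat_ge0.
      apply: ler_sum => p _; case: (prime p) => //=; case: ifP => // _.
      by rewrite divr_ge0 ?ln_nat_ge0.
    rewrite (@big_cat_nat _ _ _ a.+1) //= [X in _ + X]big_nat_cond [X in _ + X]big1 ?addr0.
      rewrite big_mkcond [leRHS]big_mkcond /=; apply: ler_sum => p _.
      by case: (prime p) => //=; case: ifP => // _; rewrite divr_ge0 ?ln_nat_ge0.
    move=> p /andP[/andP[ap _] /andP[_ ps]]; move: (lt_trans ps st2).
    by rewrite ltr_nat ltnNge ap.
  apply: le_trans (mertens_upper R a0) _; rewrite lerD2r ler_ln ?posrE ?ltr0n //.
  exact: lt_le_trans ltr01 s1.
have ht : ln t - 5 <= \sum_(0 <= p < B | prime p && (p%:R < t)) ln p%:R / p%:R.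
  apply: le_trans (_ : \sum_(0 <= p < b | prime p) ln p%:R / p%:R <= _); last first.
    rewrite [leRHS](@big_cat_nat _ _ _ b) //= ler_wpDr //.
    rewrite big_nat_cond [leRHS]big_nat_cond [leRHS]big_mkcond [leLHS]big_mkcond /=.
    apply: ler_sum => p _; case: ifP => [/andP[pb ->]|_].
      by rewrite pb /= (lt_le_trans _ tt1) // ltr_nat.
    by case: ifP => // _; rewrite divr_ge0 ?ln_nat_ge0.
  have := mertens_lower R b0; rewrite big_mkcond big_nat_recr //= -big_mkcond /=.
  have le1 : (if prime b then ln b%:R / b%:R else 0) <= 1 :> R.
    case: ifP => // _; rewrite ler_pdivrMr ?ltr0n // mul1r ltW // ln_sublinear ?ltr0n //.
  have : ln t <= ln b%:R + 1.
    apply: le_trans (_ : ln b.+1%:R <= _).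
      by rewrite ler_ln ?posrE ?ltr0n ?(ltW tt2) // (lt_le_trans ltr01).
    have := ln_succ_sub R b0; have : b%:R^-1 <= 1 :> R by rewrite invf_le1 ?ltr0n // ler1n.
    lra.
  move=> h1 h2; apply: le_trans (_ : ln b%:R - 3 - 1 <= _); first by lra.
  by rewrite lerBlDr; apply: le_trans h2 (lerD (lexx _) le1).
have -> : \sum_(0 <= p < B | prime p && (s <= p%:R < t)) ln p%:R / p%:R =
  \sum_(0 <= p < B | prime p && (p%:R < t)) ln p%:R / p%:R -
  \sum_(0 <= p < B | prime p && (p%:R < s)) ln p%:R / p%:R :> R.
  apply/eqP; rewrite eq_sym subr_eq; apply/eqP.
  rewrite (bigID (fun p => s <= p%:R)) /=; congr (_ + _); apply: eq_bigl => p.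
    by case: (prime p) => //=; rewrite andbC.
  case: (prime p) => //=; rewrite -ltNge andbC.
  by case: ltP => // ps; rewrite (lt_le_trans ps).
lra.
Qed.

(** * Random completely multiplicative functions *)

Lemma prim_root_exists (C : numClosedFieldType) (n : nat) :
  (0 < n)%N -> exists z : C, n.-primitive_root z.
Proof.
move=> n_gt0; have [r] := closed_field_poly_normal ('X^n - 1 : {poly C}).
rewrite (monicP _) ?monicXnsubC // scale1r => Dr.
have r_root : all n.-unity_root r by apply/allP => z; rewrite -root_prod_XsubC -Dr.
have r_uniq : uniq r.
  by rewrite -separable_prod_XsubC -Dr separable_Xn_sub_1 // pnatr_eq0 -lt0n.
have r_size : (n <= size r)%N.
  by rewrite -ltnS -(size_prod_XsubC r id) -Dr size_XnsubC.
by have /hasP[z _ z_prim] := has_prim_root n_gt0 r_root r_uniq r_size; exists z.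
Qed.

Lemma sum_prim_root_powers (C : numClosedFieldType) (k j : nat) (z : C) :
  k.-primitive_root z -> ~~ (k %| j)%N -> \sum_(a < k) z ^+ (j * a) = 0.
Proof.
move=> z_prim kj; have zj1 : z ^+ j - 1 != 0.
  by rewrite subr_eq0 -(prim_order_dvd z_prim).
apply: (mulfI zj1); rewrite mulr0.
under eq_bigr do rewrite exprM.
by rewrite -subrX1 exprAC (prim_expr_order z_prim) expr1n subrr.
Qed.

(* The law on the k-th roots of unity under which every power z^j with k not
   dividing j has mean [1 - phi]. *)
Definition root_law {C : numClosedFieldType} (k : nat) (phi : C) (a : nat) : C :=
  phi / k%:R + (a == 0%N)%:R * (1 - phi).

Lemma root_law_sum (C : numClosedFieldType) (k : nat) (phi : C) (F : nat -> C) :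
  (0 < k)%N ->
  \sum_(a < k) root_law k phi a * F a =
  phi / k%:R * (\sum_(a < k) F a) + (1 - phi) * F 0%N.
Proof.
case: k => // k _; rewrite mulr_sumr.
under eq_bigr do rewrite mulrDl.
rewrite big_split /=; congr (_ + _).
by rewrite big_ord_recl /= mul1r big1 ?addr0 // => i _; rewrite !mul0r.
Qed.

Lemma root_law_total (C : numClosedFieldType) (k : nat) (phi : C) :
  (0 < k)%N -> \sum_(a < k) root_law k phi a = 1.
Proof.
move=> k0; have := @root_law_sum C k phi (fun=> 1) k0.
under eq_bigr do rewrite mulr1; move=> ->.
rewrite sumr_const card_ord divfK ?mulr1 ?pnatr_eq0 -?lt0n //; ring.
Qed.

(** Only the weight at 0, phi/k + 1 - phi, could be negative; the second hypothesis says that it is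
    not. *)
Lemma root_law_ge0 (C : numClosedFieldType) (k : nat) (phi : C) a :
  (0 < k)%N -> 0 <= phi -> phi * (k%:R - 1) <= k%:R -> 0 <= root_law k phi a.
Proof.
move=> k0 phi0 phik; rewrite /root_law; case: eqP => _; last first.
  by rewrite mul0r addr0 divr_ge0.
have kp : 0 < k%:R :> C by rewrite ltr0n.
rewrite mul1r -(pmulr_rge0 _ kp) mulrDr mulrCA divff ?mulr1 ?gt_eqF //.
have -> : phi + k%:R * (1 - phi) = k%:R - phi * (k%:R - 1) by ring.
by rewrite subr_ge0.
Qed.

(** [s] and [t] stand for the exponents of p in two integers. If [s + t <= 1], at most one factor is
    nontrivial; if [phi = 0] the law sits at the root 1 and the exponents do not matter. *)
Lemma root_law_moment (C : numClosedFieldType) (k j s t : nat) (phi z : C) :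
  k.-primitive_root z -> (0 < j < k)%N -> (s + t <= 1)%N \/ phi = 0 ->
  \sum_(a < k) root_law k phi a * ((z ^+ (a * s)) ^+ j * ((z ^+ (a * t)) ^+ j)^*) =
  (1 - phi * (0 < s)%:R) * (1 - phi * (0 < t)%:R).
Proof.
move=> z_prim /andP[j0 jk] st; have k0 : (0 < k)%N by lia.
rewrite (root_law_sum _ (fun a => (z ^+ (a * s)) ^+ j * ((z ^+ (a * t)) ^+ j)^*)) //.
rewrite !mul0n !expr0 !expr1n conjC1 !mulr1.
case: st => [st|->]; last by rewrite !mul0r !subr0 add0r mulr1.
have kj : ~~ (k %| j)%N by rewrite gtnNdvd.
have sum0 : \sum_(a < k) z ^+ (a * 1) ^+ j = 0.
  rewrite -[RHS](sum_prim_root_powers z_prim kj); apply: eq_bigr => a _.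
  by rewrite muln1 -exprM mulnC.
case: s t st => [|[|s]] [|[|t]] //= _; rewrite ?mulr0 ?mulr1 ?subr0 ?mul1r.
- under eq_bigr do rewrite !muln0 !expr0 !expr1n conjC1 mulr1.
  rewrite sumr_const card_ord -mulr_natl mulr1 divfK ?pnatr_eq0 -?lt0n //; ring.
- under eq_bigr do rewrite muln0 expr0 expr1n mul1r.
  by rewrite -rmorph_sum sum0 rmorph0; ring.
- under eq_bigr do rewrite muln0 expr0 expr1n conjC1 mulr1.
  by rewrite sum0; ring.
Qed.

(** [logn p n] vanishes for composite [p], so these indices are inert; primes from [B] on are sent
    to 1. *)
Definition root_fun {C : numClosedFieldType} (k B : nat) (z : C)
    (omega : {ffun 'I_B -> 'I_k}) (n : nat) : C :=
  \prod_(p < B) z ^+ (omega p * logn p n).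

Definition law_prob {C : numClosedFieldType} (k B : nat) (phi : nat -> C)
    (omega : {ffun 'I_B -> 'I_k}) : C :=
  \prod_(p < B) root_law k (phi p) (omega p).

(* The mean of [root_fun] at integers without repeated prime factors p such
   that [phi p != 0]. *)
Definition mean_fun {C : pzRingType} (B : nat) (phi : nat -> C) (n : nat) : C :=
  \prod_(p < B) (1 - phi p * (0 < logn p n)%:R).

Lemma law_prob_total (C : numClosedFieldType) (k B : nat) (phi : nat -> C) :
  (0 < k)%N -> \sum_(omega : {ffun 'I_B -> 'I_k}) law_prob phi omega = 1.
Proof.
move=> k0; rewrite /law_prob.
rewrite -(bigA_distr_bigA (fun p a => root_law k (phi (val p)) (val a))) /=.
by rewrite big1 // => p _; apply: root_law_total.
Qed.

Lemma root_fun_moment (C : numClosedFieldType) (k B j m n : nat)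
    (phi : nat -> C) (z : C) : k.-primitive_root z -> (0 < j < k)%N ->
  (forall p, (p < B)%N -> phi p != 0 -> (logn p m + logn p n <= 1)%N) ->
  \sum_(omega : {ffun 'I_B -> 'I_k})
    law_prob phi omega * (root_fun z omega m ^+ j * (root_fun z omega n ^+ j)^*) =
  mean_fun B phi m * mean_fun B phi n.
Proof.
move=> z_prim jk mn.
pose F (p : 'I_B) (a : 'I_k) := root_law k (phi p) a *
  ((z ^+ (a * logn p m)) ^+ j * ((z ^+ (a * logn p n)) ^+ j)^*).
rewrite (eq_bigr (fun omega : {ffun 'I_B -> 'I_k} => \prod_(p < B) F p (omega p))).
  rewrite -bigA_distr_bigA /mean_fun -big_split /=; apply: eq_bigr => p _.
  apply: root_law_moment => //.
  by have [->|phi0] := eqVneq (phi p) 0; [right|left; apply: mn].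
move=> omega _; rewrite /law_prob /root_fun /F big_split /= big_split /=.
by rewrite -!prodrXl rmorph_prod.
Qed.

Lemma norm_root_fun (C : numClosedFieldType) (k B : nat) (z : C)
    (omega : {ffun 'I_B -> 'I_k}) n : (0 < k)%N ->
  k.-primitive_root z -> `|root_fun z omega n| = 1.
Proof.
move=> k0 z_prim; rewrite normr_prod big1 // => p _.
suff z1 : `|z| = 1 by rewrite normrX z1 expr1n.
apply/eqP; rewrite -(pexpr_eq1 k0) // -normrX.
by rewrite (prim_expr_order z_prim) normr1.
Qed.

Lemma norm_mean_fun (C : numDomainType) (B : nat) (phi : nat -> C) n :
  (forall p, 0 <= phi p <= 2) -> `|mean_fun B phi n| <= 1.
Proof.
move=> phi2; rewrite normr_prod; apply: prodr_ile1 => p _.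
rewrite normr_ge0 /=; have /andP[phi0 phi_le2] := phi2 p.
case: (0 < logn p n)%N; last by rewrite mulr0 subr0 normr1.
rewrite mulr1 real_ler_norml ?rpredB ?rpred1 ?ger0_real //.
by rewrite lerBrDl lerBlDr lerBlDr lerDl phi0 andbT.
Qed.

Lemma conj_mean_fun (C : numClosedFieldType) (B : nat) (phi : nat -> C) n :
  (forall p, 0 <= phi p) -> (mean_fun B phi n)^* = mean_fun B phi n.
Proof.
move=> phi0; rewrite rmorph_prod; apply: eq_bigr => p _.
by rewrite rmorphB rmorph1 rmorphM rmorph_nat /= (CrealP (ger0_real (phi0 p))).
Qed.

Lemma law_prob_ge0 (C : numClosedFieldType) (k B : nat) (phi : nat -> C)
    (omega : {ffun 'I_B -> 'I_k}) : (0 < k)%N ->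
  (forall p, 0 <= phi p) -> (forall p, phi p * (k%:R - 1) <= k%:R) ->
  0 <= law_prob phi omega.
Proof.
by move=> k0 phi0 phik; apply: prodr_ge0 => p _; apply: root_law_ge0.
Qed.

(** Centred values at m and n are uncorrelated unless some random prime occurs twice in m n. The
    means are the moments with one argument equal to 1. *)
Lemma root_fun_cov (C : numClosedFieldType) (k B j m n : nat)
    (phi : nat -> C) (z : C) : k.-primitive_root z -> (0 < j < k)%N ->
  (forall p, 0 <= phi p) ->
  (forall p, (p < B)%N -> phi p != 0 -> (logn p m + logn p n <= 1)%N) ->
  \sum_(omega : {ffun 'I_B -> 'I_k})
    law_prob phi omega * ((root_fun z omega m ^+ j - mean_fun B phi m) *
       (root_fun z omega n ^+ j - mean_fun B phi n)^*) = 0.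
Proof.
move=> z_prim jk phi0 mn; have k0 : (0 < k)%N by lia.
have f1 omega : root_fun z omega 1 = 1 :> C.
  by rewrite /root_fun big1 // => p _; rewrite logn1 muln0.
have F1 : mean_fun B phi 1 = 1.
  by rewrite /mean_fun big1 // => p _; rewrite logn1 mulr0 subr0.
have Emn := root_fun_moment z_prim jk mn.
have Em := @root_fun_moment _ k B j m 1 phi z z_prim jk.
have En := @root_fun_moment _ k B j 1 n phi z z_prim jk.
rewrite F1 mulr1 in Em; rewrite F1 mul1r in En.
have {}Em : \sum_(omega : {ffun 'I_B -> 'I_k}) law_prob phi omega * root_fun z omega m ^+ j = mean_fun B phi m.
  rewrite -Em; last first.
    by move=> p pB fp; apply: leq_trans (mn p pB fp); rewrite logn1 addn0 leq_addr.
  by apply: eq_bigr => omega _; rewrite f1 expr1n conjC1 mulr1.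
have {}En : \sum_(omega : {ffun 'I_B -> 'I_k}) law_prob phi omega * (root_fun z omega n ^+ j)^* = mean_fun B phi n.
  rewrite -En; last first.
    by move=> p pB fp; apply: leq_trans (mn p pB fp); rewrite logn1 add0n leq_addl.
  by apply: eq_bigr => omega _; rewrite f1 expr1n mul1r.
set Fm := mean_fun B phi m in Em Emn *; set Fn := mean_fun B phi n in En Emn *.
have E0 := @law_prob_total C k B phi k0.
transitivity (\sum_(omega : {ffun 'I_B -> 'I_k})
    law_prob phi omega * (root_fun z omega m ^+ j * (root_fun z omega n ^+ j)^*)
  - (\sum_(omega : {ffun 'I_B -> 'I_k}) law_prob phi omega * root_fun z omega m ^+ j) * Fn
  - (\sum_(omega : {ffun 'I_B -> 'I_k}) law_prob phi omega * (root_fun z omega n ^+ j)^*) * Fm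
  + (\sum_(omega : {ffun 'I_B -> 'I_k}) law_prob phi omega) * (Fm * Fn)).
  rewrite !mulr_suml -!sumrB -big_split /=; apply: eq_bigr => omega _.
  rewrite rmorphB /= conj_mean_fun // -/Fm -/Fn.
  by move: (_ ^+ j) (_^*) => u v; ring.
by rewrite Emn Em En E0; ring.
Qed.

(** Only pairs with p^2 | m, p^2 | n, or p dividing both can contribute, each at most 4 in absolute
    value. For a given p each of the three kinds has total weight at most Sigma^2/p^2, whence 12. *)
Lemma root_fun_second_moment (C : numClosedFieldType) (k B j x : nat)
    (phi c : nat -> C) (z Sigma : C) : k.-primitive_root z -> (0 < j < k)%N ->
  (forall p, 0 <= phi p <= 2) -> (forall p, phi p * (k%:R - 1) <= k%:R) ->
  (forall p, phi p != 0 -> prime p) -> (forall n, 0 <= c n) -> 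
  (forall d, (0 < d)%N -> \sum_(1 <= n < x.+1 | (d %| n)%N) c n <= Sigma / d%:R) ->
  \sum_(omega : {ffun 'I_B -> 'I_k}) law_prob phi omega *
    `|\sum_(1 <= n < x.+1) c n * (root_fun z omega n ^+ j - mean_fun B phi n)| ^+ 2
  <= 12 * Sigma ^+ 2 * \sum_(p < B | phi p != 0) (p%:R ^+ 2)^-1.
Proof.
move=> z_prim jk phi2 phik phi_prime c0 cS; have k0 : (0 < k)%N by lia.
have phi0 p : 0 <= phi p by have /andP[] := phi2 p.
pose Z (omega : {ffun 'I_B -> 'I_k}) n := root_fun z omega n ^+ j - mean_fun B phi n.
have Z2 omega n : `|Z omega n| <= 2.
  apply: le_trans (ler_normB _ _) _; rewrite normrX norm_root_fun // expr1n.
  by rewrite -[leRHS](natrD _ 1 1) lerD2l norm_mean_fun.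
pose E m n := \sum_omega law_prob phi omega * (Z omega m * (Z omega n)^*).
(* A union bound: [beta] is at least 1 on every correlated pair, and it factors into divisor
   sums. *)
pose beta m n : C := \sum_(p < B | phi p != 0)
  ((p ^ 2 %| m)%N%:R + (p ^ 2 %| n)%N%:R + ((p %| m) && (p %| n))%N%:R).
have beta0 m n : 0 <= beta m n by apply: sumr_ge0 => p _; rewrite !addr_ge0.
have Ebound m n : (0 < m)%N -> (0 < n)%N -> `|E m n| <= 4 * beta m n.
  move=> m0 n0.
  have [good|] := boolP [forall p : 'I_B, (phi p != 0) ==> (logn p m + logn p n <= 1)%N].
    rewrite /E root_fun_cov // ?normr0 ?mulr_ge0 // => p pB fp.
    by have /forallP/(_ (Ordinal pB))/implyP := good; apply.
  rewrite negb_forall => /existsP[p]; rewrite negb_imply -ltnNge => /andP[fp bad].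
  apply: le_trans (_ : 4 * 1 <= _); last first.
    rewrite ler_wpM2l // /beta (bigD1 p) //=.
    have p_pr := phi_prime _ fp.
    apply: le_trans (_ : 1 <= (p ^ 2 %| m)%N%:R + (p ^ 2 %| n)%N%:R + ((p %| m) && (p %| n))%N%:R) _.
      have h2 u : (0 < u)%N -> (p ^ 2 %| u)%N = (2 <= logn p u)%N.
        by move=> u0; rewrite pfactor_dvdn.
      have h1 u : (0 < u)%N -> (p %| u)%N = (1 <= logn p u)%N.
        by move=> u0; rewrite -pfactor_dvdn ?expn1.
      rewrite !h2 // !h1 // -!natrD ler1n; move: bad.
      by move: (logn p m) (logn p n) => [|[|a]] [|[|b]].
    by rewrite lerDl sumr_ge0 // => q _; rewrite !addr_ge0.
  rewrite mulrC -[X in X * _](@law_prob_total C k B phi k0) mulr_suml.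
  apply: le_trans (ler_norm_sum _ _ _) _; apply: ler_sum => omega _.
  rewrite normrM ger0_norm ?law_prob_ge0 // ler_wpM2l ?law_prob_ge0 //.
  rewrite normrM norm_conjC (natrM _ 2 2).
  by rewrite ler_pM.
rewrite -[leLHS]ger0_norm; last first.
  by apply: sumr_ge0 => omega _; rewrite mulr_ge0 ?exprn_ge0 ?law_prob_ge0.
have -> : \sum_(omega : {ffun 'I_B -> 'I_k}) law_prob phi omega *
    `|\sum_(1 <= n < x.+1) c n * (root_fun z omega n ^+ j - mean_fun B phi n)| ^+ 2 =
   \sum_(1 <= m < x.+1) \sum_(1 <= n < x.+1) c m * c n * E m n.
  rewrite /E; under [RHS]eq_bigr do (under eq_bigr do rewrite mulr_sumr; rewrite exchange_big).
  rewrite [RHS]exchange_big /=; apply: eq_bigr => omega _.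
  rewrite normCK rmorph_sum mulr_suml mulr_sumr; apply: eq_bigr => m _.
  rewrite !mulr_sumr; apply: eq_bigr => n _.
  by rewrite rmorphM /= (CrealP (ger0_real (c0 n))) -/(Z omega m) -/(Z omega n); ring.
apply: le_trans (ler_norm_sum _ _ _) _.
apply: le_trans (_ : \sum_(1 <= m < x.+1) \sum_(1 <= n < x.+1) c m * c n * (4 * beta m n) <= _).
  rewrite !big_nat; apply: ler_sum => m /andP[m0 _].
  apply: le_trans (ler_norm_sum _ _ _) _.
  rewrite !big_nat; apply: ler_sum => n /andP[n0 _].
  by rewrite normrM ger0_norm ?mulr_ge0 // ler_wpM2l ?mulr_ge0 // Ebound.
have S1 := cS 1%N isT; rewrite divr1 (eq_bigl xpredT) in S1; last by move=> n; rewrite dvd1n.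
have cge0 P : 0 <= \sum_(1 <= n < x.+1 | P n) c n by apply: sumr_ge0.
have Sig0 : 0 <= Sigma by apply: le_trans S1; apply: cge0.
have -> : \sum_(1 <= m < x.+1) \sum_(1 <= n < x.+1) c m * c n * (4 * beta m n) =
  \sum_(p < B | phi p != 0) 4 *
   ((\sum_(1 <= m < x.+1 | (p ^ 2 %| m)%N) c m) * (\sum_(1 <= n < x.+1) c n) +
    (\sum_(1 <= m < x.+1) c m) * (\sum_(1 <= n < x.+1 | (p ^ 2 %| n)%N) c n) +
    (\sum_(1 <= m < x.+1 | (p %| m)%N) c m) * (\sum_(1 <= n < x.+1 | (p %| n)%N) c n)).
  rewrite /beta.
  under eq_bigr do (under eq_bigr do rewrite !mulr_sumr; rewrite exchange_big).
  rewrite exchange_big /=; apply: eq_bigr => p _.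
  rewrite [\sum_(_ <= _ < _ | (p ^ 2 %| _)%N) _]big_mkcond.
  rewrite [\sum_(_ <= _ < _ | (p %| _)%N) _]big_mkcond /=.
  rewrite !mulr_suml -!big_split /= mulr_sumr; apply: eq_bigr => m _.
  rewrite !mulr_sumr -!big_split /= mulr_sumr; apply: eq_bigr => n _.
  by case: (p ^ 2 %| m)%N; case: (p ^ 2 %| n)%N; case: (p %| m)%N; case: (p %| n)%N => /=; ring.
rewrite mulr_sumr; apply: ler_sum => p fp.
have p0 : (0 < p)%N by apply: prime_gt0; apply: phi_prime.
have p2 : (0 < p ^ 2)%N by rewrite expn_gt0 p0.
have pC : 0 < p%:R :> C by rewrite ltr0n.
have -> : 12 * Sigma ^+ 2 * (p%:R ^+ 2)^-1 =
  4 * (Sigma / (p ^ 2)%:R * Sigma + Sigma * (Sigma / (p ^ 2)%:R) + Sigma / p%:R * (Sigma / p%:R)).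
  by rewrite natrX; field; rewrite gt_eqF.
rewrite ler_wpM2l //; apply: lerD; first apply: lerD.
- by apply: ler_pM; rewrite ?cge0 ?cS.
- by apply: ler_pM; rewrite ?cge0 ?cS.
- by apply: ler_pM; rewrite ?cge0 ?cS.
Qed.

Lemma sum_multiples (V : zmodType) (u : nat -> V) (d x : nat) : (0 < d)%N ->
  \sum_(1 <= n < x.+1 | (d %| n)%N) u n = \sum_(1 <= q < (x %/ d).+1) u (q * d)%N.
Proof.
move=> d0; elim: x => [|x IHx]; first by rewrite div0n !big_geq.
rewrite big_mkcond big_nat_recr //= -big_mkcond IHx.
have := divnS x d0; case: ifP => dx E; last by rewrite addr0 E.
rewrite E add1n [in RHS]big_nat_recr //=; congr (_ + u _).
by rewrite (_ : (x %/ d).+1 = x.+1 %/ d)%N ?divnK // E.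
Qed.

Lemma normc_norm (R : realType) (z : R[i]) : `|z| = (Normc.normc z)%:C%C.
Proof. by []. Qed.

Lemma root_fun_second_moment_real (R : realType) (k B j x : nat)
    (phi c : nat -> R) (z : R[i]) (Sigma : R) :
  k.-primitive_root z -> (0 < j < k)%N ->
  (forall p, 0 <= phi p <= 2) -> (forall p, phi p * (k%:R - 1) <= k%:R) ->
  (forall p, phi p != 0 -> prime p) -> (forall n, 0 <= c n) ->
  (forall d, (0 < d)%N -> \sum_(1 <= n < x.+1 | (d %| n)%N) c n <= Sigma / d%:R) ->
  \sum_(omega : {ffun 'I_B -> 'I_k})
    complex.Re (law_prob (fun p => (phi p)%:C%C) omega) *
    Normc.normc (\sum_(1 <= n < x.+1)
      (c n)%:C%C * (root_fun z omega n ^+ j - (mean_fun B phi n)%:C%C)) ^+ 2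
  <= 12 * Sigma ^+ 2 * \sum_(p < B | phi p != 0) (p%:R ^+ 2)^-1.
Proof.
move=> z_prim jk phi2 phik phi_prime c0 cS.
have k0 : (0 < k)%N by lia.
pose phiC p := (phi p)%:C%C; pose cC n := (c n)%:C%C.
have phiC2 p : 0 <= phiC p <= 2.
  have /andP[h1 h2] := phi2 p.
  by rewrite /phiC -(rmorph0 (real_complex R)) -(rmorph_nat (real_complex R) 2) !lecR h1.
have phiCk p : phiC p * (k%:R - 1) <= k%:R.
  by rewrite /phiC -(rmorph_nat (real_complex R) k) -(rmorph1 (real_complex R)) -rmorphB -rmorphM lecR.
have phiC_prime p : phiC p != 0 -> prime p.
  by move=> h; apply: phi_prime; apply: contraNneq h => h; rewrite /phiC h.
have cC0 n : 0 <= cC n by rewrite /cC -(rmorph0 (real_complex R)) lecR.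
have cCS d : (0 < d)%N -> \sum_(1 <= n < x.+1 | (d %| n)%N) cC n <= Sigma%:C%C / d%:R.
  move=> d0; rewrite /cC -rmorph_sum -(rmorph_nat (real_complex R) d) -fmorphV -rmorphM.
  by rewrite lecR cS.
have := @root_fun_second_moment _ k B j x phiC cC z Sigma%:C%C z_prim jk phiC2 phiCk phiC_prime cC0 cCS.
rewrite -lecR; congr (_ <= _).
  rewrite rmorph_sum; apply: eq_bigr => omega _; rewrite rmorphM rmorphXn /=.
  congr (_ * _).
    have /ger0_real : 0 <= law_prob phiC omega.
      by apply: law_prob_ge0 => // p; have /andP[] := phiC2 p.
    by rewrite -/phiC; case: (law_prob _ _) => a b; rewrite complex_real => /eqP->.
  rewrite normc_norm; congr ((_ (Normc.normc _)) ^+ 2); apply: eq_bigr => n _.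
  congr (_ * (_ - _)); rewrite /mean_fun rmorph_prod; apply: eq_bigr => p _.
  by rewrite rmorphB rmorph1 rmorphM rmorph_nat.
rewrite 2!rmorphM rmorphXn rmorph_nat /= rmorph_sum; congr (_ * _).
have E p : (phiC p != 0) = (phi p != 0).
  by rewrite /phiC -(inj_eq (@complexI R)).
rewrite (eq_bigl _ _ (fun p : 'I_B => E p)); apply: eq_bigr => p _.
by rewrite fmorphV rmorphXn rmorph_nat.
Qed.

Definition harmonic_sum {R : realType} (n : nat) : R := \sum_(1 <= i < n.+1) i%:R^-1.

Lemma harmonic_sum_ge0 (R : realType) n : 0 <= harmonic_sum n :> R.
Proof. by apply: sumr_ge0. Qed.

Lemma harmonic_sum_le (R : realType) m n : (m <= n)%N ->
  harmonic_sum m <= harmonic_sum n :> R.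
Proof.
move=> mn; rewrite /harmonic_sum [leRHS](@big_cat_nat _ _ _ m.+1) //= lerDl.
exact: sumr_ge0.
Qed.

Lemma root_fun_calF (R : realType) (k B : nat) (z : R[i])
  (omega : {ffun 'I_B -> 'I_k}) : k.-primitive_root z -> calF R k (root_fun z omega).
Proof.
move=> z_prim; split.
  split=> [|m n m0 n0]; first by rewrite /root_fun big1 // => p _; rewrite logn1 muln0.
  rewrite /root_fun -big_split /=; apply: eq_bigr => p _.
  by rewrite lognM // mulnDr exprD.
move=> p _; right => /=; rewrite /root_fun -prodrXl big1 // => q _.
by rewrite exprAC (prim_expr_order z_prim) expr1n.
Qed.

Lemma sum_multiples_one (R : realType) (x d : nat) : (0 < d)%N ->
  \sum_(1 <= n < x.+1 | (d %| n)%N) 1 <= x%:R / d%:R :> R.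
Proof.
move=> d0; rewrite (@sum_multiples _ (fun=> 1)) // sumr_const_nat subn1 /=.
by rewrite ler_pdivlMr ?ltr0n // -natrM ler_nat leq_divM.
Qed.

Lemma sum_multiples_inv (R : realType) (x d : nat) : (0 < d)%N ->
  \sum_(1 <= n < x.+1 | (d %| n)%N) n%:R^-1 = harmonic_sum (x %/ d) / d%:R :> R.
Proof.
move=> d0; rewrite (@sum_multiples _ (fun n => n%:R^-1)) // mulr_suml.
by apply: eq_bigr => q _; rewrite natrM invfM.
Qed.

Lemma sum_multiples_inv_le (R : realType) (x d : nat) : (0 < d)%N ->
  \sum_(1 <= n < x.+1 | (d %| n)%N) n%:R^-1 <= harmonic_sum x / d%:R :> R.
Proof.
by move=> d0; rewrite sum_multiples_inv // ler_pM2r ?invr_gt0 ?ltr0n // harmonic_sum_le // leq_div.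
Qed.

Lemma exists_le_average (R : realType) (T : finType) (P Q : T -> R) (q : R) :
  (forall t, 0 <= P t) -> \sum_t P t = 1 -> \sum_t P t * Q t <= q ->
  exists t, Q t <= q.
Proof.
move=> P0 P1 PQ; apply: contrapT => /forallNP noQ.
have gtQ t : q < Q t by rewrite ltNge; apply/negP/noQ.
have [t Pt] : exists t, 0 < P t.
  apply: contrapT => /forallNP noP.
  move: P1; rewrite big1 => [/eqP|t _]; first by rewrite eq_sym oner_eq0.
  by apply/eqP; rewrite eq_le P0 andbT leNgt; apply/negP/noP.
suff : q < \sum_t P t * Q t by rewrite ltNge PQ.
rewrite -[ltLHS]mul1r -P1 mulr_suml (bigD1 t) //= [ltRHS](bigD1 t) //=.
apply: ltr_leD; first by rewrite ltr_pM2l.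
by apply: ler_sum => s _; rewrite ler_wpM2l // ltW.
Qed.

(* The choice is made by averaging over independent values of f at the primes p
   with [phi p != 0]; the weights x^-3 make the total variance logarithmic. *)
Lemma exists_near_mean_fun (R : realType) (k B Y nX : nat) (phi : nat -> R) :
  (1 < k)%N -> (0 < nX)%N -> (forall p, 0 <= phi p <= 2) ->
  (forall p, phi p * (k%:R - 1) <= k%:R) -> (forall p, phi p != 0 -> prime p) ->
  let V := 12 * (\sum_(p < B | phi p != 0) (p%:R ^+ 2)^-1) *
           (k%:R * harmonic_sum Y + 1) in
  exists f : nat -> R[i], [/\ calF R k f,
   forall n, Normc.normc (f n) = 1,
   forall j, (1 <= j <= k.-1)%N ->
     \sum_(1 <= x < Y.+1) Normc.normc (\sum_(1 <= n < x.+1)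
        (f n ^+ j - (mean_fun B phi n)%:C%C)) ^+ 2 / x%:R ^+ 3 <= V &
   Normc.normc (\sum_(1 <= n < nX.+1)
     (n%:R^-1)%:C%C * (f n - (mean_fun B phi n)%:C%C)) ^+ 2
     <= V * harmonic_sum nX ^+ 2].
Proof.
move=> k1 nX0 phi2 phik phi_prime V; have k0 : (0 < k)%N by lia.
have [z z_prim] := prim_root_exists R[i] k0.
pose W := \sum_(p < B | phi p != 0) (p%:R ^+ 2)^-1 : R.
have HX : 0 < harmonic_sum nX :> R.
  by apply: lt_le_trans (harmonic_sum_le R nX0); rewrite /harmonic_sum big_nat1 invr1.
pose P (omega : {ffun 'I_B -> 'I_k}) := complex.Re (law_prob (fun p => (phi p)%:C%C) omega).
have PC omega : (P omega)%:C%C = law_prob (fun p => (phi p)%:C%C) omega /\ 0 <= P omega.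
  have : 0 <= law_prob (fun p => (phi p)%:C%C) omega.
    apply: law_prob_ge0 => // p.
      by have /andP[] := phi2 p; rewrite -lecR.
    by rewrite -(rmorph_nat (real_complex R) k) -(rmorph1 (real_complex R)) -rmorphB -rmorphM lecR.
  move=> h; have := ger0_real h; move: h; rewrite /P; case: (law_prob _ _) => a b /=.
  by move=> h; rewrite complex_real => /eqP b0; move: h; rewrite b0 -(rmorph0 (real_complex R)) lecR.
have P0 omega : 0 <= P omega by have [] := PC omega.
have P1 : \sum_omega P omega = 1.
  apply: complexI; rewrite rmorph_sum rmorph1 -(@law_prob_total _ k B (fun p => (phi p)%:C%C) k0).
  by apply: eq_bigr => omega _; have [] := PC omega.
pose D1 (omega : {ffun 'I_B -> 'I_k}) j x : R := Normc.normc (\sum_(1 <= n < x.+1)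
        (root_fun z omega n ^+ j - (mean_fun B phi n)%:C%C)) ^+ 2.
pose D2 (omega : {ffun 'I_B -> 'I_k}) : R := Normc.normc (\sum_(1 <= n < nX.+1)
     (n%:R^-1)%:C%C * (root_fun z omega n - (mean_fun B phi n)%:C%C)) ^+ 2.
(* All the nonnegative errors, over every [j] and [x] as well as the logarithmic one, are added up,
   so that one [omega] below the average controls them together. *)
pose Q (omega : {ffun 'I_B -> 'I_k}) : R := \sum_(1 <= j < k) \sum_(1 <= x < Y.+1) D1 omega j x / x%:R ^+ 3 +
   D2 omega / harmonic_sum nX ^+ 2.
have D1_le j x : (0 < j < k)%N -> \sum_omega P omega * D1 omega j x <= 12 * x%:R ^+ 2 * W.
  move=> jk; have := @root_fun_second_moment_real R k B j x phi (fun=> 1) z x%:R z_prim jk phi2 phik phi_prime.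
  move/(_ (fun=> ler01) (fun d d0 => sum_multiples_one R x d0)).
  congr (_ <= _); apply: eq_bigr => omega _; rewrite /P /D1; congr (_ * Normc.normc _ ^+ 2).
  by apply: eq_bigr => n _; rewrite mul1r.
have D2_le : \sum_omega P omega * D2 omega <= 12 * harmonic_sum nX ^+ 2 * W.
  have := @root_fun_second_moment_real R k B 1 nX phi (fun n => n%:R^-1) z (harmonic_sum nX) z_prim k1 phi2 phik phi_prime.
  apply=> [n|d d0]; first by rewrite invr_ge0.
  exact: sum_multiples_inv_le.
have Qavg : \sum_omega P omega * Q omega <= V.
  have -> : \sum_omega P omega * Q omega =
     \sum_(1 <= j < k) \sum_(1 <= x < Y.+1) (\sum_omega P omega * D1 omega j x) / x%:R ^+ 3 +
     (\sum_omega P omega * D2 omega) / harmonic_sum nX ^+ 2.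
    under eq_bigr do rewrite /Q mulrDr.
    rewrite big_split /= mulr_suml; congr (_ + _); last first.
      by apply: eq_bigr => omega _; rewrite mulrA.
    under eq_bigr do rewrite mulr_sumr.
    rewrite exchange_big /=; apply: eq_bigr => j _.
    under eq_bigr do rewrite mulr_sumr.
    rewrite exchange_big /=; apply: eq_bigr => x _.
    by rewrite mulr_suml; apply: eq_bigr => omega _; rewrite mulrA.
  have -> : V = k%:R * (12 * W * harmonic_sum Y) + 12 * W by rewrite /V -/W; ring.
  have W0 : 0 <= W by apply: sumr_ge0 => p _; rewrite invr_ge0 exprn_ge0.
  apply: lerD; last by rewrite ler_pdivrMr ?exprn_gt0 // mulrAC.
  apply: (@le_trans _ _ (\sum_(1 <= j < k) 12 * W * harmonic_sum Y)).
    rewrite !big_nat; apply: ler_sum => j jk.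
    rewrite /harmonic_sum mulr_sumr !big_nat; apply: ler_sum => x /andP[x0 _].
    have x0' : 0 < x%:R :> R by rewrite ltr0n.
    rewrite ler_pdivrMr ?exprn_gt0 //; apply: le_trans (D1_le _ _ jk) _.
    rewrite le_eqVlt; apply/orP; left; apply/eqP; field; exact: lt0r_neq0.
  rewrite sumr_const_nat -[leLHS]mulr_natl ler_wpM2r ?mulr_ge0 ?harmonic_sum_ge0 // ler_nat; lia.
have [omega Qo] := exists_le_average P0 P1 Qavg.
have D1_0 j x : 0 <= D1 omega j x by exact: sqr_ge0.
have D2_0 : 0 <= D2 omega by exact: sqr_ge0.
have S1_0 j : 0 <= \sum_(1 <= x < Y.+1) D1 omega j x / x%:R ^+ 3.
  apply: sumr_ge0 => x _; rewrite mulr_ge0 ?D1_0 // invr_ge0 exprn_ge0.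
exists (root_fun z omega); split; first exact: root_fun_calF.
  by move=> n; apply: complexI; rewrite -normc_norm norm_root_fun.
  move=> j jk; have jk' : (1 <= j < k)%N by lia.
  apply: le_trans Qo; rewrite /Q; apply: ler_wpDr; first by rewrite mulr_ge0 ?D2_0 // invr_ge0 exprn_ge0 // ltW.
  rewrite [leRHS](bigD1_seq j) ?mem_index_iota //=; last exact: iota_uniq.
  by apply: ler_wpDr => //; apply: sumr_ge0.
rewrite -ler_pdivrMr ?exprn_gt0 //; apply: le_trans Qo; rewrite /Q lerDr.
by apply: sumr_ge0.
Qed.

(** * Mean values of the averaged function *)

Lemma prod_primes_dvd (B : nat) (T : {set 'I_B}) (n : nat) :
  {in T, forall p : 'I_B, prime p} -> (0 < n)%N ->
  ((\prod_(p in T) p)%N %| n)%N = [forall p in T, (0 < logn p n)%N].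
Proof.
move=> T_prime n0.
have logn_dvd (p : 'I_B) : p \in T -> (0 < logn p n)%N = (p %| n)%N.
  by move=> pT; rewrite logn_gt0 mem_primes T_prime // n0.
apply/idP/forall_inP => [dn p pT|Tn].
  by rewrite logn_dvd // (dvdn_trans _ dn) // (bigD1 p) //= dvdn_mulr.
suff : forall s : seq 'I_B, uniq s -> {subset s <= T} -> (\prod_(p <- s) p %| n)%N.
  move=> /(_ (enum T) (enum_uniq _)); rewrite -big_enum /=; apply=> p.
  by rewrite mem_enum.
elim=> [|p s IHs] /=; first by rewrite big_nil dvd1n.
move=> /andP[ps us] sT; rewrite big_cons Gauss_dvd.
  rewrite -logn_dvd ?Tn ?sT ?mem_head ?IHs // => q qs; apply: sT.
  by rewrite in_cons qs orbT.
rewrite coprime_sym big_seq; elim/big_rec: _ => [|q m qs pm]; first exact: coprime1n.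
rewrite coprimeMl pm andbT prime_coprime ?T_prime ?sT ?in_cons ?qs ?orbT //.
rewrite dvdn_prime2 ?T_prime ?sT ?mem_head ?in_cons ?qs ?orbT //.
by apply: contra ps => /eqP/val_inj<-.
Qed.

(** Expansion over squarefree d, represented by their sets of prime factors; a set with an index
    where [phi] vanishes has coefficient 0. *)
Lemma sum_mean_fun (R : realType) (B x : nat) (phi u : nat -> R) :
  (forall p, phi p != 0 -> prime p) ->
  \sum_(1 <= n < x.+1) u n * mean_fun B phi n =
  \sum_(T : {set 'I_B}) (\prod_(p in T) - phi p) *
    \sum_(1 <= n < x.+1 | ((\prod_(p in T) p)%N %| n)%N) u n.
Proof.
move=> phi_prime.
transitivity (\sum_(1 <= n < x.+1) \sum_(T : {set 'I_B})
   u n * \prod_(p in T) (- phi p * (0 < logn p n)%:R)).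
  apply: eq_bigr => n _; rewrite -mulr_sumr; congr (_ * _); rewrite /mean_fun.
  under eq_bigr do rewrite addrC -mulNr.
  by rewrite bigA_distr; apply: eq_bigr => T _; rewrite -big_mkcond.
rewrite exchange_big /=; apply: eq_bigr => T _.
under eq_bigr do rewrite big_split /= mulrCA.
rewrite -mulr_sumr; have [->|nz] := @eqVneq R (\prod_(p in T) - phi p) 0.
  by rewrite !mul0r.
congr (_ * _); rewrite [RHS]big_mkcond !big_nat; apply: eq_bigr => n /andP[n0 _].
have T_prime : {in T, forall p : 'I_B, prime p}.
  move=> p pT; apply: phi_prime; move/prodf_neq0: nz => /(_ p pT).
  by rewrite oppr_eq0.
rewrite prod_primes_dvd // -natr_prod -mulr_natr.
case: forall_inP => [Tn|nTn].
  by rewrite (_ : \prod_(p in T) _ = 1%N) ?mulr1 // big1 // => p pT; rewrite Tn.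
have [p pT pn] : exists2 p, p \in T & logn p n = 0%N.
  apply: contrapT => H; apply: nTn => p pT; rewrite lt0n; apply/eqP => pn.
  by apply: H; exists p.
by rewrite (_ : \prod_(p in T) _ = 0%N) ?mulr0 // (bigD1 p) //= pn.
Qed.

Lemma harmonic_sum_ge_ln (R : realType) q : ln q.+1%:R <= harmonic_sum q :> R.
Proof.
elim: q => [|q IHq]; first by rewrite ln1 harmonic_sum_ge0.
rewrite /harmonic_sum big_nat_recr //=.
by have := lerD IHq (@ln_succ_sub R q.+1 isT); rewrite addrCA subrr addr0.
Qed.

Lemma inv_le_ln_succ (R : realType) q : (0 < q)%N ->
  q.+1%:R^-1 <= ln q.+1%:R - ln q%:R :> R.
Proof.
move=> q0; have q1 : q.+1%:R != 0 :> R by rewrite pnatr_eq0.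
have : ln (1 - q.+1%:R^-1) <= - q.+1%:R^-1 :> R.
  by apply: le_ln1Dx; rewrite ltrN2 invf_lt1 ?ltr1n.
have -> : 1 - q.+1%:R^-1 = q%:R / q.+1%:R :> R.
  by apply: (mulIf q1); rewrite mulrBl mul1r mulVf // divfK // -natr1 addrK.
by rewrite ln_div ?posrE ?ltr0n // lerNr opprB.
Qed.

Lemma harmonic_sum_le_ln (R : realType) q : (0 < q)%N ->
  harmonic_sum q <= 1 + ln q%:R :> R.
Proof.
case: q => // q _; elim: q => [|q IHq].
  by rewrite /harmonic_sum big_nat1 invr1 ln1 addr0.
rewrite /harmonic_sum big_nat_recr //=.
apply: le_trans (lerD IHq (@inv_le_ln_succ R q.+1 isT)) _.
lra.
Qed.

(** * Sums over squarefree d grouped by the bin of log d *)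

Section SubsetSums.
Context {R : realType} {B r L : nat} {phi : nat -> R} {b : nat -> nat} {h : R}.
Hypothesis phi_prime : forall p, phi p != 0 -> prime p.
Hypothesis phi_ge0 : forall p, 0 <= phi p.
Hypothesis h_gt0 : 0 < h.
Hypothesis phi_bin : forall p, phi p != 0 -> 
  (b p)%:R * h <= ln p%:R < (b p).+1%:R * h /\ (r < b p)%N.

Let coefG n := (\prod_(p < B) (1 + (- (phi p / p%:R)) *: 'X^(b p)))`_n.
Let coefC n := (\prod_(p < B) (1 + (phi p / p%:R) *: 'X^(b p)))`_n.
Let bin (T : {set 'I_B}) := (\sum_(p in T) b p)%N.
Let weight (T : {set 'I_B}) := \prod_(p in T) - (phi p / p%:R).

Lemma subset_sum_approx (v : nat -> R) (w e : nat -> R) :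
  (forall n, (L < n)%N -> w n = 0) -> (forall n, (L < n)%N -> e n = 0) ->
  (forall T, weight T != 0 -> `|v (\prod_(p in T) p)%N - w (bin T)| <= e (bin T)) ->
  `|\sum_T weight T * v (\prod_(p in T) p)%N - \sum_(0 <= n < L.+1) coefG n * w n|
  <= \sum_(0 <= n < L.+1) coefC n * e n.
Proof.
move=> w0 e0 vw; rewrite -sum_subsets_coef // -sum_subsets_coef //.
rewrite -sumrB; apply: le_trans (ler_norm_sum _ _ _) _; apply: ler_sum => T _.
rewrite -/(weight T) -/(bin T) -mulrBr normrM.
have -> : \prod_(p in T) (phi p / p%:R) = `|weight T|.
  rewrite normr_prod; apply: eq_bigr => p _; rewrite normrN ger0_norm //.
  by rewrite divr_ge0.
have [->|nz] := @eqVneq R (weight T) 0; first by rewrite normr0 !mul0r.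
by rewrite ler_wpM2l // vw.
Qed.

(** Rounding loses at most [h] per prime factor, and every factor uses up at least [r.+1] bins, so
    there are few of them. *)
Lemma weight_bin T : weight T != 0 ->
  [/\ (0 < \prod_(p in T) p)%N,
      (bin T)%:R * h <= ln (\prod_(p in T) p)%N%:R <= (bin T + #|T|)%:R * h &
      (#|T| * r.+1 <= bin T)%N].
Proof.
move=> nz.
have Tphi : {in T, forall p : 'I_B, phi p != 0}.
  move=> p pT; move/prodf_neq0: nz => /(_ p pT); rewrite oppr_eq0 mulf_eq0 negb_or.
  by case/andP.
have p_gt0 : {in T, forall p : 'I_B, (0 < p)%N}.
  by move=> p pT; apply/prime_gt0/phi_prime/Tphi.
have T0 : (0 < \prod_(p in T) p)%N by apply: prodn_cond_gt0.
split => //; last first.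
  rewrite -sum_nat_const /bin; apply: leq_sum => p pT.
  by have [] := phi_bin (Tphi _ pT).
rewrite ln_prod_nat // /bin -sum1_card -big_split /= !natr_sum !mulr_suml.
apply/andP; split; apply: ler_sum => p pT;
  have [/andP[h1 h2] _] := phi_bin (Tphi _ pT) => //.
by rewrite addn1 ltW.
Qed.

Lemma prod_weight T : weight T != 0 ->
  \prod_(p in T) - phi p = weight T * (\prod_(p in T) p)%N%:R.
Proof.
move=> nz; rewrite natr_prod /weight -big_split /=; apply: eq_bigr => p pT.
move/prodf_neq0: nz => /(_ p pT); rewrite oppr_eq0 mulf_eq0 negb_or invr_eq0.
by case/andP => _ p0; rewrite mulNr divfK.
Qed.

Lemma prod_weight0 T : weight T = 0 -> \prod_(p in T) - phi p = 0.
Proof.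
move=> /eqP/prodf_eq0[p pT]; rewrite oppr_eq0 mulf_eq0 invr_eq0 => p0.
apply/eqP/prodf_eq0; exists p => //; rewrite oppr_eq0.
case/orP: p0 => // /eqP p0; apply/negP => /negP /phi_prime.
by case: (nat_of_ord p) p0 => // n /eqP; rewrite pnatr_eq0.
Qed.

Lemma sum_mean_fun_weight (x : nat) (u v : nat -> R) :
  (forall d, (0 < d)%N -> d%:R * \sum_(1 <= n < x.+1 | (d %| n)%N) u n = v d) ->
  \sum_(1 <= n < x.+1) u n * mean_fun B phi n =
  \sum_T weight T * v (\prod_(p in T) p)%N.
Proof.
move=> uv; rewrite sum_mean_fun //; apply: eq_bigr => T _.
have [w0|nz] := @eqVneq R (weight T) 0; first by rewrite prod_weight0 // w0 !mul0r.
have [d0 _ _] := weight_bin nz.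
by rewrite prod_weight // -mulrA uv.
Qed.

(** d floor(x/d) is x up to an error d <= x e^(-h) when the bin is at most [n0], lies between 0 and
    x for bins up to [v0], and is 0 beyond, where d > x. The gap [M] between [n0] and [v0] absorbs
    the rounding. *)
Lemma mean_fun_sum_approx (x n0 v0 M : nat) : (0 < x)%N -> (v0 <= L)%N ->
  (L < M.+1 * r.+1)%N -> (n0 + M < v0)%N ->
  v0%:R * h <= ln x%:R < v0.+1%:R * h ->
  `|\sum_(1 <= n < x.+1) mean_fun B phi n|
  <= x%:R * (`|\sum_(0 <= n < n0.+1) coefG n| +
     expR (- h) * \sum_(0 <= n < n0.+1) coefC n + \sum_(n0.+1 <= n < v0.+1) coefC n).
Proof.
move=> x0 v0L LM n0v /andP[hx1 hx2].
have x0' : 0 < x%:R :> R by rewrite ltr0n.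
pose v d := (d * (x %/ d))%N%:R : R.
have -> : \sum_(1 <= n < x.+1) mean_fun B phi n = \sum_T weight T * v (\prod_(p in T) p)%N.
  rewrite -(@sum_mean_fun_weight x (fun=> 1) v); first by apply: eq_bigr => n _; rewrite mul1r.
  by move=> d d0; rewrite (@sum_multiples _ (fun=> 1)) // sumr_const_nat subn1 /= /v natrM.
pose w n := if (n <= n0)%N then x%:R else 0 : R.
pose e n := x%:R * (if (n <= n0)%N then expR (- h) else if (n <= v0)%N then 1 else 0) : R.
have w0 n : (L < n)%N -> w n = 0 by move=> Ln; rewrite /w ifF //; apply/negbTE; lia.
have e0 n : (L < n)%N -> e n = 0.
  by move=> Ln; rewrite /e !ifF ?mulr0 //; apply/negbTE; lia.
have := subset_sum_approx w0 e0 (v := v).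
have step T : weight T != 0 -> `|v (\prod_(p in T) p)%N - w (bin T)| <= e (bin T).
  move=> nz; have [d0 /andP[d1 d2] Tb] := weight_bin nz.
  set d := (\prod_(p in T) p)%N in d0 d1 d2 *.
  have d0' : 0 < d%:R :> R by rewrite ltr0n.
  have v_le : v d <= x%:R by rewrite /v ler_nat mulnC leq_divM.
  have v_ge0 : 0 <= v d by [].
  rewrite /w /e; case: ifP => [bn|/negbT bn].
    have TM : (#|T| <= M)%N by clear -Tb bn n0v v0L LM; nia.
    have dx : d%:R <= x%:R * expR (- h).
      rewrite -[d%:R]lnK ?posrE // -[x%:R]lnK ?posrE // -expRD ler_expR.
      apply: le_trans d2 _; rewrite lerBrDr.
      apply: le_trans hx1; rewrite -[X in _ + X]mul1r -mulrDl natr1 ler_pM2r //.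
      rewrite ler_nat; lia.
    rewrite distrC ger0_norm ?subr_ge0 //; apply: le_trans dx.
    rewrite lerBlDr /v -natrD ler_nat {1}(divn_eq x d) mulnC addnC leq_add2r.
    by rewrite ltnW // ltn_mod.
  case: ifP => [bv|/negbT bv].
    by rewrite subr0 ger0_norm // mulr1.
  rewrite /v divn_small ?muln0 ?subr0 ?normr0 ?mulr0 //.
  rewrite -(ltr_nat R) -ltr_ln ?posrE //; apply: lt_le_trans hx2 _.
  apply: le_trans d1; rewrite ler_pM2r // ler_nat; lia.
move=> /(_ step) H.
have n0L : (n0 < L)%N by lia.
have Ew : \sum_(0 <= n < L.+1) coefG n * w n = x%:R * \sum_(0 <= n < n0.+1) coefG n.
  rewrite (@big_cat_nat _ _ _ n0.+1) //=; last by lia.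
  rewrite [X in _ + X]big_nat [X in _ + X]big1 ?addr0.
    rewrite mulr_sumr !big_nat; apply: eq_bigr => n /andP[_ nn].
    by rewrite /w -ltnS nn mulrC.
  by move=> n /andP[nn _]; rewrite /w ifF ?mulr0 //; apply/negbTE; lia.
have Ee : \sum_(0 <= n < L.+1) coefC n * e n = x%:R *
   (expR (- h) * \sum_(0 <= n < n0.+1) coefC n + \sum_(n0.+1 <= n < v0.+1) coefC n).
  rewrite (@big_cat_nat _ _ _ n0.+1) //=; last by lia.
  rewrite [X in _ + X = _](@big_cat_nat _ _ _ v0.+1) /=; [|lia|lia].
  rewrite [X in _ + (_ + X)]big_nat [X in _ + (_ + X)]big1 ?addr0; last first.
    move=> n /andP[nn _]; rewrite /e !ifF ?mulr0 //; apply/negbTE; lia.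
  rewrite mulrDr !mulr_sumr !big_nat; congr (_ + _); apply: eq_bigr => n /andP[n1 n2].
    by rewrite /e -ltnS n2; ring.
  rewrite /e ifF; last by apply/negbTE; lia.
  by rewrite -ltnS n2 mulr1 mulrC.
rewrite Ew Ee in H; rewrite -addrA mulrDr -lerBlDl.
apply: le_trans H; apply: le_trans (lerB_dist _ _).
by rewrite normrM normr_nat.
Qed.

(** The harmonic sum up to x/d is ln(x/d) up to 1, and ln(x/d) is (b0 - bin) h up to 1 from ln x and
    [M] h from the rounding of ln d. *)
Lemma mean_fun_log_sum_approx (x b0 M : nat) : (0 < x)%N -> (b0 <= L)%N ->
  (L < M.+1 * r.+1)%N -> b0%:R * h - 1 <= ln x%:R <= b0%:R * h ->
  `|\sum_(1 <= n < x.+1) n%:R^-1 * mean_fun B phi n -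
    h * \sum_(0 <= n < b0.+1) coefG n * (b0 - n)%:R|
  <= (M%:R * h + 2) * \sum_(0 <= n < b0.+1) coefC n.
Proof.
move=> x0 b0L LM /andP[hx1 hx2].
have x0' : 0 < x%:R :> R by rewrite ltr0n.
pose v d := harmonic_sum (x %/ d) : R.
rewrite (@sum_mean_fun_weight x (fun n => n%:R^-1) v); last first.
  by move=> d d0; rewrite sum_multiples_inv // mulrC divfK // pnatr_eq0 -lt0n.
pose w n := if (n <= b0)%N then (b0 - n)%:R * h else 0 : R.
pose e n := if (n <= b0)%N then M%:R * h + 2 else 0 : R.
have w0 n : (L < n)%N -> w n = 0 by move=> Ln; rewrite /w ifF //; apply/negbTE; lia.
have e0 n : (L < n)%N -> e n = 0 by move=> Ln; rewrite /e ifF //; apply/negbTE; lia.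
have cut (F G : nat -> R) : (forall n, (b0 < n)%N -> G n = 0) ->
    \sum_(0 <= n < L.+1) F n * G n = \sum_(0 <= n < b0.+1) F n * G n.
  move=> G0; rewrite (@big_cat_nat _ _ _ b0.+1) //=.
  rewrite [X in _ + X]big_nat [X in _ + X]big1 ?addr0 // => n /andP[bn _].
  by rewrite G0 ?mulr0.
have := subset_sum_approx w0 e0 (v := v).
have step T : weight T != 0 -> `|v (\prod_(p in T) p)%N - w (bin T)| <= e (bin T).
  move=> nz; have [d0 /andP[d1 d2] Tb] := weight_bin nz.
  set d := (\prod_(p in T) p)%N in d0 d1 d2 *.
  have d0' : 0 < d%:R :> R by rewrite ltr0n.
  rewrite /w /e; case: ifP => [bn|/negbT bn]; last first.
    rewrite subr0 /v divn_small ?/harmonic_sum ?big_geq ?normr0 //.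
    rewrite -(ltr_nat R) -ltr_ln ?posrE //; apply: le_lt_trans hx2 _.
    apply: lt_le_trans d1; rewrite ltr_pM2r // ltr_nat; lia.
  have TM : (#|T| <= M)%N by clear -Tb bn b0L LM; nia.
  have d2' : ln d%:R <= (bin T)%:R * h + M%:R * h.
    by apply: le_trans d2 _; rewrite natrD mulrDl lerD2l ler_pM2r // ler_nat.
  have Mh0 : 0 <= M%:R * h by rewrite mulr_ge0 // ltW.
  rewrite natrB // mulrBl.
  have [dx|xd] := leqP d x.
    have q0 : (0 < x %/ d)%N by rewrite divn_gt0.
    have q0' : 0 < (x %/ d)%:R :> R by rewrite ltr0n.
    have v1 : ln x%:R - ln d%:R <= v d.
      rewrite -ln_div ?posrE //; apply: le_trans (@harmonic_sum_ge_ln R _).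
      rewrite ler_ln ?posrE ?divr_gt0 ?ltr0n // ler_pdivrMr // -natrM ler_nat.
      by rewrite ltnW // ltn_ceil.
    have v2 : v d <= 1 + (ln x%:R - ln d%:R).
      rewrite -ln_div ?posrE //; apply: le_trans (@harmonic_sum_le_ln R _ q0) _.
      rewrite lerD2l ler_ln ?posrE ?divr_gt0 // ler_pdivlMr // -natrM ler_nat.
      exact: leq_divM.
    rewrite ler_norml; apply/andP; split; lra.
  have lnxd : ln x%:R < ln d%:R :> R by rewrite ltr_ln ?posrE // ltr_nat.
  have bn' : (bin T)%:R * h <= b0%:R * h by rewrite ler_pM2r // ler_nat.
  rewrite /v divn_small // /harmonic_sum big_geq // ler_norml.
  apply/andP; split; lra.
move=> /(_ step); rewrite !cut; last 2 first.
- by move=> n bn; rewrite /w /e ifF //; apply/negbTE; lia.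
- by move=> n bn; rewrite /w /e ifF //; apply/negbTE; lia.
congr (`|_ - _| <= _); rewrite mulr_sumr !big_nat; apply: eq_bigr => n /andP[_ nb].
  by rewrite /w -ltnS nb; ring.
by rewrite /e -ltnS nb mulrC.
Qed.

End SubsetSums.

(** * Comparison of the prime product with the renewal sequence *)

Lemma coefXderiv (R : realType) (P : {poly R}) n : ('X * deriv P)`_n = n%:R * P`_n.
Proof.
rewrite coefXM coef_deriv; case: n => [|n] /=; first by rewrite mul0r.
by rewrite mulr_natl.
Qed.

(* The coefficients of [1 - W], for [W] the generating function of [w]. *)
Definition renewal_defect {R : realType} (w : nat -> R) (n : nat) : R :=
  (n == 0%N)%:R - w n.

(** Coefficient form of X (1 - W)' + Phi (1 - W) = 0. *)
Lemma renewal_defect_rec (R : realType) r D (w phi : nat -> R) n :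
  renewal_pair r D w phi ->
  n%:R * renewal_defect w n + \sum_(j < n.+1) phi j * renewal_defect w (n - j)%N = 0.
Proof.
move=> P; have [_ w0 _ phiE] := P.
have -> : \sum_(j < n.+1) phi j * renewal_defect w (n - j)%N =
   phi n - \sum_(1 <= l < n.+1) w l * phi (n - l)%N.
  under eq_bigr do rewrite mulrBr.
  rewrite sumrB; congr (_ - _).
    rewrite big_ord_recr /= subnn eqxx mulr1 big1 ?add0r // => j _.
    by rewrite (_ : (n - j == 0)%N = false) ?mulr0 //; apply/negbTE; rewrite subn_eq0 -ltnNge.
  rewrite -(big_mkord xpredT (fun j => phi j * w (n - j)%N)) big_nat_rev /= add0n.
  rewrite big_ltn // subn1 /= subnn w0 ?mulr0 ?add0r; last by left.
  rewrite !big_nat; apply: eq_bigr => l /andP[l0 ln].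
  by rewrite subSS mulrC subKn.
rewrite [in phi n]phiE /renewal_defect addrK.
case: n => [|n]; first by rewrite !mul0r addr0.
by rewrite sub0r mulrN addNr.
Qed.

Lemma renewal_defect_sum (R : realType) r D (w phi : nat -> R) n :
  renewal_pair r D w phi -> (D <= n)%N ->
  \sum_(0 <= i < n.+1) renewal_defect w i = 0.
Proof.
move=> [_ w0 w1 _] Dn; rewrite /renewal_defect sumrB.
have -> : \sum_(0 <= i < n.+1) (i == 0%N)%:R = 1 :> R.
  by rewrite big_ltn // eqxx big_nat big1 ?addr0 // => -[].
rewrite (@big_cat_nat _ _ _ D.+1) //= w1 [X in _ - (_ + X)]big_nat big1 ?addr0 ?subrr // => i /andP[Di _].
by rewrite w0 //; right.
Qed.

(** Since 1 - W vanishes at 1, the part with the factor n drops out and W'(1), the mean step,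
    remains. *)
Lemma renewal_defect_moment (R : realType) r D (w phi : nat -> R) n :
  renewal_pair r D w phi -> (D <= n)%N ->
  \sum_(0 <= i < n.+1) renewal_defect w i * (n - i)%:R =
  \sum_(0 <= i < D.+1) i%:R * w i.
Proof.
move=> P Dn; have [_ w0 _ _] := P.
have := renewal_defect_sum P Dn => /(congr1 (fun x => x * n%:R)); rewrite mul0r mulr_suml => S0.
rewrite -[LHS]subr0 -[X in _ - X]S0 -sumrB.
rewrite [LHS](@big_cat_nat _ _ _ D.+1) //= [X in _ + X]big_nat [X in _ + X]big1 ?addr0; last first.
  by move=> [|i] /andP[Di _] //; rewrite /renewal_defect w0 ?subr0 ?mul0r ?subr0 //; right.
rewrite !big_nat; apply: eq_bigr => i /andP[_ iD].
rewrite natrB; last by lia.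
rewrite /renewal_defect; case: i iD => [|i] _; first by ring.
by rewrite sub0r; ring.
Qed.

Section Coefficients.
Context {R : realType} {I : finType} {r D L : nat} {a : I -> R} {b : I -> nat}.
Context {w phi : nat -> R}.
Hypothesis P : renewal_pair r D w phi.
Hypothesis phi2 : forall n, phi n <= 2.
Hypothesis a_ge0 : forall p, 0 <= a p.
Hypothesis a_bin : forall p, a p != 0 -> (r < b p)%N.
Hypothesis a_phi : forall n, (n <= L)%N -> \sum_(p | b p == n) (b p)%:R * a p = phi n.

Let coefG n := (\prod_p (1 + (- a p) *: 'X^(b p)))`_n.
Let coefC n := (\prod_p (1 + a p *: 'X^(b p)))`_n.

Lemma coefC_ge0 n : 0 <= coefC n.
Proof.
suff /(_ n) : coef_dominated (\prod_p (1 + a p *: 'X^(b p))) (\prod_p (1 + a p *: 'X^(b p))).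
  by apply: le_trans.
by apply: coef_dominated_prod => p; rewrite ger0_norm.
Qed.

Lemma coef_at0 (x : I -> R) : (forall p, x p != 0 -> a p != 0) ->
  (\prod_p (1 + x p *: 'X^(b p)))`_0 = 1.
Proof.
move=> xa; rewrite coef0_prod big1 // => p _; rewrite coefD coef1 coefZ coefXn.
have [->|xp] := eqVneq (x p) 0; first by rewrite mul0r addr0.
by have := a_bin (xa _ xp); case: (b p) => // n _; rewrite mulr0 addr0.
Qed.

(** The absolute coefficients satisfy the renewal inequality because the bin sums of [a] reproduce
    [phi], which is at most 2. *)
Lemma coefC_bound :
  (forall n, (r < n <= L.+1)%N ->
     \sum_(0 <= m < n) coefC m <= n%:R * n.+1%:R / (r.+1%:R * r.+2%:R)) /\
  (forall n, (0 < n <= L)%N -> coefC n <= 2 * n.+1%:R / (r.+1%:R * r.+2%:R)).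
Proof.
apply: (@renewal_mass_bound R r L coefC phi).
- exact: coef_at0.
- exact: coefC_ge0.
- move=> n nL; rewrite -coefXderiv; apply: le_trans (log_deriv_le _ _ a_ge0 n) _.
  rewrite coefM; apply: ler_sum => j _; rewrite ler_wpM2r ?coefC_ge0 //.
  rewrite coef_sumMXn a_phi //; by have := ltn_ord j; lia.
- exact: renewal_init P.
- by move=> j _; exact: phi2.
Qed.

(** [coefG] obeys the recurrence of the renewal defect up to the quadratic terms of
    [log_deriv_error], and both start at 1; the perturbation bound applies to the difference. *)
Lemma coefG_approx n : (n <= L)%N ->
  `|coefG n - renewal_defect w n| <=
  3 ^+ n * ((\sum_p (b p)%:R * a p ^+ 2) * \sum_(0 <= m < L.+1) coefC m).
Proof.
have [_ w0 _ _] := P.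
move: n; apply: (@renewal_perturbation R L (fun n => coefG n - renewal_defect w n) phi).
- rewrite /coefG coef_at0 /renewal_defect ?w0 ?subr0 ?subrr //; first by left.
  by move=> p; rewrite oppr_eq0.
- by apply: (renewal_init P).
- by move=> j _; rewrite phi2 (renewal_ge0 P).
move=> n nL.
have -> : n%:R * (coefG n - renewal_defect w n) +
   \sum_(j < n.+1) phi j * (coefG (n - j) - renewal_defect w (n - j)) =
   n%:R * coefG n + \sum_(j < n.+1) phi j * coefG (n - j).
  rewrite -[RHS]subr0 -[X in _ = _ - X](renewal_defect_rec n P).
  under eq_bigr do rewrite mulrBr.
  rewrite sumrB; ring.
have xa p : `|- a p| <= a p by rewrite normrN ger0_norm.
have := @log_deriv_error R I (index_enum I) _ a b xa => /(_ n).
rewrite coefB coefXderiv -/(coefG n).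
have -> : ((\sum_p ((b p)%:R * - a p) *: 'X^(b p)) *
     \prod_p (1 + - a p *: 'X^(b p)))`_n = - \sum_(j < n.+1) phi j * coefG (n - j).
  rewrite coefM -sumrN; apply: eq_bigr => j _; rewrite -mulNr; congr (_ * _).
  rewrite coef_sumMXn -a_phi; last by have := ltn_ord j; lia.
  by rewrite -sumrN; apply: eq_bigr => p _; rewrite mulrN.
rewrite opprK => /le_trans; apply; rewrite coefM.
set Q := \sum_p (b p)%:R * a p ^+ 2.
have term_ge0 p : 0 <= (b p)%:R * a p ^+ 2 by rewrite mulr_ge0 ?exprn_ge0.
apply: (@le_trans _ _ (\sum_(j < n.+1) Q * coefC (n - j))).
  apply: ler_sum => j _; rewrite ler_wpM2r ?coefC_ge0 // coef_sumMXn.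
  by rewrite /Q [leRHS](bigID (fun p => b p + b p == j)%N) /= lerDl sumr_ge0.
rewrite -mulr_sumr ler_wpM2l ?sumr_ge0 //.
rewrite -(big_mkord xpredT (fun j => coefC (n - j))) big_nat_rev /= add0n.
rewrite [leRHS](@big_cat_nat _ _ _ n.+1) //=.
rewrite (eq_big_nat _ _ (F2 := coefC)); first by rewrite lerDl sumr_ge0 // => j _; exact: coefC_ge0.
by move=> j /andP[_ jn]; rewrite subSS subKn.
Qed.

End Coefficients.

(** * Weights on primes with prescribed bin sums *)

Lemma sum_inv_sqr_le (R : realType) (B : nat) (y : R) (Q : pred nat) : 2 <= y ->
  (forall p, Q p -> y <= p%:R) -> \sum_(p < B | Q p) (p%:R ^+ 2)^-1 <= 2 / y :> R.
Proof.
move=> y2 Qy; have y0 : 0 < y by lra.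
pose S n := \sum_(0 <= p < n | Q p) (p%:R ^+ 2)^-1 : R.
have SS n : S n.+1 = S n + (if Q n then (n%:R ^+ 2)^-1 else 0).
  by rewrite /S [in LHS]big_mkcond big_nat_recr //= -big_mkcond.
have small n : n%:R <= y -> S n = 0.
  elim: n => [|n IHn] ny; first by rewrite /S big_geq.
  rewrite SS IHn ?add0r; last by apply: le_trans ny; rewrite ler_nat.
  case: ifP => // /Qy yn; move: (le_trans ny yn); rewrite ler_nat ltnn //.
have tail n : y <= n%:R -> S n <= (y - 1)^-1 - (n%:R - 1)^-1.
  elim: n => [|n IHn] yn; first by move: yn; rewrite leNgt y0.
  have y1 : 0 < y - 1 by lra.
  rewrite -natr1 addrK SS; have [ny|{}yn] := ltP n%:R y.
    rewrite small ?(ltW ny) // add0r ifF; last first.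
      by apply/negP => /Qy; rewrite leNgt ny.
    have n0 : 0 < n%:R :> R by move: yn; rewrite -natr1; lra.
    rewrite subr_ge0 lef_pV2 ?posrE //; move: yn; rewrite -natr1; lra.
  have n1 : 0 < n%:R - 1 :> R by lra.
  have n0 : 0 < n%:R :> R by lra.
  apply: (@le_trans _ _ ((y - 1)^-1 - (n%:R - 1)^-1 + (n%:R ^+ 2)^-1)).
    by apply: lerD; [exact: IHn|case: ifP => // _; rewrite invr_ge0 exprn_ge0 // ltW].
  rewrite -addrA lerD2l -subr_ge0.
  have -> : - n%:R^-1 - (- (n%:R - 1)^-1 + (n%:R ^+ 2)^-1) = (n%:R ^+ 2 * (n%:R - 1))^-1 :> R.
    by field; rewrite !gt_eqF.
  by rewrite invr_ge0 mulr_ge0 ?exprn_ge0 // ltW.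
rewrite -(big_mkord Q (fun p => (p%:R ^+ 2)^-1)) -/(S B).
have y1 : (y - 1)^-1 <= 2 / y.
  by rewrite ler_pdivlMr // mulrC ler_pdivrMr; lra.
have [yB|By] := leP y B%:R; last first.
  by rewrite small ?(ltW By) //; apply: divr_ge0 => //; apply: ltW.
apply: le_trans (tail _ yB) _; rewrite lerBlDr; apply: ler_wpDr => //.
by rewrite invr_ge0 subr_ge0; lra.
Qed.

(** Dividing by the actual sum of 1/p over the bin makes the bin sums exact. Only the size of the
    weights needs Mertens: bin n has mass at least (h-9)/((n+1)h), which costs the factors (n+1)/n
    <= (r+2)/(r+1) and h/(h-9). *)
Lemma prime_weights_exist (R : realType) (r L : nat) (h Theta kappa : R)
    (target : nat -> R) : 9 < h ->
  (forall n, 0 <= target n <= Theta) -> (forall n, (n <= r)%N -> target n = 0) ->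
  Theta * (r.+2%:R / r.+1%:R) * (h / (h - 9)) <= kappa ->
  exists (B : nat) (phi : nat -> R) (b : nat -> nat),
  [/\ forall p, phi p != 0 -> prime p,
      forall p, 0 <= phi p <= kappa,
      forall p, phi p != 0 ->
        (b p)%:R * h <= ln p%:R < (b p).+1%:R * h /\ (r < b p <= L)%N,
      forall n, (n <= L)%N ->
        \sum_(p < B | b p == n) (b p)%:R * (phi p / p%:R) = target n &
      \sum_(p < B | phi p != 0) (p%:R ^+ 2)^-1 <= 2 * expR (- h)].
Proof.
move=> h9 target2 target0 kappaP; have h0 : 0 < h by lra.
(* With this [B] all bins up to [L] are complete. *)
have [B HB] : exists B : nat, expR (L.+1%:R * h) <= B%:R.
  by exists (Num.truncn (expR (L.+1%:R * h))).+1; apply/ltW/truncnS_gt.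
pose b p := Num.truncn (ln p%:R / h : R).
have bP p : (b p)%:R * h <= ln p%:R < (b p).+1%:R * h.
  have := truncn_itv (divr_ge0 (ln_nat_ge0 R p) (ltW h0)).
  by rewrite -/(b p) ler_pdivlMr // ltr_pdivrMr.
pose mass n := \sum_(p < B | prime p && (b p == n)) p%:R^-1 : R.
pose good p := prime p && (r < b p <= L)%N.
pose phi p := if good p then target (b p) / ((b p)%:R * mass (b p)) else 0.
have phi_good p : phi p != 0 -> good p by rewrite /phi; case: ifP => //; rewrite eqxx.
have mass_ge n : (r < n <= L)%N -> (h - 9) / (n.+1%:R * h) <= mass n.
  move=> /andP[rn nL].
  have s1 : 1 <= expR (n%:R * h) by rewrite -expR0 ler_expR mulr_ge0 // ltW.
  have st : expR (n%:R * h) <= expR (n.+1%:R * h).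
    by rewrite ler_expR ler_pM2r // ler_nat.
  have tB : expR (n.+1%:R * h) <= B%:R.
    by apply: le_trans HB; rewrite ler_expR ler_pM2r // ler_nat.
  have := sum_ln_over_primes_interval s1 st tB.
  rewrite !expRK -mulrBl -natrB // subSnn mul1r big_mkord => H.
  have nh : 0 < n.+1%:R * h by rewrite mulr_gt0.
  rewrite ler_pdivrMr // /mass mulr_suml; apply: le_trans H _.
  have eqb (p : 'I_B) : prime p && (expR (n%:R * h) <= p%:R < expR (n.+1%:R * h)) = prime p && (b p == n).
    have [p_pr|//] := boolP (prime p); rewrite /=.
    have p0 : 0 < p%:R :> R by rewrite ltr0n prime_gt0.
    rewrite -[X in _ <= X]lnK ?posrE // ler_expR -[X in X < _]lnK ?posrE // ltr_expR.
    have /andP[b1 b2] := bP p.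
    apply/idP/eqP => [/andP[n1 n2]|<-]; last exact: bP.
    apply/eqP; rewrite eqn_leq; apply/andP; split.
      by rewrite -ltnS -(ltr_nat R) -(ltr_pM2r h0) (le_lt_trans b1).
    by rewrite -ltnS -(ltr_nat R) -(ltr_pM2r h0) (le_lt_trans n1).
  rewrite (eq_bigl _ _ eqb); apply: ler_sum => p /andP[p_pr /eqP bn].
  rewrite mulrC ler_wpM2l // ltW //.
  by have /andP[_] := bP p; rewrite bn.
have mass_gt0 n : (r < n <= L)%N -> 0 < mass n.
  by move=> rn; apply: lt_le_trans (mass_ge _ rn); rewrite divr_gt0 ?mulr_gt0 // subr_gt0.
exists B, phi, b; split.
- by move=> p /phi_good/andP[].
- move=> p; have [t0 tT] := andP (target2 (b p)); have [T0 T1] := andP (target2 0%N).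
  have kappa0 : 0 <= kappa.
    apply: le_trans kappaP; rewrite !mulr_ge0 ?invr_ge0 ?subr_ge0 ?(ltW h0) ?(ltW h9) //.
    exact: le_trans T1.
  rewrite /phi; case: ifP => [/andP[p_pr rb]|_]; last by rewrite lexx.
  have mp := mass_gt0 _ rb; have b0 : 0 < (b p)%:R :> R by rewrite ltr0n; clear -rb; lia.
  rewrite divr_ge0 ?mulr_ge0 ?(ltW mp) //=; apply: le_trans kappaP.
  rewrite ler_pdivrMr ?mulr_gt0 //.
  apply: (@le_trans _ _ (Theta * (r.+2%:R / r.+1%:R) * (h / (h - 9)) *
     ((b p)%:R * ((h - 9) / ((b p).+1%:R * h))))); last first.
    rewrite ler_wpM2l ?ler_wpM2l ?mass_ge // !mulr_ge0 ?invr_ge0 ?subr_ge0 ?(ltW h0) ?(ltW h9) //.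
    exact: le_trans T1.
  have -> : Theta * (r.+2%:R / r.+1%:R) * (h / (h - 9)) *
     ((b p)%:R * ((h - 9) / ((b p).+1%:R * h))) =
     Theta * ((r.+2 * b p)%:R / (r.+1 * (b p).+1)%:R).
    rewrite !natrM; field; rewrite !nat1r ?natr1; rewrite !pnatr_eq0 /= subr_eq0 !gt_eqF //=.
  apply: le_trans tT _; rewrite ler_peMr ?(le_trans T0) //.
  rewrite ler_pdivlMr ?ltr0n ?muln_gt0 // mul1r ler_nat.
  by move: rb => /andP[rb _]; clear -rb; nia.
- by move=> p /phi_good/andP[_ rb].
- move=> n nL; have [rn|nr] := ltnP r n; last first.
    rewrite target0 // big1 // => p /eqP bn; rewrite /phi ifF ?mul0r ?mulr0 //.
    by rewrite /good bn (ltnNge r n) nr andbF.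
  have rnL : (r < n <= L)%N by rewrite rn.
  have mn := mass_gt0 _ rnL; have n0 : 0 < n%:R :> R by rewrite ltr0n; clear -rn; lia.
  transitivity (\sum_(p < B | prime p && (b p == n)) target n / mass n * p%:R^-1).
    rewrite [LHS]big_mkcond [RHS]big_mkcond; apply: eq_bigr => p _.
    have [bn|] := eqVneq (b p) n; last by rewrite andbF.
    rewrite /phi /good bn rnL !andbT; case: ifP => _; last by rewrite mul0r mulr0.
    by rewrite mulrA; congr (_ / _); field; rewrite !gt_eqF.
  by rewrite -mulr_sumr divfK // gt_eqF.
- have y2 : 2 <= expR h by apply: le_trans (expR_ge1Dx h); lra.
  have := @sum_inv_sqr_le R B (expR h) (fun p => phi p != 0) y2.
  rewrite expRN; apply=> p /phi_good/andP[p_pr /andP[rb _]].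
  have p0 : 0 < p%:R :> R by rewrite ltr0n prime_gt0.
  rewrite -[leRHS]lnK ?posrE // ler_expR; have /andP[+ _] := bP p; apply: le_trans.
  by rewrite ler_peMl ?(ltW h0) // ler1n; clear -rb; lia.
Qed.

(** 3^L comes from [renewal_perturbation]. With l = L + 2, the quadratic sum gives 8 l e^(-h), the
    coefficient mass l^2, and summation over the bins another l^2; the ninth unit covers the term
    e^(-h) l^2. *)
Definition error_const {R : realType} (L : nat) : R := 9 * L.+2%:R ^+ 5 * 3 ^+ L.

(** The largest step is [m * r]. Past it the partial sums of the renewal defect vanish, so only the
    perturbation and the few bins near log x remain. At [x] close to exp(b0 h), the weights [b0 - n]
    extract the mean step instead. *)
Lemma mean_fun_construction (R : realType) (r m M : nat) (h kappa : R) :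
  let L := (M * r.+1)%N in let b0 := (m * r + M + 3)%N in
  (0 < r)%N -> (1 < m)%N -> 9 < h -> (b0 <= L)%N ->
  (1 + m%:R / (m`!%:R - 1)) * (r.+2%:R / r.+1%:R) * (h / (h - 9)) <= kappa -> kappa <= 2 ->
  1 + m%:R / (m`!%:R - 1) <= 2 :> R ->
  exists (B : nat) (phi : nat -> R),
  [/\ forall p, phi p != 0 -> prime p,
      forall p, 0 <= phi p <= kappa,
      \sum_(p < B | phi p != 0) (p%:R ^+ 2)^-1 <= 2 * expR (- h),
      forall x, (0 < x)%N -> b0.-1%:R * h <= ln x%:R < L.+1%:R * h ->
        `|\sum_(1 <= n < x.+1) mean_fun B phi n| <=
        x%:R * (expR (- h) * error_const L + 2 * M.+1%:R ^+ 2 / r.+2%:R) &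
      forall x, (0 < x)%N -> b0%:R * h - 1 <= ln x%:R <= b0%:R * h ->
        h * (expR (\sum_(i < r) i.+1%:R^-1) - r%:R * (2 / (m.-1)`!%:R)
             - expR (- h) * error_const L)
        - (M%:R * h + 2) * (b0.+1%:R * b0.+2%:R / (r.+1%:R * r.+2%:R)) <=
        \sum_(1 <= n < x.+1) n%:R^-1 * mean_fun B phi n].
Proof.
move=> L b0 r0 m1 h9 b0L kappaP kappa2 Theta2.
have h0 : 0 < h by lra.
have [w [phiM [PM phiM_le EX]]] := @dickman_renewal R r m r0 m1.
set Theta := 1 + _ in kappaP Theta2 phiM_le.
have phiM2 n : phiM n <= 2 by apply: le_trans (phiM_le n) Theta2.
have [||B [phi [b [phi_prime phik phi_bin phi_target phiW]]]] :=
  @prime_weights_exist R r L h Theta kappa phiM h9 _ _ kappaP.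
- by move=> n; rewrite (renewal_ge0 PM) phiM_le.
- exact: renewal_init PM.
have phi0 p : 0 <= phi p by have /andP[] := phik p.
have phi_bin' p : phi p != 0 ->
    (b p)%:R * h <= ln p%:R < (b p).+1%:R * h /\ (r < b p)%N.
  by move=> /phi_bin[? /andP[]].
pose a (p : 'I_B) := phi p / p%:R.
pose bb (p : 'I_B) := b p.
have a0 p : 0 <= a p by rewrite divr_ge0.
have a_bin p : a p != 0 -> (r < bb p)%N.
  by rewrite mulf_eq0 negb_or => /andP[/phi_bin'[]].
have a_phi n : (n <= L)%N -> \sum_(p | bb p == n) (bb p)%:R * a p = phiM n.
  exact: phi_target.
have [Csum Cterm] := coefC_bound PM phiM2 a0 a_bin a_phi.
have Gapp := coefG_approx PM phiM2 a0 a_bin a_phi.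
have C0 := coefC_ge0 (b := bb) a0.
have rL : (r < L)%N by move: b0L; rewrite /b0; nia.
have LM : (L < M.+1 * r.+1)%N by rewrite /L; nia.
pose C n := (\prod_p (1 + a p *: 'X^(bb p)))`_n.
pose G n := (\prod_p (1 + (- a p) *: 'X^(bb p)))`_n.
pose l : R := L.+2%:R; pose t : R := 3 ^+ L; pose eh := expR (- h).
have eh0 : 0 < eh by exact: expR_gt0.
have l2 : 2 <= l by rewrite /l ler_nat.
have t1 : 1 <= t by rewrite /t exprn_ege1 // ler1n.
pose S n := \sum_(0 <= i < n.+1) C i.
have S_le n : (r <= n <= L)%N -> S n <= n.+1%:R * n.+2%:R / (r.+1%:R * r.+2%:R).
  by move=> rnL; apply: Csum.
have SL : S L <= l ^+ 2.
  apply: le_trans (S_le _ _) _; first by rewrite (ltnW rL) leqnn.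
  rewrite ler_pdivrMr ?mulr_gt0 // -[leLHS]mulr1; apply: ler_pM => //.
    by rewrite expr2 ler_pM // ler_nat.
  by rewrite -natrM ler1n.
have S_mono n : (n <= L)%N -> S n <= S L.
  move=> nL; rewrite /S [leRHS](@big_cat_nat _ _ _ n.+1) //= lerDl.
  by apply: sumr_ge0 => i _; apply: C0.
have S_ge0 n : 0 <= S n by apply: sumr_ge0 => i _; apply: C0.
have Q_le : \sum_p (bb p)%:R * a p ^+ 2 <= 8 * l * eh.
  apply: (@le_trans _ _ (\sum_(p < B | phi p != 0) l * 4 * (p%:R ^+ 2)^-1)).
    rewrite [leRHS]big_mkcond; apply: ler_sum => p _.
    case: ifP => [php|/negbFE/eqP php]; last by rewrite /a php mul0r expr0n mulr0.
    rewrite /a expr_div_n mulrA ler_wpM2r ?invr_ge0 ?exprn_ge0 //.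
    have [_ /andP[_ bL]] := phi_bin _ php.
    apply: ler_pM => //; first by rewrite exprn_ge0.
      by rewrite ler_nat; apply: leq_trans bL _; rewrite -addn2 leq_addr.
    have /andP[_ pk] := phik p; have := phi0 p; nra.
  rewrite -mulr_sumr; have -> : 8 * l * eh = l * 4 * (2 * eh) by ring.
  rewrite ler_wpM2l //; lra.
pose delta := 8 * t * l ^+ 3 * eh.
have E_le n : (n <= L)%N -> `|G n - renewal_defect w n| <= delta.
  move=> nL; apply: le_trans (Gapp _ nL) _.
  have -> : delta = t * (8 * l * eh * l ^+ 2) by rewrite /delta; ring.
  apply: ler_pM; rewrite ?exprn_ge0 //.
  - by rewrite mulr_ge0 ?S_ge0 // sumr_ge0 // => p _; rewrite mulr_ge0 // exprn_ge0.
  - by rewrite /t ler_eXn2l // ltr1n.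
  - apply: ler_pM => //; first by rewrite sumr_ge0 // => p _; rewrite mulr_ge0 // exprn_ge0.
    exact: S_ge0.
have delta_le : l ^+ 2 * delta + eh * l ^+ 2 <= eh * error_const L.
  rewrite /error_const -/l -/t /delta.
  have -> : l ^+ 2 * (8 * t * l ^+ 3 * eh) + eh * l ^+ 2 = eh * (8 * l ^+ 5 * t + l ^+ 2) by ring.
  have -> : 9 * l ^+ 5 * t = 8 * l ^+ 5 * t + l ^+ 5 * t by ring.
  rewrite ler_pM2l // lerD2l.
  apply: (@le_trans _ _ (l ^+ 5)); first by rewrite ler_weXn2l //; lra.
  by rewrite ler_peMr // exprn_ge0 //; lra.
have delta0 : 0 <= delta by rewrite !mulr_ge0 ?exprn_ge0 //; lra.
have Elem : l ^+ 2 * delta <= eh * error_const L.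
  by apply: le_trans delta_le; rewrite lerDl mulr_ge0 ?exprn_ge0 //; lra.
exists B, phi; split => //.
- move=> x x0 /andP[hx1 hx2].
  have x0' : 0 < x%:R :> R by rewrite ltr0n.
  have lnx0 : 0 <= ln x%:R / h by rewrite divr_ge0 ?ln_nat_ge0 // ltW.
  have /andP[v1 v2] := truncn_itv lnx0.
  set v0 := Num.truncn _ in v1 v2.
  rewrite ler_pdivlMr // in v1; rewrite ltr_pdivrMr // in v2.
  have v0L : (v0 <= L)%N by rewrite -ltnS -(ltr_nat R) -(ltr_pM2r h0) (le_lt_trans v1).
  have bv : (b0.-1 <= v0)%N by rewrite -ltnS -(ltr_nat R) -(ltr_pM2r h0) (le_lt_trans hx1).
  (* The [M + 3] in [b0] leaves room for this shift: [n0] still reaches [m * r]. The [M.+1] bins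
     above it have mass at most [2 * M.+1 / r.+2] each. *)
  pose n0 := (v0 - M.+1)%N.
  have [n0v n0D nM] : [/\ (n0 + M < v0)%N, (m * r <= n0)%N & (v0.+1 - n0.+1 = M.+1)%N].
    by move: bv; rewrite /n0 /b0; clear; split; lia.
  have n0L : (n0 <= L)%N by clear -n0v v0L; lia.
  have vv : v0%:R * h <= ln x%:R < v0.+1%:R * h by rewrite v1.
  apply: le_trans (mean_fun_sum_approx (B := B) phi_prime phi0 h0 phi_bin' x0 v0L LM n0v vv) _.
  rewrite ler_pM2l //.
  apply: (@le_trans _ _ (l ^+ 2 * delta + eh * l ^+ 2 + 2 * M.+1%:R ^+ 2 / r.+2%:R)).
    apply: lerD; first apply: lerD.
    + have -> : \sum_(0 <= n < n0.+1) (\prod_(p < B) (1 + - (phi p / p%:R) *: 'X^(b p)))`_n =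
         \sum_(0 <= n < n0.+1) (G n - renewal_defect w n).
        by rewrite sumrB (renewal_defect_sum PM) ?subr0.
      apply: le_trans (ler_norm_sum _ _ _) _.
      apply: (@le_trans _ _ (\sum_(0 <= n < n0.+1) delta)).
        rewrite !big_nat; apply: ler_sum => n /andP[_ nn]; apply: E_le.
        by apply: leq_trans n0L; rewrite -ltnS.
      rewrite sumr_const_nat subn0 -[leLHS]mulr_natl ler_wpM2r //.
      apply: (@le_trans _ _ l); first by rewrite ler_nat !ltnS ltnW.
      by rewrite expr2 ler_peMr //; clear -l2; lra.
    + rewrite ler_pM2l //; apply: le_trans SL; exact: S_mono.
    + apply: (@le_trans _ _ (\sum_(n0.+1 <= n < v0.+1) 2 * M.+1%:R / r.+2%:R)).
        rewrite !big_nat; apply: ler_sum => n /andP[n1 n2].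
        have nL : (0 < n <= L)%N by clear -n1 n2 v0L; lia.
        apply: le_trans (Cterm _ nL) _.
        rewrite ler_pdivrMr ?mulr_gt0 //.
        have -> : 2 * M.+1%:R / r.+2%:R * (r.+1%:R * r.+2%:R) = 2 * (M.+1 * r.+1)%:R :> R.
          rewrite natrM; have : r.+2%:R != 0 :> R by [].
          by move: r.+2%:R r.+1%:R M.+1%:R => u v z u0; field.
        rewrite ler_pM2l // ler_nat; clear -nL LM; lia.
      rewrite sumr_const_nat nM.
      by rewrite -[leLHS]mulr_natl le_eqVlt; apply/orP; left; apply/eqP; ring.
  by rewrite lerD2r.
- move=> x x0 hx.
  have H := mean_fun_log_sum_approx (B := B) phi_prime phi0 h0 phi_bin' x0 b0L LM hx.
  set F := \sum_(_ <= _ < _) _ * mean_fun _ _ _ in H *.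
  set GG := \sum_(_ <= _ < _) _ * (b0 - _)%:R in H.
  have Sb : S b0 <= b0.+1%:R * b0.+2%:R / (r.+1%:R * r.+2%:R).
    by apply: S_le; rewrite b0L andbT /b0; clear -m1; nia.
  have GG_ge : \sum_(0 <= n < (m * r).+1) n%:R * w n - eh * error_const L <= GG.
    rewrite -(renewal_defect_moment (n := b0) PM); last by rewrite /b0 -addnA leq_addr.
    rewrite lerBlDr -lerBlDl; apply: le_trans Elem; apply: le_trans (ler_norm _) _.
    rewrite /GG -sumrB; apply: le_trans (ler_norm_sum _ _ _) _.
    apply: (@le_trans _ _ (\sum_(0 <= n < b0.+1) delta * l)).
      rewrite !big_nat; apply: ler_sum => n /andP[_ nn]; rewrite -mulrBl normrM.
      apply: ler_pM => //; first by rewrite distrC; apply: E_le; clear -nn b0L; lia.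
      by rewrite normr_nat ler_nat; clear -nn b0L; lia.
    rewrite sumr_const_nat subn0 -[leLHS]mulr_natl [delta * l]mulrC mulrA ler_wpM2r //.
    rewrite expr2 ler_wpM2r // ler_nat; clear -b0L; lia.
  have Mh0 : 0 <= M%:R * h + 2 by rewrite addr_ge0 // mulr_ge0 // ltW.
  have {}H : h * GG - (M%:R * h + 2) * (b0.+1%:R * b0.+2%:R / (r.+1%:R * r.+2%:R)) <= F.
    rewrite lerBlDr -lerBlDl; apply: (le_trans (ler_norm _)); rewrite distrC.
    by apply: le_trans H _; rewrite ler_wpM2l.
  apply: le_trans H; rewrite lerD2r ler_pM2l //; apply: le_trans GG_ge.
  by rewrite lerD2r.
Qed.

(** * Euler's constant *)

Lemma harmonic_sumE (R : realType) n :
  harmonic_sum n = \sum_(i < n) i.+1%:R^-1 :> R.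
Proof. by rewrite /harmonic_sum big_add1 /= big_mkord. Qed.

Lemma euler_mascheroni_le (R : realType) (n : nat) : (0 < n)%N ->
  euler_mascheroni R <= \sum_(i < n) i.+1%:R^-1 - ln n%:R.
Proof.
move=> n0; pose u n : R := harmonic_sum n - ln n%:R.
(* The shift matters: [ln 0 = 0] makes [u 0 = 0], below [u 1 = 1]. *)
have u_noninc : nonincreasing_seq (fun n => u n.+1).
  apply/nonincreasing_seqP => q; rewrite /u /harmonic_sum [X in X - _ <= _]big_nat_recr //=.
  have := @inv_le_ln_succ R q.+1 isT; move: (\sum_(_ <= _ < _) _) => s; move: (_^-1) => i ?; lra.
have u_lb : has_lbound (range (fun n => u n.+1)).
  exists 0 => _ [q _ <-]; rewrite /u subr_ge0.
  apply: le_trans (harmonic_sum_ge_ln R q.+1).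
  by rewrite ler_ln ?posrE ?ltr0n // ler_nat.
have -> : euler_mascheroni R = limn (fun n => u n.+1).
  apply/esym/cvg_lim => //.
  have := nonincreasing_is_cvgn u_noninc u_lb => /cvg_ex[l ul].
  have ul' : u @ \oo --> l by rewrite -cvg_shiftS.
  suff -> : euler_mascheroni R = l by [].
  apply/cvg_lim => //; apply: cvg_trans ul'; apply: near_eq_cvg.
  near=> j; rewrite /u harmonic_sumE /series /= big_mkord //.
rewrite -harmonic_sumE; case: n n0 => // n _.
exact: nonincreasing_cvgn_ge u_noninc (nonincreasing_is_cvgn u_noninc u_lb) n.
Unshelve. all: by end_near. Qed.

Lemma expR_euler_le (R : realType) (n : nat) : (0 < n)%N ->
  n%:R * expR (euler_mascheroni R) <= expR (\sum_(i < n) i.+1%:R^-1).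
Proof.
move=> n0; have n0' : 0 < n%:R :> R by rewrite ltr0n.
rewrite -{1}[n%:R]lnK ?posrE // -expRD ler_expR -lerBrDl.
exact: euler_mascheroni_le.
Qed.

(** * Choice of the parameters *)

(* If D n > eta n then D >= eta n / 2 on an interval of eta n / 4 integers
   ending at n, whose contribution to the weighted sum is at least eta^3 / 16. *)
Lemma linear_bound_of_weighted_sum (R : realType) (D : nat -> R) (Y n : nat) (eta V : R) :
  0 < eta <= 1 -> (forall x, 0 <= D x) -> (forall x, D x.+1 <= D x + 2) ->
  \sum_(1 <= x < Y.+1) D x ^+ 2 / x%:R ^+ 3 <= V -> V < eta ^+ 3 / 16 ->
  (0 < n <= Y)%N -> D n <= eta * n%:R.
Proof.
move=> /andP[eta0 eta1] D0 DS DV VE /andP[n0 nY]; rewrite leNgt; apply/negP => Dn.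
have n0' : 0 < n%:R :> R by rewrite ltr0n.
have en0 : 0 <= eta * n%:R / 4 by rewrite divr_ge0 // mulr_ge0 // ltW.
have /andP[s1 s2] := truncn_itv en0; set s := Num.truncn _ in s1 s2.
have sn : (s < n)%N by rewrite -(ltr_nat R); apply: le_lt_trans s1 _; nra.
have Dstep i : (i <= n)%N -> D n <= D (n - i)%N + 2 * i%:R.
  elim: i => [|i IHi] ni; first by rewrite subn0 mulr0 addr0.
  apply: le_trans (IHi (ltnW ni)) _; have := DS (n - i.+1)%N.
  have -> : (n - i.+1).+1 = (n - i)%N by clear -ni; lia.
  rewrite -[i.+1%:R]natr1; move: (D _) (D _) => x y ?; lra.
have Dge x : (n - s <= x < n.+1)%N -> eta ^+ 2 / (4 * n%:R) <= D x ^+ 2 / x%:R ^+ 3.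
  move=> /andP[x1 x2]; have x0 : 0 < x%:R :> R by rewrite ltr0n; clear -x1 sn; lia.
  have Dx : eta * n%:R / 2 <= D x.
    have := Dstep (n - x)%N; rewrite subKn // => /(_ (leq_subr _ _)) h.
    have h2 : (n - x)%:R <= eta * n%:R / 4 by apply: le_trans s1; rewrite ler_nat; clear -x1 sn; lia.
    lra.
  have en2 : 0 <= eta * n%:R / 2 by lra.
  apply: (@le_trans _ _ ((eta * n%:R / 2) ^+ 2 / n%:R ^+ 3)).
    by rewrite le_eqVlt; apply/orP; left; apply/eqP; field; rewrite gt_eqF.
  apply: ler_pM; rewrite ?exprn_ge0 ?invr_ge0 ?exprn_ge0 //.
    by rewrite lerXn2r // nnegrE // (le_trans en2).
  rewrite lef_pV2 ?posrE ?exprn_gt0 // lerXn2r // ?nnegrE // ler_nat //.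
suff : eta ^+ 3 / 16 <= V by rewrite leNgt VE.
apply: le_trans DV; rewrite (@big_cat_nat _ _ _ (n - s)) /=; [|clear -n0 sn; lia|clear -nY; lia].
apply: ler_wpDl; first by apply: sumr_ge0 => x _; rewrite divr_ge0 ?exprn_ge0.
rewrite (@big_cat_nat _ _ _ n.+1) /=; [|clear; lia|clear -nY; lia].
apply: ler_wpDr; first by apply: sumr_ge0 => x _; rewrite divr_ge0 ?exprn_ge0.
apply: (@le_trans _ _ (\sum_(n - s <= x < n.+1) eta ^+ 2 / (4 * n%:R))); last first.
  by rewrite !big_nat; apply: ler_sum => x; apply: Dge.
rewrite sumr_const_nat -[leRHS]mulr_natl; have -> : (n.+1 - (n - s) = s.+1)%N by clear -sn; lia.
have -> : eta ^+ 3 / 16 = (eta * n%:R / 4) * (eta ^+ 2 / (4 * n%:R)).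
  by field; rewrite gt_eqF.
by rewrite ler_wpM2r ?divr_ge0 ?exprn_ge0 ?mulr_ge0 ?ltW.
Qed.

Lemma normcD_le (R : realType) (x y : R[i]) :
  Normc.normc (x + y) <= Normc.normc x + Normc.normc y.
Proof. by rewrite -lecR rmorphD -!normc_norm ler_normD. Qed.

Lemma normc_real (R : realType) (x : R) : Normc.normc x%:C%C = `|x|.
Proof. by rewrite /Normc.normc /= expr0n addr0 sqrtr_sqr. Qed.

Lemma normc_ge0 (R : realType) (x : R[i]) : 0 <= Normc.normc x.
Proof. by rewrite -lecR -normc_norm rmorph0 normr_ge0. Qed.

Lemma truncn_expR (R : realType) (X u : R) : 1 <= u -> X = expR u ->
  (0 < Num.truncn X)%N /\ u - 1 <= ln (Num.truncn X)%:R <= u.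
Proof.
move=> u1 XE; have X0 : 0 <= X by rewrite XE expR_ge0.
have e2 : 2 <= expR 1 :> R by apply: le_trans (expR_ge1Dx 1); lra.
have eu : expR u = expR 1 * expR (u - 1) by rewrite -expRD addrC subrK.
have eu1 : 1 <= expR (u - 1) by rewrite -[leLHS]expR0 ler_expR; lra.
have /andP[h1 h2] := truncn_itv X0; set n := Num.truncn X in h1 h2 *.
have h3 : expR (u - 1) <= n%:R.
  have h : 2 * expR (u - 1) <= X by rewrite XE eu ler_wpM2r ?expR_ge0.
  move: h2 h eu1; rewrite -natr1; move: (expR (u - 1)) => v h2 h eu1; lra.
have n0 : 0 < n%:R :> R by apply: lt_le_trans h3; exact: expR_gt0.
split; first by rewrite -(ltr_nat R).
rewrite -[u - 1]expRK -[X in _ <= _ <= X]expRK !ler_ln ?posrE ?expR_gt0 //.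
by rewrite h3 -XE.
Qed.

(** Half of [eps] is spent on the mean values of F and half on the random fluctuation. [A * b0 <= L]
    keeps [X, X^A] within the range of the bins. In [V], 24 e^(-h) is 12 times the sum of 1/p^2, and
    1 + A b0 h bounds the harmonic sum up to X^A. *)
Lemma good_function_at_scale (R : realType) (k r m M : nat) (A eps delta h : R) :
  let L := (M * r.+1)%N in let b0 := (m * r + M + 3)%N in
  let V := 24 * expR (- h) * (k%:R * (1 + A * (b0%:R * h)) + 1) in
  (1 < k)%N -> (0 < r)%N -> (1 < m)%N -> 9 < h -> 1 <= A -> A * b0%:R <= L%:R ->
  (1 + m%:R / (m`!%:R - 1)) * (r.+2%:R / r.+1%:R) * (h / (h - 9)) <= k%:R / (k%:R - 1) ->
  1 + m%:R / (m`!%:R - 1) <= 2 :> R ->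
  0 < eps <= 1 -> 0 < delta ->
  expR (- h) * error_const L + 2 * M.+1%:R ^+ 2 / r.+2%:R <= eps / 2 ->
  V < (eps / 2) ^+ 3 / 16 -> V <= (delta / 2) ^+ 2 ->
  exists f : nat -> R[i],
  [/\ calF R k f, satisfies_C k eps (expR (b0%:R * h)) A f &
    h * (expR (\sum_(i < r) i.+1%:R^-1) - r%:R * (2 / (m.-1)`!%:R)
             - expR (- h) * error_const L)
        - (M%:R * h + 2) * (b0.+1%:R * b0.+2%:R / (r.+1%:R * r.+2%:R))
        - delta * (b0%:R * h) <=
    Normc.normc (psum (fun n => f n / n%:R) (expR (b0%:R * h)))].
Proof.
move=> L b0 V k1 r0 m1 h9 A1 AL kP Theta2 /andP[eps0 eps1] delta0 hypC hypV1 hypV2.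
have h0 : 0 < h by lra.
have k1' : 0 < k%:R - 1 :> R by rewrite subr_gt0 ltr1n.
have k2 : 2 <= k%:R :> R by rewrite ler_nat.
have kappa2 : k%:R / (k%:R - 1) <= 2 :> R by rewrite ler_pdivrMr //; clear -k2; lra.
have b0_3 : 3 <= b0%:R :> R by rewrite ler_nat /b0 leq_addl.
have b0L : (b0 <= L)%N.
  by rewrite -(ler_nat R); apply: le_trans AL; rewrite ler_peMl.
have [B [phi [phi_prime phik phiW Fsmall Flog]]] :=
  @mean_fun_construction R r m M h (k%:R / (k%:R - 1)) r0 m1 h9 b0L kP kappa2 Theta2.
have phi2 p : 0 <= phi p <= 2.
  by have /andP[-> pk] := phik p; apply: le_trans kappa2.
have phikk p : phi p * (k%:R - 1) <= k%:R.
  by have /andP[_ pk] := phik p; rewrite -ler_pdivlMr.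
pose u := b0%:R * h; pose X := expR u.
have u27 : 27 <= u by rewrite /u; clear -b0_3 h9; nra.
have X0 : 0 < X := expR_gt0 u.
have XA : X `^ A = expR (A * u) by rewrite /powR gt_eqF // expRK.
have Au : u <= A * u by rewrite ler_peMl //; clear -u27; lra.
have u1 : 1 <= u by clear -u27; lra.
have [nX0 /andP[nX1 nX2]] := @truncn_expR R X u u1 erefl.
have [Y0 /andP[Y1 Y2]] := @truncn_expR R (X `^ A) (A * u) (le_trans u1 Au) XA.
set nX := Num.truncn X in nX0 nX1 nX2; set Y := Num.truncn (X `^ A) in Y0 Y1 Y2.
have [f [f_calF f1 fC fL]] := @exists_near_mean_fun R k B Y nX phi k1 nX0 phi2 phikk phi_prime.
have HY : harmonic_sum Y <= 1 + A * u.
  by apply: le_trans (harmonic_sum_le_ln R Y0) _; rewrite lerD2l.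
have HX : harmonic_sum nX <= 2 * u.
  apply: le_trans (harmonic_sum_le_ln R nX0) _; clear -nX2 u27; lra.
set V' := 12 * _ * _ in fC fL.
have VV : V' <= V.
  have -> : V = 12 * (2 * expR (- h)) * (k%:R * (1 + A * u) + 1) by rewrite /V /u; ring.
  apply: ler_pM.
  - by rewrite mulr_ge0 // sumr_ge0 // => p _; rewrite invr_ge0 exprn_ge0.
  - by rewrite addr_ge0 // mulr_ge0 // harmonic_sum_ge0.
  - by rewrite ler_pM2l.
  - by rewrite lerD2r ler_wpM2l.
have F1 n : `|mean_fun B phi n| <= 1 by apply: norm_mean_fun.
exists f; split => //.
- move=> j jk x /andP[Xx xX].
  have x0 : 0 < x by apply: lt_le_trans Xx.
  have /andP[n1 n2] := truncn_itv (ltW x0); set n := Num.truncn x in n1 n2.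
  have nY : (n <= Y)%N by apply: (@le_truncn R).
  have nXn : (nX <= n)%N by apply: (@le_truncn R).
  have n0 : (0 < n)%N by apply: leq_trans nXn.
  have n0' : 0 < n%:R :> R by rewrite ltr0n.
  have lnn : b0.-1%:R * h <= ln n%:R < L.+1%:R * h.
    apply/andP; split.
      apply: (@le_trans _ _ (u - 1)).
        have -> : b0.-1%:R = b0%:R - 1 :> R by rewrite -subn1 natrB // /b0 addn3.
        rewrite /u; clear -h9; lra.
      by apply: le_trans nX1 _; rewrite ler_ln ?posrE ?ltr0n // ler_nat.
    apply: (@le_lt_trans _ _ (A * u)).
      by apply: le_trans Y2; rewrite ler_ln ?posrE ?ltr0n // ler_nat.
    apply: (@le_lt_trans _ _ (L%:R * h)); last by rewrite ltr_pM2r // ltr_nat.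
    by rewrite /u mulrA ler_pM2r.
  pose Delta y := \sum_(1 <= i < y.+1) (f i ^+ j - (mean_fun B phi i)%:C%C).
  have DeltaS y : Normc.normc (Delta y.+1) <= Normc.normc (Delta y) + 2.
    rewrite /Delta big_nat_recr //=; apply: le_trans (normcD_le _ _) _; rewrite lerD2l.
    apply: le_trans (normcD_le _ _) _; rewrite -rmorphN normc_real normrN.
    apply: lerD; last exact: F1.
    rewrite -lecR -normc_norm normrX normc_norm f1 rmorph1 expr1n //.
  have e2 : 0 < eps / 2 <= 1 by apply/andP; clear -eps0 eps1; split; lra.
  have DeltaV : \sum_(1 <= y < Y.+1) Normc.normc (Delta y) ^+ 2 / y%:R ^+ 3 <= V.
    by apply: le_trans VV; apply: fC.
  have nY' : (0 < n <= Y)%N by rewrite n0.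
  have H := linear_bound_of_weighted_sum e2 (fun y => normc_ge0 (Delta y)) DeltaS DeltaV hypV1 nY'.
  have -> : psum (fun n => f n ^+ j) x = Delta n + (\sum_(1 <= i < n.+1) mean_fun B phi i)%:C%C.
    by rewrite /psum /Delta rmorph_sum -big_split /=; apply: eq_bigr => i _; rewrite subrK.
  apply: le_trans (normcD_le _ _) _; rewrite normc_real.
  apply: (@le_trans _ _ (eps / 2 * n%:R + n%:R * (eps / 2))).
    apply: lerD => //; apply: le_trans (Fsmall _ n0 lnn) _.
    by rewrite ler_pM2l.
  rewrite [n%:R * _]mulrC -mulrDl -splitr ler_pM2l //.
- rewrite -/u -/X.
  pose Delta := \sum_(1 <= n < nX.+1) (n%:R^-1)%:C%C * (f n - (mean_fun B phi n)%:C%C).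
  have DeltaN : Normc.normc Delta <= delta * u.
    have du : 0 <= delta * u by rewrite mulr_ge0 ?(ltW delta0) //; clear -u27; lra.
    rewrite -(ler_pXn2r (n := 2)) ?nnegrE ?normc_ge0 //.
    apply: le_trans fL _; have -> : (delta * u) ^+ 2 = (delta / 2) ^+ 2 * (2 * u) ^+ 2 by field.
    apply: ler_pM; rewrite ?exprn_ge0 ?harmonic_sum_ge0 //.
    - rewrite /V' mulr_ge0 //; first by rewrite mulr_ge0 // sumr_ge0 // => p _; rewrite invr_ge0 exprn_ge0.
      by rewrite addr_ge0 // mulr_ge0 // harmonic_sum_ge0.
    - exact: le_trans VV hypV2.
    - rewrite lerXn2r ?nnegrE ?harmonic_sum_ge0 //; clear -u27; lra.
  set Fs := \sum_(1 <= n < nX.+1) n%:R^-1 * mean_fun B phi n.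
  have -> : psum (fun n => f n / n%:R) X = Delta + Fs%:C%C.
    rewrite /psum /Delta /Fs rmorph_sum -big_split /=; apply: eq_bigr => n _.
    rewrite (rmorphM (real_complex R) n%:R^-1 (mean_fun B phi n)).
    by rewrite -mulrDr subrK mulrC fmorphV rmorph_nat.
  have lnX : b0%:R * h - 1 <= ln nX%:R <= b0%:R * h by rewrite nX1.
  apply: (@le_trans _ _ (Fs - delta * u)).
    by rewrite lerD2r; apply: Flog.
  rewrite lerBlDr; apply: (@le_trans _ _ `|Fs|); first exact: ler_norm.
  rewrite -normc_real.
  have {1}-> : Fs%:C%C = (Delta + Fs%:C%C) - Delta by rewrite addrAC subrr add0r.
  apply: le_trans (normcD_le _ _) _; apply: lerD => //.
  suff -> : Normc.normc (- Delta) = Normc.normc Delta by [].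
  by apply: complexI; rewrite -!normc_norm normrN.
Qed.

Lemma expRN_mul_le (R : realType) (h : R) : 0 < h -> h * expR (- h) <= 4 / h.
Proof.
move=> h0; rewrite expRN ler_pdivlMr // mulrAC ler_pdivrMr ?expR_gt0 //.
have -> : expR h = expR (h / 2) * expR (h / 2) by rewrite -expRD -splitr.
have h2 : h / 2 <= expR (h / 2).
  by apply: le_trans (expR_ge1Dx _); rewrite lerDr.
have : (h / 2) * (h / 2) <= expR (h / 2) * expR (h / 2).
  by apply: ler_pM => //; rewrite divr_ge0 // ltW.
move: (_ * expR _) => v ?; lra.
Qed.

Lemma large_scale (R : realType) (tau K K2 x y z : R) :
  0 < tau <= 1 -> 0 <= K -> 0 <= K2 -> 0 < x -> 0 < y -> 0 < z ->
  exists h0 : R, forall h, h0 <= h ->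
  [/\ 9 < h, h / (h - 9) <= 1 + tau, expR (- h) * K <= x,
      h * expR (- h) * K2 < y & h * expR (- h) * K2 <= z].
Proof.
move=> /andP[tau0 tau1] K0 K20 x0 y0 z0.
(* One summand per requirement; the last three use h e^(-h) <= 4/h. *)
exists (10 + 18 / tau + (4 * K / x + (4 * K2 + 1) / y + 4 * K2 / z)) => h hh.
have p1 : 0 < 18 / tau by rewrite divr_gt0.
have p2 : 0 <= 4 * K / x by rewrite divr_ge0 ?mulr_ge0 // ltW.
have p3 : 0 <= (4 * K2 + 1) / y by rewrite divr_ge0 ?addr_ge0 ?mulr_ge0 // ltW.
have p4 : 0 <= 4 * K2 / z by rewrite divr_ge0 ?mulr_ge0 // ltW.
have h10 : 10 <= h by lra.
have h0 : 0 < h by lra.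
have hE := expRN_mul_le h0.
have e0 := expR_gt0 (- h).
have bound c w : 0 <= c -> 0 < w -> 4 * c / w <= h -> h * expR (- h) * c <= w.
  move=> c0 w0; rewrite ler_pdivrMr // => H; apply: (@le_trans _ _ (4 / h * c)).
    by rewrite ler_wpM2r.
  by rewrite mulrAC ler_pdivrMr // mulrC [w * h]mulrC mulrC.
split.
- lra.
- rewrite ler_pdivrMr; last by lra.
  have : 18 <= h * tau by rewrite -ler_pdivrMr //; lra.
  by move=> ?; lra.
- apply: (@le_trans _ _ (h * expR (- h) * K)).
    rewrite ler_wpM2r // ler_peMl ?(ltW e0) //; lra.
  apply: bound => //; lra.
- have yq : 4 * (K2 + 1 / 4) / y <= h.
    have -> : 4 * (K2 + 1 / 4) = 4 * K2 + 1 by field.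
    lra.
  apply: lt_le_trans (bound (K2 + 1 / 4) y _ y0 yq); last by lra.
  rewrite ltr_pM2l ?mulr_gt0 //; lra.
- apply: bound => //; lra.
Qed.

(** Up to bounded terms the logarithmic sum is h r (e^gamma - 2/(m-1)!), while log X = b0 h with b0
    close to m r; the quotient is [g]. *)
Lemma good_functions_exist (R : realType) (k m : nat) (A eps c : R) :
  (1 < k)%N -> (1 < m)%N -> (m * k.-1 < (m`!).-1)%N -> 1 <= A -> 0 < eps <= 1 ->
  c < (expR (euler_mascheroni R) - 2 / (m.-1)`!%:R) / m%:R ->
  exists X0 : R, forall X, X0 <= X -> exists f : nat -> R[i],
  [/\ calF R k f, satisfies_C k eps X A f &
      c <= (ln X)^-1 * Normc.normc (psum (fun n => f n / n%:R) X)].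
Proof.
move=> k1 m1 mk A1 /andP[eps0 eps1]; set g := (X in c < X) => cg.
(* One share of the margin g - c pays for the fluctuation, another for the terms that stay bounded
   as r grows. *)
pose delta := (g - c) / 4; have delta0 : 0 < delta by rewrite divr_gt0 // subr_gt0.
pose Theta : R := 1 + m%:R / (m`!%:R - 1).
pose kappa : R := k%:R / (k%:R - 1).
have k1' : 0 < k%:R - 1 :> R by rewrite subr_gt0 ltr1n.
have mf : (0 < m`!)%N by exact: fact_gt0.
have m0 : 0 < m%:R :> R by rewrite ltr0n; lia.
have mfE : m`!%:R - 1 = (m`!).-1%:R :> R by rewrite -subn1 natrB.
have kE : k%:R - 1 = k.-1%:R :> R by rewrite -subn1 natrB //; lia.
have mf1 : 0 < m`!%:R - 1 :> R by rewrite mfE ltr0n; apply: leq_ltn_trans mk.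
have Thetak : Theta < kappa.
  have -> : kappa = 1 + 1 / (k%:R - 1) by rewrite /kappa; field; rewrite gt_eqF.
  rewrite ltrD2l ltr_pdivrMr // mulrC mulrA ltr_pdivlMr // mulr1.
  by rewrite mfE kE -natrM ltr_nat.
have k2 : 2 <= k%:R :> R by rewrite ler_nat.
have kappa2 : kappa <= 2 by rewrite ler_pdivrMr //; clear -k2; lra.
have Theta1 : 1 <= Theta by rewrite lerDl divr_ge0 // ltW.
(* Since Theta <= 2 and tau <= 1, Theta (1 + tau)^2 <= Theta + 6 tau; one factor 1 + tau is for
   (r+2)/(r+1), the other for h/(h-9). *)
pose tau := (kappa - Theta) / 6; have tau0 : 0 < tau by rewrite divr_gt0 // subr_gt0.
have tau1 : 0 < tau <= 1 by rewrite tau0 /tau; lra.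
have tauP : Theta * (1 + tau) * (1 + tau) <= kappa.
  have tau6 : tau <= 1 / 6 by rewrite /tau; lra.
  have -> : kappa = Theta + 6 * tau by rewrite /tau; field.
  have T2 : Theta <= 2 by lra.
  nra.
have [M MP] : exists M : nat, A * (m.+1)%:R <= M%:R.
  by exists (Num.truncn (A * m.+1%:R)).+1; apply/ltW/truncnS_gt.
pose C1 : R := 1 + M.+1%:R * m.+1%:R ^+ 2.
have C10 : 0 <= C1 by rewrite addr_ge0 // mulr_ge0 // exprn_ge0.
have [r [rM rtau reps rC]] : exists r : nat, [/\ (M + 5 <= r)%N, 1 / tau <= r%:R :> R,
   8 * M.+1%:R ^+ 2 / eps <= r%:R & (`|g| * (M + 3)%:R + C1) / delta <= r%:R].
  pose v : R := (M + 5)%:R + 1 / tau + 8 * M.+1%:R ^+ 2 / eps + (`|g| * (M + 3)%:R + C1) / delta.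
  have q1 : 0 <= (M + 5)%:R :> R by [].
  have q2 : 0 < 1 / tau by rewrite divr_gt0.
  have q3 : 0 <= 8 * M.+1%:R ^+ 2 / eps by apply: divr_ge0; [apply: mulr_ge0 => //; apply: exprn_ge0|apply: ltW].
  have q4 : 0 <= (`|g| * (M + 3)%:R + C1) / delta.
    by apply: divr_ge0; [apply: addr_ge0 => //; apply: mulr_ge0|apply: ltW].
  have vr : v <= (Num.truncn v).+1%:R by apply/ltW/truncnS_gt.
  exists (Num.truncn v).+1; split.
  - by rewrite -(ler_nat R); apply: le_trans vr; rewrite /v; lra.
  - by apply: le_trans vr; rewrite /v; lra.
  - by apply: le_trans vr; rewrite /v; lra.
  - by apply: le_trans vr; rewrite /v; lra.
have r0 : (0 < r)%N by clear -rM; lia.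
have r0' : 0 < r%:R :> R by rewrite ltr0n.
pose L := (M * r.+1)%N; pose b0 := (m * r + M + 3)%N.
have b0' : 0 < b0%:R :> R by rewrite ltr0n /b0 addn3.
have K0 : 0 <= error_const L :> R by rewrite /error_const !mulr_ge0 ?exprn_ge0.
pose K2 : R := 24 * (k%:R * (1 + A * b0%:R) + 1).
have K20 : 0 <= K2 by rewrite mulr_ge0 // addr_ge0 // mulr_ge0 // addr_ge0 // mulr_ge0 //; lra.
have x0 : 0 < eps / 4 by rewrite divr_gt0.
have y0 : 0 < (eps / 2) ^+ 3 / 16 by rewrite divr_gt0 // exprn_gt0 // divr_gt0.
have z0 : 0 < (delta / 2) ^+ 2 by rewrite exprn_gt0 // divr_gt0.
have [h0 h0P] := large_scale tau1 K0 K20 x0 y0 z0.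
exists (expR (b0%:R * h0)) => X XX0.
have X0 : 0 < X by apply: lt_le_trans XX0; exact: expR_gt0.
(* All other parameters are fixed by now, so every large X is reached by adjusting [h] alone. *)
pose h := ln X / b0%:R.
have lnX : ln X = b0%:R * h by rewrite /h mulrC divfK ?gt_eqF.
have XE : X = expR (b0%:R * h) by rewrite -lnX lnK.
have hh0 : h0 <= h.
  by rewrite /h ler_pdivlMr // mulrC -ler_expR lnK.
have {h0P hh0}[h9 htau hK hV1 hV2] := h0P _ hh0.
have hpos : 0 < h by clear -h9; lra.
have AL : A * b0%:R <= L%:R.
  apply: (@le_trans _ _ (A * (m.+1 * r)%:R)).
    rewrite ler_wpM2l ?(le_trans ler01) // ler_nat /b0; clear -rM; nia.
  rewrite natrM mulrA /L natrM; apply: ler_pM => //; first by rewrite mulr_ge0 // (le_trans ler01).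
  by rewrite ler_nat.
have kP : Theta * (r.+2%:R / r.+1%:R) * (h / (h - 9)) <= kappa.
  apply: le_trans tauP; apply: ler_pM => //.
  - by rewrite mulr_ge0 ?divr_ge0 // (le_trans ler01).
  - by rewrite divr_ge0 ?(ltW hpos) //; clear -h9; lra.
  rewrite ler_wpM2l ?(le_trans ler01) // ler_pdivrMr ?ltr0n //.
  rewrite -!natr1; move: rtau; rewrite ler_pdivrMr //; clear -tau0.
  move: (r%:R) => u ?; nra.
have Theta2 : Theta <= 2 by clear -Thetak kappa2; lra.
have hypC : expR (- h) * error_const L + 2 * M.+1%:R ^+ 2 / r.+2%:R <= eps / 2.
  have -> : eps / 2 = eps / 4 + eps / 4 by field.
  apply: lerD => //; rewrite ler_pdivrMr ?ltr0n //.
  move: reps; rewrite ler_pdivrMr // -(natr1 r.+1) -(natr1 r); clear -eps0.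
  move: (r%:R) (M.+1%:R ^+ 2) => u v ?; nra.
have VK : 24 * expR (- h) * (k%:R * (1 + A * (b0%:R * h)) + 1) <= h * expR (- h) * K2.
  have -> : h * expR (- h) * K2 = 24 * expR (- h) * (k%:R * (h + A * (b0%:R * h)) + h).
    by rewrite /K2; ring.
  rewrite ler_wpM2l ?mulr_ge0 ?expR_ge0 //.
  have h1 : 1 <= h by clear -h9; lra.
  by rewrite lerD // ler_wpM2l // lerD2r.
have [f [f1 f2 f3]] := good_function_at_scale k1 r0 m1 h9 A1 AL kP Theta2
  (introT andP (conj eps0 eps1)) delta0 hypC (le_lt_trans VK hV1) (le_trans VK hV2).
exists f; rewrite XE; split => //; rewrite expRK mulrC ler_pdivlMr ?(mulr_gt0 b0' hpos) //.
apply: le_trans f3.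
have eH := @expR_euler_le R r r0.
set H := expR (\sum_(_ < _) _) in eH *.
have Sb : b0.+1%:R * b0.+2%:R / (r.+1%:R * r.+2%:R) <= m.+1%:R ^+ 2 :> R.
  rewrite ler_pdivrMr ?mulr_gt0 // -natrX -!natrM ler_nat /b0; clear -rM.
  apply: leq_trans (_ : ((m.+1 * r) * (m.+1 * r) <= _)%N); first by apply: leq_mul; nia.
  by rewrite expnS expn1 mulnACA leq_mul // leq_mul // ltnW.
have Mh : (M%:R * h + 2) * (b0.+1%:R * b0.+2%:R / (r.+1%:R * r.+2%:R)) <= h * (M.+1%:R * m.+1%:R ^+ 2).
  rewrite [leRHS]mulrA; apply: ler_pM => //.
  - by rewrite addr_ge0 // mulr_ge0 // ltW.
  - by rewrite -(natr1 M); clear -h9; move: (M%:R) => u; lra.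
have hK1 : expR (- h) * error_const L <= 1 by clear -hK eps1; lra.
apply: (@le_trans _ _ (h * (r%:R * expR (euler_mascheroni R) - r%:R * (2 / (m.-1)`!%:R) - 1)
    - h * (M.+1%:R * m.+1%:R ^+ 2) - delta * (b0%:R * h))); last first.
  rewrite lerD2r lerB // ler_pM2l //; clear -eH hK1.
  rewrite /L in hK1; lra.
have -> : c * (b0%:R * h) = h * (c * b0%:R) by ring.
have -> : h * (r%:R * expR (euler_mascheroni R) - r%:R * (2 / (m.-1)`!%:R) - 1)
    - h * (M.+1%:R * m.+1%:R ^+ 2) - delta * (b0%:R * h) =
  h * (r%:R * (expR (euler_mascheroni R) - 2 / (m.-1)`!%:R) - C1 - delta * b0%:R).
  by rewrite /C1; ring.
rewrite ler_pM2l //.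
have -> : expR (euler_mascheroni R) - 2 / (m.-1)`!%:R = m%:R * g.
  by rewrite /g [RHS]mulrC divfK // gt_eqF.
have -> : c = g - 4 * delta by rewrite /delta; field.
have -> : b0%:R = m%:R * r%:R + (M + 3)%:R :> R by rewrite /b0 -addnA natrD natrM.
move: rC; rewrite ler_pdivrMr // => rC.
have gle : g * (M + 3)%:R <= `|g| * (M + 3)%:R by rewrite ler_wpM2r // ler_norm.
have m2 : 1 <= m%:R :> R by rewrite ler1n; clear -m1; lia.
have rd : r%:R * delta <= m%:R * (r%:R * delta) by rewrite ler_peMl // mulr_ge0 // ltW.
have md : 0 <= delta * (M + 3)%:R by rewrite mulr_ge0 // ltW.
have mrd : 0 <= m%:R * (r%:R * delta) by apply: mulr_ge0 => //; apply: mulr_ge0 => //; apply: ltW.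
clear -rC gle rd md mrd; move: (M + 3)%:R (r%:R) (m%:R) `|g| rC gle rd md mrd => u v w a; lra.
Qed.

(** * The limits defining gamma_k *)

Lemma limf_esup_le_near (R : realType) (f g : R -> \bar R) (F : set_system R) :
  Filter F -> (\forall x \near F, (f x <= g x)%E) ->
  (limf_esup f F <= limf_esup g F)%E.
Proof.
move=> FF fg; rewrite !limf_esupE; apply: le_ereal_inf_tmp => _ [V FV <-].
apply: (@le_trans _ _ (ereal_sup [set f x | x in V `&` [set x | (f x <= g x)%E]])).
  apply: ereal_inf_lbound; exists (V `&` [set x | (f x <= g x)%E]) => //.
  exact: filterI.
apply: ge_ereal_sup => _ [x [Vx fgx] <-].
by apply: le_trans fgx _; apply: ereal_sup_ubound; exists x.
Qed.

Lemma limf_esup_pinfty_ge (R : realType) (f : R -> \bar R) (c : \bar R) (X0 : R) :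
  (forall x, X0 <= x -> (c <= f x)%E) -> (c <= limf_esup f +oo%R)%E.
Proof.
move=> cf; rewrite limf_esupE; apply: le_ereal_inf_tmp => _ [V [M [_ MV]] <-].
apply: (le_trans (cf (Num.max X0 (M + 1)) _)); first by rewrite le_max lexx.
apply: ereal_sup_ubound; exists (Num.max X0 (M + 1)) => //.
by apply: MV; rewrite lt_max ltrDl ltr01 orbT.
Qed.

Lemma log_means_sub (R : realType) (k : nat) (eps1 eps2 X A1 A2 : R) :
  1 <= X -> eps1 <= eps2 -> A2 <= A1 ->
  log_means k eps1 X A1 `<=` log_means k eps2 X A2.
Proof.
move=> X1 e12 A12 _ [f [fF fC] <-]; exists f => //; split => // j jk x /andP[Xx xX].
apply: (le_trans (fC j jk x _)).
  by rewrite Xx (le_trans xX) // ler_powR.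
by rewrite ler_wpM2r // (le_trans _ Xx) // (le_trans ler01).
Qed.

(** The value 0 for an empty set respects monotonicity because the means are nonnegative for X >=
    1. *)
Lemma sup_log_means_mono (R : realType) (k : nat) (eps1 eps2 X A1 A2 : R) :
  1 <= X -> eps1 <= eps2 -> A2 <= A1 ->
  (sup_log_means k eps1 X A1 <= sup_log_means k eps2 X A2)%E.
Proof.
move=> X1 e12 A12; have sub := @log_means_sub R k _ _ _ _ _ X1 e12 A12.
rewrite /sup_log_means; case: eqP => [_|/eqP/set0P[y y1]].
  case: eqP => // /eqP/set0P[y y2]; apply: (@le_trans _ _ y); last exact: ereal_sup_ubound.
  case: y2 => f _ <-; rewrite lee_fin mulr_ge0 ?normc_ge0 // invr_ge0 ln_ge0 //.
rewrite ifF; last by apply/negbTE/set0P; exists y; apply: sub.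
exact: ereal_sup_le.
Qed.

Lemma sup_log_means_ge (R : realType) (k : nat) (eps X A c : R) (f : nat -> R[i]) :
  calF R k f -> satisfies_C k eps X A f ->
  c <= (ln X)^-1 * Normc.normc (psum (fun n => f n / n%:R) X) ->
  (c%:E <= sup_log_means k eps X A)%E.
Proof.
move=> fF fC cf; set y := (X in c <= X) in cf.
have fy : log_means k eps X A y%:E by exists f.
rewrite /sup_log_means ifF; last by apply/negbTE/set0P; exists y%:E.
by apply: (@le_trans _ _ y%:E); [rewrite lee_fin|exact: ereal_sup_ubound].
Qed.

Lemma limf_esup_log_means_mono (R : realType) (k : nat) (eps1 eps2 A1 A2 : R) :
  eps1 <= eps2 -> A2 <= A1 ->
  (limf_esup (fun X : R => sup_log_means k eps1 X A1) +oo%R <=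
   limf_esup (fun X : R => sup_log_means k eps2 X A2) +oo%R)%E.
Proof.
move=> e12 A12; apply: limf_esup_le_near.
near=> X; apply: sup_log_means_mono => //.
Unshelve. all: by end_near. Qed.

Lemma gamma_at_cvg (R : realType) (k : nat) (A : R) :
  cvg (limf_esup (fun X : R => sup_log_means k eps X A) +oo%R @[eps --> (0 : R)^'+]).
Proof.
apply: nondecreasing_at_right_is_cvge; near=> x => e1 e2 _ _ e12.
exact: limf_esup_log_means_mono.
Unshelve. all: by end_near. Qed.

Lemma gamma_cvg (R : realType) (k : nat) : cvg (@gamma_at R k A @[A --> +oo%R]).
Proof.
rewrite -is_cvgeNE; apply: nondecreasing_is_cvge => A2 A1 A21; rewrite leeN2.
apply: lee_lim; [exact: gamma_at_cvg|exact: gamma_at_cvg|].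
by near=> e; apply: limf_esup_log_means_mono.
Unshelve. all: by end_near. Qed.

Lemma gamma_ge (R : realType) (k : nat) (c : R) :
  (forall A eps : R, 1 <= A -> 0 < eps <= 1 ->
   exists X0 : R, forall X, X0 <= X -> exists f : nat -> R[i],
   [/\ calF R k f, satisfies_C k eps X A f &
      c <= (ln X)^-1 * Normc.normc (psum (fun n => f n / n%:R) X)]) ->
  (c%:E <= gamma_ R k)%E.
Proof.
move=> H; apply: lime_ge; first exact: gamma_cvg.
near=> A; apply: lime_ge; first exact: gamma_at_cvg.
have A1 : 1 <= A by near: A; apply: nbhs_pinfty_ge; exact: num_real.
near=> eps; have e01 : 0 < eps <= 1.
  apply/andP; split; near: eps; first exact: nbhs_right_gt.
  exact: nbhs_right_le.
have [X0 HX] := H A eps A1 e01.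
apply: (@limf_esup_pinfty_ge _ _ _ X0) => X /HX[f [fF fC cf]].
exact: sup_log_means_ge fF fC cf.
Unshelve. all: by end_near. Qed.

(** * Size of the least admissible factorial *)

Lemma ln_le_sub1 (R : realType) (x : R) : 0 < x -> ln x <= x - 1.
Proof.
by move=> x0; rewrite -{1}[x](subrK 1) addrC; apply: le_ln1Dx; rewrite ltrBrDl subrr.
Qed.

Lemma ln_add1_le_linear (R : realType) (eta : R) : 0 < eta ->
  exists x0 : R, 1 <= x0 /\ forall x, x0 <= x -> ln x + 1 <= eta * x.
Proof.
move=> eta0; have e2 : 0 < eta / 2 by rewrite divr_gt0.
exists (Num.max 1 (- ln (eta / 2) / (eta / 2))).
split; first by rewrite le_max lexx.
move=> x; rewrite ge_max => /andP[x1]; rewrite ler_pdivrMr // => h.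
have x0 : 0 < x by apply: lt_le_trans x1.
have := ln_le_sub1 (mulr_gt0 e2 x0); rewrite lnM ?posrE //.
move: h; move: (ln x) (ln (eta / 2)) => u v ? ?; lra.
Qed.

(** With F = n! and m = n + 1 this reduces m(k-1) < m! - 1 to k <= n!. *)
Lemma succ_mul_pred_lt (n k F : nat) : (0 < n)%N -> (0 < k)%N -> (k <= F)%N ->
  (n.+1 * k.-1 < (n.+1 * F).-1)%N.
Proof.
move=> n0 k0 kF; have : (n.+1 * k <= n.+1 * F)%N by rewrite leq_mul2l kF orbT.
by case: k k0 {kF} => // k _; rewrite mulnS /=; move: (n.+1 * _)%N (n.+1 * _)%N => u v; lia.
Qed.

(* [m] is about [ln k / ln (ln k)], the least size with [m! > m k]. *)
Lemma factorial_scale (R : realType) (E delta : R) : 0 < E -> 0 < delta ->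
  exists K0 : R, forall k : nat, K0 <= k%:R ->
  [/\ (1 < k)%N, 0 < ln (ln k%:R) / ln k%:R :> R &
    exists m : nat, [/\ (1 < m)%N, (m * k.-1 < (m`!).-1)%N &
      (E - delta) * (ln (ln k%:R) / ln k%:R) < (E - 2 / (m.-1)`!%:R) / m%:R]].
Proof.
move=> E0 delta0.
(* The first bound gives (1 + eta)(1 - eta/2) >= 1, the second keeps E - 2/n! positive, the third
   yields (E - delta)(1 + 2 eta) < E - eta at the end. *)
pose eta := Num.min (1 / 2) (Num.min (E / 2) (delta / (2 * (1 + 2 * E)))).
have E1 : 0 < 2 * (1 + 2 * E) by lra.
have eta0 : 0 < eta by rewrite !lt_min !divr_gt0.
have eta1 : eta <= 1 / 2 by rewrite ge_min lexx.
have etaE : eta <= E / 2 by rewrite !ge_min lexx orbT.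
have etad : eta * (1 + 2 * E) < delta.
  have : eta <= delta / (2 * (1 + 2 * E)) by rewrite !ge_min lexx !orbT.
  by rewrite ler_pdivlMr // => ?; lra.
have eta2 : 0 < eta / 2 by rewrite divr_gt0.
have [x0 [x01 x0P]] := ln_add1_le_linear eta2.
exists (Num.max (2 / eta) (expR (Num.max x0 (expR x0)))) => k.
rewrite ge_max => /andP[k1 k2].
have k0 : 0 < k%:R :> R by apply: lt_le_trans k2; exact: expR_gt0.
set l := ln k%:R : R.
have : Num.max x0 (expR x0) <= l by rewrite -ler_expR lnK.
rewrite ge_max => /andP[l1 l2].
have l0 : 0 < l by lra.
set la := ln l.
have la1 : x0 <= la by rewrite -ler_expR lnK.
have la0 : 0 < la by lra.
have hl := x0P _ l1; have hla := x0P _ la1; rewrite -/la in hl.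
have r0 : 0 < la / l by rewrite divr_gt0.
have r0' : 0 < l / la by rewrite divr_gt0.
have q2 : 2 <= eta * (l / la) by rewrite mulrA ler_pdivlMr //; lra.
have v0 : 0 <= (1 + eta) * (l / la) by rewrite mulr_ge0 ?(ltW r0') //; lra.
(* n is just above (1 + eta) ln k / ln ln k: large enough that n! >= k, while m = n + 1 stays below
   (1 + 2 eta) ln k / ln ln k. *)
have /andP[v1 v2] := truncn_itv v0; set t := Num.truncn _ in v1 v2.
pose n := t.+1.
have n0 : 0 < n%:R :> R by rewrite ltr0n.
have kN : (0 < k)%N by rewrite -(ltr0n R).
have kn : k%:R <= n`!%:R :> R.
  rewrite -ler_ln ?posrE ?ltr0n ?fact_gt0 //; apply: le_trans _ (ln_fact_ge R n).
  have ln_n : la - ln la <= ln n%:R.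
    rewrite -ln_div ?posrE // ler_ln ?posrE //; apply: le_trans _ (ltW v2).
    by rewrite ler_peMl ?(ltW r0') //; lra.
  have h1 : la * (1 - eta / 2) <= ln n%:R - 1 by lra.
  have -> : n%:R * ln n%:R - n%:R = n%:R * (ln n%:R - 1) :> R by ring.
  apply: (@le_trans _ _ (((1 + eta) * (l / la)) * (la * (1 - eta / 2)))).
    have -> : (1 + eta) * (l / la) * (la * (1 - eta / 2)) = l * ((1 + eta) * (1 - eta / 2)).
      by field; rewrite gt_eqF.
    rewrite -/l ler_peMr ?(ltW l0) //; nra.
  apply: ler_pM => //; last exact: ltW.
  by rewrite mulr_ge0 ?(ltW la0) //; lra.
have k_gt1 : (1 < k)%N.
  by rewrite -(ltr_nat R); apply: lt_le_trans k1; rewrite ltr_pdivlMr //; lra.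
split => //; exists n.+1; split => //.
  by rewrite factS; apply: succ_mul_pred_lt => //; rewrite -(ler_nat R).
have m0 : 0 < n.+1%:R :> R by [].
have m_le : n.+1%:R <= (1 + 2 * eta) * (l / la).
  have -> : n.+1%:R = t%:R + 2 :> R by rewrite /n -!natr1; ring.
  have -> : (1 + 2 * eta) * (l / la) = (1 + eta) * (l / la) + eta * (l / la) by ring.
  exact: lerD.
have f_le : 2 / n`!%:R <= eta.
  rewrite ler_pdivrMr ?ltr0n ?fact_gt0 // mulrC; move: k1; rewrite ler_pdivrMr // => k1.
  by apply: le_trans k1 _; rewrite ler_pM2r.
rewrite /= ltr_pdivlMr //.
have [neg|pos] := lerP (E - delta) 0.
  apply: (@le_lt_trans _ _ 0); last by lra.
  by rewrite mulr_le0_ge0 // mulr_le0_ge0 // ltW.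
apply: (@le_lt_trans _ _ ((E - delta) * (la / l) * ((1 + 2 * eta) * (l / la)))).
  by rewrite ler_wpM2l // mulr_ge0 // ltW.
have -> : (E - delta) * (la / l) * ((1 + 2 * eta) * (l / la)) = (E - delta) * (1 + 2 * eta).
  by field; rewrite !gt_eqF.
apply: (@lt_le_trans _ _ (E - eta)); last by lra.
have : eta * (E - delta) <= eta * E by rewrite ler_pM2l //; lra.
move: etad; clear; move=> ? ?; lra.
Qed.

Lemma gamma_lower_bound (R : realType) (delta : R) : 0 < delta ->
  \forall k \near \oo, 0 < ln (ln k%:R) / ln k%:R :> R /\
    (((expR (euler_mascheroni R) - delta) * (ln (ln k%:R) / ln k%:R))%:E
       <= gamma_ R k)%E.
Proof.
move=> delta0.
have [K0 K0P] := factorial_scale (expR_gt0 (euler_mascheroni R)) delta0.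
near=> k; have [k1 r0 [m [m1 mk gm]]] : [/\ (1 < k)%N, 0 < ln (ln k%:R) / ln k%:R :> R &
    exists m : nat, [/\ (1 < m)%N, (m * k.-1 < (m`!).-1)%N &
      (expR (euler_mascheroni R) - delta) * (ln (ln k%:R) / ln k%:R) < (expR (euler_mascheroni R) - 2 / (m.-1)`!%:R) / m%:R]].
  by apply: K0P; near: k; exact: nbhs_infty_ger.
split=> //; apply: gamma_ge => A eps A1 eps01.
exact: good_functions_exist k1 m1 mk A1 eps01 gm.
Unshelve. all: by end_near. Qed.

Theorem mainTheorem4 (R : realType) :
  exists o : nat -> R,
    o @ \oo --> (0 : R) /\
    \forall k \near \oo,
      (((expR (euler_mascheroni R) + o k) * (ln (ln k%:R) / ln k%:R))%:E
         <= gamma_ R k)%E.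
Proof.
pose E := expR (euler_mascheroni R).
pose rate (k : nat) : R := ln (ln k%:R) / ln k%:R.
(* The cut at 0 discards any excess of gamma_k over the claimed size, so lower bounds alone make [o]
   tend to 0. If gamma_k is +oo the inequality is trivial, and -oo is ruled out by the lower
   bound. *)
exists (fun k => if gamma_ R k is r%:E then Num.min 0 (r / rate k - E) else 0).
split.
  apply/cvgrPdist_le => eps eps0; near=> k.
  have [r0 gk] : 0 < rate k /\ (((E - eps) * rate k)%:E <= gamma_ R k)%E.
    by near: k; exact: gamma_lower_bound.
  case: (gamma_ R k) gk => [r|_|//]; last by rewrite subr0 normr0 ltW.
  rewrite lee_fin sub0r normrN -ler_pdivlMr // => gr.
  rewrite ler0_norm ?ge_min ?lexx // lerNl le_min; apply/andP; split; lra.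
near=> k.
have [r0 gk] : 0 < rate k /\ (((E - 1) * rate k)%:E <= gamma_ R k)%E.
  by near: k; exact: gamma_lower_bound.
rewrite -/(rate k) -/E; case: (gamma_ R k) gk => [r|_|//]; last by rewrite leey.
rewrite !lee_fin => _; rewrite -ler_pdivlMr // addrC -lerBrDr ge_min lexx orbT.
by [].
Unshelve. all: by end_near. Qed.
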